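(* Let $q\in(1,2]$, let $Y$ be a Banach space, $y\in Y$, $\lambda\in(0,\infty)$, $\nu\in(0,1)$, and suppose the following. (1) $\mathcal{D}_y:Y\to[0,\infty]$ is proper, coercive, lower semicontinuous and convex, and $A:L^q(\Omega)\to Y$ is linear and bounded. (2) $\mathcal{G}:L^q(\Omega)\to[0,\infty]$ is the generative prior (defined in the context), where $Z:\Theta\to\mathbb{R}^{N_c}$ is linear and bounded and the $\mathcal{J}_l:M^l\to[0,\infty]$ are weak* lower semicontinuous with $\mathcal{J}_l(0)=0$. (3) $\mathcal{R}:L^q(\Omega)\to[0,\infty]$ is proper and weakly lower semicontinuous, and there exist a closed subspace $U\subset L^q(\Omega)$, a continuous linear projection $P_U:L^q(\Omega)\to U$ onto $U$ and a constant $C>0$ such that $\mathcal{R}(u)=\mathcal{R}(u+w)$ and $\|u-P_Uu\|_q\le C\,\mathcal{R}(u)$ for all $u\in L^q(\Omega)$, $w\in U$; moreover, either (a) $U$ is finite dimensional, or (b) $U\cap\ker(A)$ admits a complement $W$ in $U$ and there is $D>0$ with $\|u\|_q\le D\|Au\|_Y$ for all $u\in W$. Assume there exists $\hat u\in L^q(\Omega)$ such that $\mathcal{R}(\hat u)<\infty$ and $\mathcal{D}_y(A\hat u)<\infty$. Then the problem $$\min_{u,v\in L^q(\Omega)}\mathcal{E}_y(u,v),\qquad \mathcal{E}_y(u,v)=\lambda\mathcal{D}_y(Au)+s_{\mathcal R}(\nu)\mathcal{R}(u-v)+s_{\mathcal G}(\nu)\mathcal{G}(v),$$ with $s_{\mathcal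 R}(\nu)=\frac{\nu}{\min(\nu,1-\nu)}$ and $s_{\mathcal G}(\nu)=\frac{1-\nu}{\min(\nu,1-\nu)}$, admits a minimum, i.e. there is $(u,v)\in L^q(\Omega)^2$ at which the infimum of $\mathcal{E}_y$ over $L^q(\Omega)^2$ is attained.
   Context: Domains and measures. $\Omega,\Sigma\subset\mathbb{R}^d$ are bounded domains, i.e. bounded, open and simply connected sets, with $0\in\Sigma$. For sets, $A-B=\{x-y: x\in A,\ y\in B\}$. Put $\Omega^0=\Omega$, $\Omega^1=\Omega-\Sigma$ and $\Omega^{l+1}=\Omega^l-\Sigma$. For $\omega\subset\mathbb{R}^d$, $C_0(\omega)$ is the closure of $C_c(\omega)$ in the uniform norm, and $(\mathcal{M}(\omega),\|\cdot\|_{\mathcal M})$ is its dual space (finite Radon measures with the total variation norm). For bounded $\omega$, a function $f\in L^q(\omega)$ is identified with the element $\phi\mapsto\int_\omega f\phi\,dx$ of $\mathcal{M}(\omega)$; $\|\cdot\|_q$ is the $L^q$-norm. A functional is coercive if it tends to $\infty$ along every sequence whose norm tends to $\infty$, and proper if it is not identically $\infty$. Convolution. For $l\ge1$, $\mu\in\mathcal{M}(\Omega^l)$ and $g\in L^2(\Sigma)$, $\mu*g$ denotes the unique function, belonging to $L^q(\Omega^{l-1})$ for every $q\in(1,2]$, with $\int_{\Omega^{l-1}}(\mu*g)\phi\,dx=\int_{\Omega^l}\int_\Sigma\tilde\phi(x+y)g(x)\,dx\,d\mu(y)$ for all $\phi\in C_c(\Omega^{l-1})$, where $\tilde\phi$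 is the extension of $\phi$ by zero to $\mathbb{R}^d$. (It is known that such a function exists and that $\|\mu*g\|_q\le C\|\mu\|_{\mathcal M}\|g\|_2$ with a constant $C$ independent of $\mu,g$.) Network. Let $L\in\mathbb{N}$ be the number of layers, $N_1,\dots,N_L\in\mathbb{N}$ and $N_0=1$. For $l=1,\dots,L$ let $E^l\subset\{1,\dots,N_l\}\times\{1,\dots,N_{l-1}\}$ be such that for each $n\in\{1,\dots,N_l\}$ there is some $k$ with $(n,k)\in E^l$. Set $M^l=\mathcal{M}(\Omega^l)^{N_l}$, $M=M^1\times\dots\times M^L$, $\Theta^l=L^2(\Sigma)^{|E^l|}$ with elements $\theta^l=(\theta^l_{n,k})_{(n,k)\in E^l}$, and $\Theta=\Theta^1\times\dots\times\Theta^L$. Define $\mu^1*_1\theta^1=\sum_{n=1}^{N_1}\mu^1_n*\theta^1_{n,1}\in L^q(\Omega)$ and, for $l=2,\dots,L$, $\mu^l*_l\theta^l=\big(\sum_{n:(n,k)\in E^l}\mu^l_n*\theta^l_{n,k}\big)_{k=1}^{N_{l-1}}\in M^{l-1}$. Generative prior. With $Z$ ($N_c\in\mathbb{N}$) and $\mathcal{J}_l$, $l=1,\dots,L-1$, as in the claim, put $\|\mu\|_{\mathcal M}=\sum_{l=1}^L\sum_{n=1}^{N_l}\|\mu^l_n\|_{\mathcal M}$ and $G(\mu,\theta)=\|\mu\|_{\mathcal M}+\sum_{l=2}^L\mathcal{J}_{l-1}(\mu^{l-1}-\mu^l*_l\theta^l)$. For $v\in L^q(\Omega)$ let $F(v)$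 be the set of all $(\mu,\theta)\in M\times\Theta$ with $v=\mu^1*_1\theta^1$, $\|\theta^l_{n,k}\|_2\le1$ for all $l$ and all $(n,k)\in E^l$, and $Z\theta=0$. Then $\mathcal{G}(v)=\inf_{(\mu,\theta)\in F(v)}G(\mu,\theta)$, with $\mathcal{G}(v)=\infty$ if $F(v)=\emptyset$. *)

(* Defs.v *)
From HB Require Import structures.
From mathcomp Require Import all_boot all_order all_algebra.
From mathcomp Require Import all_classical all_reals all_analysis.
From mathcomp Require Import ess_sup_inf measurable_realfun.
Set Implicit Arguments.
Unset Strict Implicit.
Unset Printing Implicit Defensive.
Import Order.TTheory GRing.Theory Num.Theory.
Import numFieldNormedType.Exports.
Local Open Scope classical_set_scope.
Local Open Scope ring_scope.

(* The Borel sigma-algebra of R^n. *)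
HB.instance Definition _ (R : realType) (n : nat) :=
  @isMeasurable.Build (sigma_display (@open 'rV[R]_n)) 'rV[R]_n
    <<s (@open 'rV[R]_n) >> (@sigma_algebra0 _ setT _) (@sigma_algebraC _ _)
    (@sigma_algebra_bigcup _ setT _).

Section borel_rV.
Variable R : realType.

Lemma open_measurable_rV n (U : set 'rV[R]_n) : open U -> measurable U.
Proof. exact: sub_sigma_algebra. Qed.

Lemma measurable_coord n (i : 'I_n) :
  measurable_fun [set: 'rV[R]_n] (fun v : 'rV[R]_n => v ord0 i).
Proof.
apply: (measurability _ (RGenOInfty.measurableE R)) => //.
move=> _ [_ [x ->] <-]; rewrite setTI; apply: open_measurable_rV.
rewrite set_itvE.
apply: (@open_comp _ _ (fun v : 'rV[R]_n => v ord0 i) [set y | x < y]);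
  last exact: open_gt.
by move=> v _; exact: coord_continuous.
Qed.

Let box n (c : 'rV[rat]_n * rat) : set 'rV[R]_n :=
  [set v | forall i, `|v ord0 i - ratr (c.1 ord0 i)| < ratr c.2].

Lemma measurable_fun_rV d (T : measurableType d) n (f : T -> 'rV[R]_n) :
  (forall i, measurable_fun setT (fun x => f x ord0 i)) ->
  measurable_fun setT f.
Proof.
move=> mf; apply: (@measurability _ _ _ _ _ _ (@open 'rV[R]_n)) => //.
move=> _ [U oU <-]; rewrite setTI.
have -> : U = \bigcup_(c in [set c | box c `<=` U]) box c.
  apply/seteqP; split => [v Uv|v [c cU /cU//]].
  have /nbhs_ballP[e /= e0 eU] : nbhs v U by exact: open_nbhs_nbhs.
  have /rat_in_itvoo[r] : 0 < e / 2 by rewrite divr_gt0.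
  rewrite in_itv/= => /andP[r0 re].
  have qP i : exists q : rat, `|v ord0 i - ratr q| < ratr r.
    have /rat_in_itvoo[q] : v ord0 i - ratr r < v ord0 i + ratr r.
      by rewrite ltrD2l gtrN.
    rewrite in_itv/= => /andP[q1 q2]; exists q.
    by rewrite distrC ltr_distl q1 q2.
  exists (\row_i projT1 (cid (qP i)), r) => /=.
    move=> w wc; apply: eU; split => // i j; rewrite ord1.
    rewrite /ball/= (splitr e).
    have := wc j; rewrite /= mxE => wj.
    apply: (le_lt_trans (ler_distD (ratr (projT1 (cid (qP j)))) _ _)).
    apply: ltrD; first exact: (lt_trans (projT2 (cid (qP j)))).
    by rewrite distrC; exact: (lt_trans wj).
  by move=> i/=; rewrite mxE; exact: (projT2 (cid (qP i))).
rewrite preimage_bigcup bigcup_mkcond.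
apply: countable_bigcupT_measurable => //.
move=> c; case: ifP => // _.
have -> : f @^-1` box c = \bigcap_(i in [set: 'I_n])
    ((fun x => f x ord0 i) @^-1` ball (ratr (c.1 ord0 i) : R) (ratr c.2)).
  apply/seteqP; split => x /= h i.
    by move=> _; rewrite /ball/= distrC; exact: h.
  by rewrite distrC; exact: h.
apply: fin_bigcap_measurable => // i _.
rewrite -[X in measurable X]setTI; apply: mf => //.
exact: measurable_ball.
Qed.

Section leb_step.
Variables (n : nat) (mu : {sigma_finite_measure set 'rV[R]_n -> \bar R}).

Definition cons_rV (p : measurableTypeR R * 'rV[R]_n) : 'rV[R]_n.+1 :=
  row_mx (p.1)%:M p.2.

Lemma measurable_cons_rV : measurable_fun setT cons_rV.
Proof.
apply: measurable_fun_rV => i; case: (@splitP 1 n i) => j ij.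
- rewrite (_ : (fun p => _) = fst); first exact: measurable_fst.
  apply/funext => p; rewrite (_ : i = lshift n j); last exact/val_inj.
  by rewrite [LHS]row_mxEl mxE !ord1 eqxx mulr1n.
- rewrite (_ : (fun p => _) = (fun v : 'rV[R]_n => v ord0 j) \o snd).
    exact: (measurableT_comp (measurable_coord j) measurable_snd).
  apply/funext => p; rewrite (_ : i = rshift 1 j); last exact/val_inj.
  by rewrite [LHS]row_mxEr.
Qed.

Definition leb_cons := pushforward (@lebesgue_measure R \x mu)%E cons_rV.


Let leb_cons0 : leb_cons set0 = 0%E.
Proof. by rewrite /leb_cons /pushforward preimage_set0 measure0. Qed.

Let leb_cons_ge0 A : (0 <= leb_cons A)%E.
Proof. by rewrite /leb_cons /pushforward; exact: measure_ge0. Qed.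

Let leb_cons_sigma_additive : semi_sigma_additive leb_cons.
Proof.
move=> F mF tF mUF; rewrite /leb_cons /pushforward preimage_bigcup.
apply: measure_semi_sigma_additive.
- by move=> k; rewrite -[X in measurable X]setTI; exact: measurable_cons_rV.
- apply/trivIsetP => /= i j _ _ ij; rewrite -preimage_setI.
  by move/trivIsetP : tF => /(_ _ _ _ _ ij) ->//; rewrite preimage_set0.
- rewrite -preimage_bigcup -[X in measurable X]setTI.
  exact: measurable_cons_rV.
Qed.

HB.instance Definition _ := isMeasure.Build _ _ _
  leb_cons leb_cons0 leb_cons_ge0 leb_cons_sigma_additive.

Let leb_cons_sigma_finite : sigma_finite setT leb_cons.
Proof.
have /sigma_finiteP[F [FT ndF mF]] := sigma_finiteT mu.
have /sigma_finiteP[G [GT ndG mG]] := sigma_finiteT (@lebesgue_measure R).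
pose hd (v : 'rV[R]_n.+1) : measurableTypeR R := v ord0 ord0.
pose tl (v : 'rV[R]_n.+1) : 'rV[R]_n := \row_i v ord0 (lift ord0 i).
have mhd : measurable_fun setT hd by exact: measurable_coord.
have mtl : measurable_fun setT tl.
  apply: measurable_fun_rV => i; under eq_fun do rewrite mxE.
  exact: measurable_coord.
have hdK p : hd (cons_rV p) = p.1.
  rewrite /hd /cons_rV (_ : ord0 = lshift n (ord0 : 'I_1)); last exact/val_inj.
  by rewrite [LHS]row_mxEl mxE eqxx mulr1n.
have tlK p : tl (cons_rV p) = p.2.
  apply/rowP => i; rewrite mxE /cons_rV.
  by rewrite (_ : lift ord0 i = rshift 1 i) 1?[LHS]row_mxEr//; exact/val_inj.
exists (fun k => hd @^-1` G k `&` tl @^-1` F k).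
  apply/seteqP; split => // v _.
  have : setT (hd v) by []. rewrite GT => -[i _ Gi].
  have : setT (tl v) by []. rewrite FT => -[j _ Fj].
  exists (maxn i j) => //; split.
    by have /subsetPset := ndG _ _ (leq_maxl i j); exact.
  by have /subsetPset := ndF _ _ (leq_maxr i j); exact.
move=> k; have [mGk Goo] := mG k; have [mFk Foo] := mF k; split.
  apply: measurableI.
    by rewrite -[X in measurable X]setTI; exact: mhd.
  by rewrite -[X in measurable X]setTI; exact: mtl.
rewrite /leb_cons /pushforward.
rewrite (_ : _ @^-1` _ = G k `*` F k); last first.
  by apply/seteqP; split => p /=; rewrite hdK tlK.
by rewrite product_measure1E// lte_mul_pinfty// ge0_fin_numE.
Qed.

HB.instance Definition _ := Measure_isSigmaFinite.Build _ _ _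
  leb_cons leb_cons_sigma_finite.

End leb_step.


(* Lebesgue measure on the Borel sets of R^n, as an iterated product; see
   lebesgue_rV_box. *)
Fixpoint lebesgue_rV (n : nat) :
    {sigma_finite_measure set 'rV[R]_n -> \bar R} :=
  if n is m.+1 then leb_cons (lebesgue_rV m) else \d_ (0 : 'rV[R]_0).

End borel_rV.

Lemma lebesgue_rV_box (R : realType) n (a b : 'rV[R]_n) :
  (forall i, a ord0 i <= b ord0 i) ->
  lebesgue_rV R n [set v | forall i, a ord0 i <= v ord0 i <= b ord0 i] =
  (\prod_i (b ord0 i - a ord0 i))%:E.
Proof.
elim: n a b => [a b _|n IHn a b ab].
  by rewrite big_ord0 /= diracE mem_set// => -[].
pose tl (v : 'rV[R]_n.+1) : 'rV[R]_n := \row_i v ord0 (lift ord0 i).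
have mbox : measurable [set v : 'rV[R]_n |
    forall i, tl a ord0 i <= v ord0 i <= tl b ord0 i].
  rewrite (_ : mkset _ = \bigcap_(i in [set: 'I_n])
      (fun v : 'rV[R]_n => v ord0 i) @^-1` `[tl a ord0 i, tl b ord0 i]).
    apply: fin_bigcap_measurable => // i _; rewrite -[X in measurable X]setTI.
    exact: measurable_coord.
  apply/seteqP; split => v h i /=; first by rewrite in_itv/= h.
  by have := h i I; rewrite /= in_itv.
rewrite /= /leb_cons /pushforward.
rewrite (_ : _ @^-1` _ = `[a ord0 ord0, b ord0 ord0] `*` [set v : 'rV[R]_n |
    forall i, tl a ord0 i <= v ord0 i <= tl b ord0 i]); last first.
  have h0 (p : measurableTypeR R * 'rV[R]_n) : cons_rV p ord0 ord0 = p.1.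
    rewrite (_ : ord0 = lshift n (ord0 : 'I_1)); last exact/val_inj.
    by rewrite [LHS]row_mxEl mxE eqxx mulr1n.
  have hS (p : measurableTypeR R * 'rV[R]_n) i :
      cons_rV p ord0 (lift ord0 i) = p.2 ord0 i.
    by rewrite (_ : lift ord0 i = rshift 1 i) 1?[LHS]row_mxEr//; exact/val_inj.
  apply/seteqP; split => [p /= h|p /= [p1 p2] i].
    split; first by rewrite in_itv/= -h0.
    by move=> i; rewrite !mxE -hS.
  have [j ->|->] := fintype.unliftP ord0 i.
    by rewrite hS; have := p2 j; rewrite !mxE.
  by rewrite h0; move: p1; rewrite in_itv.
rewrite product_measure1E// IHn; last by move=> i; rewrite !mxE.
rewrite [X in (X * _)%E](_ : _ =
  lebesgue_measure `[a ord0 ord0, b ord0 ord0]%classic)//.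
rewrite lebesgue_measure_itv/= lte_fin big_ord_recl EFinM.
congr (_ * _)%E.
  case: ltP => // ba; apply/esym/eqP; rewrite eqe subr_eq0.
  by rewrite eq_le ba ab.
by congr EFin; apply: eq_bigr => i _; rewrite !mxE.
Qed.

Lemma ae_eq_Lnorm d (T : measurableType d) (R : realType)
    (mu : {measure set T -> \bar R}) (p : \bar R) (f g : {mfun T >-> R}) :
  f = g %[ae mu] -> Lnorm mu p (EFin \o f) = Lnorm mu p (EFin \o g).
Proof.
move=> fg; rewrite unlock; case: p => [r||].
- congr poweR; apply: ge0_ae_eq_integral => //.
  + apply/(measurableT_comp (measurable_poweR _))/measurableT_comp => //.
    exact/measurable_EFinP.
  + apply/(measurableT_comp (measurable_poweR _))/measurableT_comp => //.
    exact/measurable_EFinP.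
  + by move=> x _; exact: poweR_ge0.
  + by move=> x _; exact: poweR_ge0.
  + by apply: filterS fg => x /= /(_ I) ->.
- case: ifPn => // _; apply: eq_ess_sup.
  by apply: filterS fg => x /= /(_ I) ->.
- case: ifPn => // _; apply: eq_ess_inf.
  by apply: filterS fg => x /= /(_ I) ->.
Qed.

(* The library's LspaceType carries no module structure, so L^p is rebuilt as
   the quotient of LfunType by almost everywhere equality. *)
Section Lp_space.
Context d (T : measurableType d) (R : realType).
Variables (mu : {measure set T -> \bar R}) (p : \bar R) (p1 : (1 <= p)%E).
Local Notation ty := (LfunType mu p1).
Local Open Scope quotient_scope.

Definition Lfun_ae_eq (f g : ty) : bool := `[< f = g %[ae mu] >].

Let Lfun_ae_eq_refl : reflexive Lfun_ae_eq.
Proof. by move=> f; apply/asboolP; exact: ae_eq_refl. Qed.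

Let Lfun_ae_eq_sym : symmetric Lfun_ae_eq.
Proof.
by move=> f g; apply/idP/idP => /asboolP fg; apply/asboolP/ae_eq_sym.
Qed.

Let Lfun_ae_eq_trans : transitive Lfun_ae_eq.
Proof.
move=> f g h /asboolP gf /asboolP fh; apply/asboolP; exact: ae_eq_trans gf fh.
Qed.

Canonical Lfun_ae_equiv :=
  EquivRel Lfun_ae_eq Lfun_ae_eq_refl Lfun_ae_eq_sym Lfun_ae_eq_trans.

Definition Lp : Type := {eq_quot Lfun_ae_eq}.
HB.instance Definition _ := Choice.on Lp.
HB.instance Definition _ := EqQuotient.on Lp.

Definition Lp_fun (u : Lp) : T -> R := repr u.
Coercion Lp_fun : Lp >-> Funclass.

Lemma Lp_eqP (f g : ty) : \pi_Lp f = \pi_Lp g <-> f = g %[ae mu].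
Proof.
split; first by move=> /eqP; rewrite eqmodE => /asboolP.
by move=> fg; apply/eqP; rewrite eqmodE; exact/asboolP.
Qed.

Lemma repr_Lp (f : ty) : repr (\pi_Lp f) = f %[ae mu].
Proof. by apply/Lp_eqP; rewrite reprK. Qed.

Definition Lp_zero : Lp := \pi_Lp 0.
Definition Lp_add (u v : Lp) : Lp := \pi_Lp (repr u + repr v).
Definition Lp_opp (u : Lp) : Lp := \pi_Lp (- repr u).
Definition Lp_scale (a : R) (u : Lp) : Lp := \pi_Lp (a *: repr u).

Let piD f g : Lp_add (\pi_Lp f) (\pi_Lp g) = \pi_Lp (f + g).
Proof.
apply/Lp_eqP; apply: filterS2 (repr_Lp f) (repr_Lp g) => x /= fx gx _.
by rewrite /GRing.add/= fx// gx.
Qed.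

Let piN f : Lp_opp (\pi_Lp f) = \pi_Lp (- f).
Proof.
apply/Lp_eqP; apply: filterS (repr_Lp f) => x /= fx _.
by rewrite /GRing.opp/= fx.
Qed.

Let piZ a f : Lp_scale a (\pi_Lp f) = \pi_Lp (a *: f).
Proof.
apply/Lp_eqP; apply: filterS (repr_Lp f) => x /= fx _.
by rewrite /GRing.scale/= fx.
Qed.

Let LpE (u : Lp) : exists f, u = \pi_Lp f.
Proof. by exists (repr u); rewrite reprK. Qed.

Let Lp_addA : associative Lp_add.
Proof.
by move=> u v w; have [f ->] := LpE u; have [g ->] := LpE v;
  have [h ->] := LpE w; rewrite !piD addrA.
Qed.

Let Lp_addC : commutative Lp_add.
Proof. by move=> u v; rewrite /Lp_add addrC. Qed.

Let Lp_add0 : left_id Lp_zero Lp_add.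
Proof. by move=> u; have [f ->] := LpE u; rewrite piD add0r. Qed.

Let Lp_addN : left_inverse Lp_zero Lp_opp Lp_add.
Proof. by move=> u; have [f ->] := LpE u; rewrite piN piD addNr. Qed.

HB.instance Definition _ := GRing.isZmodule.Build Lp
  Lp_addA Lp_addC Lp_add0 Lp_addN.

Let Lp_scaleA a b u : Lp_scale a (Lp_scale b u) = Lp_scale (a * b) u.
Proof. by have [f ->] := LpE u; rewrite !piZ scalerA. Qed.

Let Lp_scale1 : left_id 1 Lp_scale.
Proof. by move=> u; rewrite /Lp_scale scale1r reprK. Qed.

Let Lp_scaleDr : right_distributive Lp_scale +%R.
Proof.
move=> a u v; have [f ->] := LpE u; have [g ->] := LpE v.
by rewrite [_ + _]piD !piZ [RHS]piD scalerDr.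
Qed.

Let Lp_scaleDl u : {morph Lp_scale^~ u : a b / a + b}.
Proof.
by move=> a b; have [f ->] := LpE u; rewrite !piZ [RHS]piD scalerDl.
Qed.

HB.instance Definition _ := GRing.Zmodule_isLmodule.Build R Lp
  Lp_scaleA Lp_scale1 Lp_scaleDr Lp_scaleDl.

Definition Lp_norm (u : Lp) : R := fine (Lnorm mu p (EFin \o u)).

Let Lp_norm_pi (f : ty) : Lp_norm (\pi_Lp f) = fine (Lnorm mu p (EFin \o f)).
Proof. by rewrite /Lp_norm (ae_eq_Lnorm _ (repr_Lp f)). Qed.

Let Lp_normD u v : Lp_norm (u + v) <= Lp_norm u + Lp_norm v.
Proof. by rewrite [in leLHS]/GRing.add/= Lp_norm_pi; exact: ler_LnormD. Qed.

Let Lp_normZ a u : Lp_norm (a *: u) = `|a| * Lp_norm u.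
Proof.
rewrite [in LHS]/GRing.scale/= Lp_norm_pi; apply: EFin_inj.
by rewrite finite_norm_fine EFinM /Lp_norm finite_norm_fine -LnormZ.
Qed.

Let Lp_norm_eq0 u : Lp_norm u = 0 -> u = 0.
Proof.
by move=> /fine_Lnormr_eq0 u0; rewrite -[LHS]reprK; exact/Lp_eqP.
Qed.

HB.instance Definition _ := Lmodule_isNormed.Build R Lp
  Lp_normD Lp_normZ Lp_norm_eq0.

End Lp_space.

Section dual_space.
Context {R : realType} {V : normedModType R}.

Definition dual_pred : {pred V -> R^o} :=
  mem [set m : V -> R^o | linear m /\ continuous m].

Record dual := Dual { dual_fun :> V -> R^o; _ : dual_fun \in dual_pred }.

HB.instance Definition _ := [isSub for dual_fun].
HB.instance Definition _ := gen_eqMixin dual.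
HB.instance Definition _ := [Choice of dual by <:].

Let dual_submod_closed : submod_closed dual_pred.
Proof.
split.
  rewrite inE; split; first by move=> a x y /=; rewrite scaler0 addr0.
  by move=> x; exact: cvg_cst.
move=> a f g /[!inE] -[lf cf] [lg cg]; split.
  move=> b x y; rewrite -[LHS]/(a *: f (b *: x + y) + g (b *: x + y)).
  rewrite -[RHS]/(b *: (a *: f x + g x) + (a *: f y + g y)) lf lg.
  by rewrite !scalerDr !scalerA [b * a]mulrC addrACA.
move=> x; exact: (cvgD (cvgZ (cvg_cst a) (cf x)) (cg x)).
Qed.

HB.instance Definition _ := GRing.isSubmodClosed.Build R (V -> R^o) dual_pred
  dual_submod_closed.
HB.instance Definition _ := [SubChoice_isSubLmodule of dual by <:].

Definition dual_norm (m : dual) : R :=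
  sup [set `|m x| | x in [set x | `|x| <= 1]].

End dual_space.
Arguments dual {R} V.

Definition weak_topology {R : realType} (V : normedModType R) : Type :=
  @initial_topology V {ptws dual V -> R} (fun x m => m x).

Definition weak_star_topology {R : realType} (V : normedModType R) : Type :=
  @initial_topology (dual V) {ptws V -> R} (fun m x => m x).


(* For an open w, C_c(w) and C_0(w) are represented by the extensions by zero of
   their elements to R^n; the uniform norm is unchanged by this extension. *)
Section continuous_functions.
Context {R : realType} {n : nat}.
Implicit Types (w : set 'rV[R]_n) (f : 'rV[R]_n -> R^o).

Definition tsupport f : set 'rV[R]_n := closure [set x | f x != 0].

Definition Cc w : set ('rV[R]_n -> R^o) :=
  [set f | [/\ continuous f, compact (tsupport f) & tsupport f `<=` w]].

Definition C0_pred w : {pred 'rV[R]_n -> R^o} := mem [set f |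
  forall e, 0 < e -> exists2 g, Cc w g & forall x, `|f x - g x| <= e].

Record C0 w := MkC0 { C0_fun :> 'rV[R]_n -> R^o; _ : C0_fun \in C0_pred w }.

HB.instance Definition _ w := [isSub for @C0_fun w].
HB.instance Definition _ w := gen_eqMixin (C0 w).
HB.instance Definition _ w := [Choice of C0 w by <:].

Let Cc0 w : Cc w 0.
Proof.
have s0 : tsupport 0 = set0.
  rewrite /tsupport (_ : mkset _ = set0) ?closure0//.
  by apply/seteqP; split => x //=; rewrite eqxx.
split; first exact: (@cst_continuous _ _ (0 : R^o)).
  by rewrite s0; exact: compact0.
by rewrite s0.
Qed.

Let CcZD w a f g : Cc w f -> Cc w g -> Cc w (a *: f + g).
Proof.
move=> [cf kf sf] [cg kg sg].
have sfg : tsupport (a *: f + g) `<=` tsupport f `|` tsupport g.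
  rewrite /tsupport -closureU; apply: closure_subset => x /=.
  rewrite {1}/GRing.add/= {1}/GRing.scale/=.
  have [f0|] := eqVneq (f x) 0; last by left.
  by rewrite f0 scaler0 add0r; right.
split.
- move=> x; exact: (cvgD (cvgZ (cvg_cst a) (cf x)) (cg x)).
- exact: (@subclosed_compact _ _ _ (@closed_closure _ _) (compactU kf kg) sfg).
- by move=> x /sfg[/sf|/sg].
Qed.

Let C0_submod_closed w : submod_closed (C0_pred w).
Proof.
split.
  rewrite inE => e e0; exists 0; first exact: Cc0.
  by move=> x; rewrite subrr normr0 ltW.
move=> a f g /[!inE] fw gw e e0.
have [f' f'w ff'] := fw (e / 2 / (`|a| + 1))
  ltac:(by rewrite !divr_gt0// ltr_wpDl).
have [g' g'w gg'] := gw (e / 2) ltac:(by rewrite divr_gt0).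
exists (a *: f' + g'); first exact: CcZD.
move=> x; rewrite (_ : _ - _ = a * (f x - f' x) + (g x - g' x)); last first.
  rewrite -[LHS]/(a * f x + g x - (a * f' x + g' x)).
  by rewrite mulrBr opprD addrACA.
rewrite [leRHS]splitr (le_trans (ler_normD _ _))// lerD// normrM.
rewrite (le_trans (ler_wpM2l _ (ff' x)))// mulrA ler_pdivrMr ?ltr_wpDl//.
by rewrite mulrC ler_wpM2l ?lerDl// divr_ge0 ?ltW.
Qed.

HB.instance Definition _ w := GRing.isSubmodClosed.Build R ('rV[R]_n -> R^o)
  (C0_pred w) (C0_submod_closed w).
HB.instance Definition _ w := [SubChoice_isSubLmodule of C0 w by <:].

Definition C0_norm w (f : C0 w) : R := sup (range (fun x => `|f x|)).

Let C0_has_sup w (f : C0 w) : has_sup (range (fun x => `|f x|)).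
Proof.
split; first by exists `|f 0|, 0.
have : (f : _ -> _) \in C0_pred w by exact: valP.
rewrite inE => /(_ 1 ltr01)[g [cg kg _] fg].
have [M Mg] : exists M, forall x, tsupport g x -> `|g x| <= M.
  have : compact (g @` tsupport g).
    by apply: continuous_compact => //; exact: continuous_subspaceT.
  move=> /compact_bounded[M [_ gM]]; exists (M + 1) => x gx.
  by apply: (gM (M + 1)); [rewrite ltrDl|exists x].
exists (1 + Num.max M 0) => _ [x _ <-].
rewrite -(subrK (g x) (f x)) (le_trans (ler_normD _ _))// lerD// le_max.
have [->|gx] := eqVneq (g x) 0; first by rewrite normr0 lexx orbT.
by rewrite Mg//; exact: subset_closure.
Qed.

Let C0_norm_ub w (f : C0 w) x : `|f x| <= C0_norm f.
Proof. by apply: ub_le_sup; [exact: (C0_has_sup f).2|exists x]. Qed.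

Let C0_normD w (f g : C0 w) : C0_norm (f + g) <= C0_norm f + C0_norm g.
Proof.
apply: ge_sup; first exact: (C0_has_sup _).1.
move=> _ [x _ <-]; apply: le_trans (ler_normD _ _) _.
exact: lerD (C0_norm_ub f x) (C0_norm_ub g x).
Qed.

Let C0_normZ_le w a (f : C0 w) : C0_norm (a *: f) <= `|a| * C0_norm f.
Proof.
apply: ge_sup; first exact: (C0_has_sup _).1.
by move=> _ [x _ <-]; rewrite normrM ler_wpM2l// C0_norm_ub.
Qed.

Let C0_normZ w a (f : C0 w) : C0_norm (a *: f) = `|a| * C0_norm f.
Proof.
apply/eqP; rewrite eq_le C0_normZ_le/=.
have [->|a0] := eqVneq a 0.
  by rewrite normr0 mul0r; exact: le_trans (C0_norm_ub _ 0).
rewrite -ler_pdivlMl ?normr_gt0// -normfV.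
by rewrite -[in leLHS](scalerK a0 f) C0_normZ_le.
Qed.

Let C0_norm_eq0 w (f : C0 w) : C0_norm f = 0 -> f = 0.
Proof.
move=> f0; apply/val_inj/funext => x /=; apply/eqP.
by rewrite -normr_le0 -f0; exact: C0_norm_ub.
Qed.

HB.instance Definition _ w := Lmodule_isNormed.Build R (C0 w)
  (@C0_normD w) (@C0_normZ w) (@C0_norm_eq0 w).
End continuous_functions.

Section domains.
Context {R : realType} {d : nat}.
Implicit Types A B : set 'rV[R]_d.

Definition set_sub A B : set 'rV[R]_d := [set x - y | x in A & y in B].

Lemma open_set_sub A B : open A -> open (set_sub A B).
Proof.
move=> oA.
have -> : set_sub A B = \bigcup_(y in B) (fun z => z + y) @^-1` A.
  apply/seteqP; split => [_ [x Ax [y By <-]]|z [y By /= Azy]].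
    by exists y => //=; rewrite subrK.
  by exists (z + y) => //; exists y => //; rewrite addrK.
apply: bigcup_open => y By; apply: open_comp => // z _.
exact: (cvgD cvg_id (cvg_cst y)).
Qed.

Definition path_connected A := forall x y, A x -> A y ->
  exists c : R -> 'rV[R]_d, [/\ {within `[0, 1], continuous c},
    c 0 = x, c 1 = y & c @` `[0, 1] `<=` A].

Definition null_homotopic_in A (c : R -> 'rV[R]_d) :=
  exists H : R * R -> 'rV[R]_d,
    [/\ {within `[0, 1] `*` `[0, 1], continuous H},
        H @` (`[0, 1] `*` `[0, 1]) `<=` A,
        forall t, 0 <= t <= 1 -> H (0, t) = c t /\ H (1, t) = c 0 &
        forall s, 0 <= s <= 1 -> H (s, 0) = c 0 /\ H (s, 1) = c 0].

Definition simply_connected A := path_connected A /\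
  forall c : R -> 'rV[R]_d, {within `[0, 1], continuous c} -> c 0 = c 1 ->
    c @` `[0, 1] `<=` A -> null_homotopic_in A c.

Definition bounded_domain A :=
  [/\ A !=set0, bounded_set A, open A & simply_connected A].

Record openset := OpenSet { oset :> set 'rV[R]_d; oset_open : open oset }.

Definition openset_sub (A : openset) B : openset :=
  OpenSet (@open_set_sub A B (@oset_open A)).

(* Omega^l *)
Fixpoint layer_set (Omega Sigma : openset) (l : nat) : openset :=
  if l is l'.+1 then openset_sub (layer_set Omega Sigma l') Sigma else Omega.

End domains.
Arguments openset R d : clear implicits.
Arguments oset_open {R d} o.

Section lebesgue_on.
Context {R : realType} {d : nat}.

Definition leb_on (w : openset R d) :=
  mrestr (lebesgue_rV R d) (open_measurable_rV (oset_open w)).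

Lemma lee1_exponent (q : R) : 1 < q -> (1 <= q%:E)%E.
Proof. by move=> /ltW; rewrite lee_fin. Qed.

Lemma lt12 : 1 < 2 :> R. Proof. by rewrite ltr1n. Qed.

End lebesgue_on.

Notation Lq w q1 := (Lp (leb_on w) (lee1_exponent q1)).
Notation L2 w := (Lq w lt12).
(* M(w) is, by definition, the dual of C_0(w); dual_norm is the total variation
   norm. *)
Notation Radon w := (dual (C0 (oset w))).

Section function_spaces.
Context {R : realType} {d : nat}.
Implicit Types (w : openset R d) (h : 'rV[R]_d -> R).
Local Notation leb := (lebesgue_rV R d).

(* The element of L^q(w) represented by h. The default value 0 is only reached
   when h is not in L^q(w). *)
Definition Lq_class w (q : R) (q1 : 1 < q) h : Lq w q1 :=
  xget 0 [set u : Lq w q1 | u = h %[ae leb_on w]].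

(* The measure phi |-> \int_w h phi identified with h. The default value 0 is not
   reached when w is bounded and h is in some L^q(w). *)
Definition Radon_of w h : Radon w :=
  xget 0 [set m : Radon w |
    forall f : C0 w, m f = \int[leb]_(x in w) (h x * f x)].

(* h = mu * g. The inner integral over Sigma is an element psi of C_0(w - Sigma),
   on which mu, being an element of the dual space, can be evaluated. *)
Definition is_conv w (Sigma : openset R d) (mu : Radon (openset_sub w Sigma))
    (g : L2 Sigma) h :=
  (forall q : R, 1 < q <= 2 -> h \in Lfun (leb_on w) q%:E) /\
  forall f, Cc w f -> exists2 psi : C0 (openset_sub w Sigma),
    (forall y, psi y = \int[leb]_(x in Sigma) (f (x + y) * g x)) &
    \int[leb]_(x in w) (h x * f x) = mu psi.

(* Such a function exists and is unique up to a null set. *)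
Definition conv w Sigma mu g := xget (cst 0) [set h | @is_conv w Sigma mu g h].

End function_spaces.

(* width l is N_l. The index i : 'I_depth stands for the layer l = i + 1, so that
   conn i is E^(i+1), a set of pairs (n, k) with n <= N_(i+1) and k <= N_i. *)
Record network := Network {
  depth : nat;
  width : nat -> nat;
  conn : forall i : 'I_depth, {set 'I_(width i.+1) * 'I_(width i)};
  depth_gt0 : (0 < depth)%N;
  width0 : width 0 = 1%N;
  width_gt0 : forall l, (l <= depth)%N -> (0 < width l)%N;
  conn_exists : forall (i : 'I_depth) n, exists k, (n, k) \in conn i
}.

Section generative_prior.
Context {R : realType} {d : nat} (Omega Sigma : openset R d) (net : network).
Local Notation Om := (layer_set Omega Sigma).
Local Notation L := (depth net).

(* Theta is the product over the layers l and the pairs (n, k) in E^l. *)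
Definition edge (i : 'I_L) := {e | e \in conn i}.
Definition edges := {i : 'I_L & edge i}.
Definition Theta := edges -> L2 Sigma.
(* M^i *)
Definition layer_measures (i : nat) : Type := 'I_(width net i) -> Radon (Om i).
Definition measures := forall i : 'I_L, layer_measures i.+1.

Lemma ltn_predl (j : 'I_L.-1) : (j < L)%N.
Proof. by rewrite (leq_trans (ltn_ord j))// leq_pred. Qed.
Lemma ltn_predr (j : 'I_L.-1) : (j.+1 < L)%N.
Proof. by have := ltn_ord j; case: L j => [|m] j //=. Qed.

(* The layers 1, and j + 1 and j + 2 for j < L - 1. *)
Definition input_index : 'I_L := Ordinal (depth_gt0 net).
Definition lower_index (j : 'I_L.-1) : 'I_L := Ordinal (ltn_predl j).
Definition upper_index (j : 'I_L.-1) : 'I_L := Ordinal (ltn_predr j).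

(* mu^l_n * theta^l_(n, k) for l = i + 1 and e = (n, k). *)
Definition edge_conv (mu : measures) (th : Theta) (i : 'I_L) (e : edge i) :=
  conv (mu i (val e).1) (th (Tagged _ e)).

(* Since N_0 = 1, the edges of the first layer are the pairs (n, 1), n <= N_1. *)
Definition first_layer q (q1 : 1 < q) (mu : measures) (th : Theta) :
    Lq Omega q1 :=
  \sum_(e : edge input_index) Lq_class Omega q1 (edge_conv mu th e).

(* mu^l *_l theta^l for l = j + 2, an element of M^(l-1). *)
Definition layer_conv (mu : measures) (th : Theta) (j : 'I_L.-1) :
    layer_measures j.+1 :=
  fun k => \sum_(e : edge (upper_index j) | (val e).2 == k)
    Radon_of (Om j.+1) (edge_conv mu th e).

Definition measures_norm (mu : measures) : R :=
  \sum_(i < L) \sum_(n < width net i.+1) dual_norm (mu i n).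

(* J j is the functional J_(j+1) on M^(j+1). *)
Definition prior_energy (J : forall j : 'I_L.-1, layer_measures j.+1 -> \bar R)
    (mu : measures) (th : Theta) : \bar R :=
  ((measures_norm mu)%:E +
   \sum_(j < L.-1)
     J j (fun k => (mu (lower_index j) k - @layer_conv mu th j k)%R))%E.

Definition admissible q (q1 : 1 < q) Nc (Z : Theta -> 'rV[R]_Nc)
    (v : Lq Omega q1) : set (measures * Theta) :=
  [set mt | [/\ v = first_layer q1 mt.1 mt.2,
     forall e, `|mt.2 e| <= 1 & Z mt.2 = 0]].

Definition generative_prior q (q1 : 1 < q) Nc (Z : Theta -> 'rV[R]_Nc) J
    (v : Lq Omega q1) : \bar R :=
  ereal_inf [set prior_energy J mt.1 mt.2 | mt in admissible Z v].

End generative_prior.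

Section functionals.
Context {R : realType}.

Definition proper_fun {T : Type} (f : T -> \bar R) := exists x, f x != +oo%E.

Definition coercive {V : normedModType R} (f : V -> \bar R) :=
  forall s : nat -> V, `|s n| @[n --> \oo] --> +oo ->
    f (s n) @[n --> \oo] --> +oo%E.

Definition convex_ereal {V : lmodType R} (f : V -> \bar R) :=
  forall (x y : V) (t : R), 0 <= t <= 1 ->
    (f (t *: x + (1 - t) *: y)%R <= t%:E * f x + (1 - t)%:E * f y)%E.

Definition weakly_lsc {V : normedModType R} (f : V -> \bar R) :=
  lower_semicontinuous (f : weak_topology V -> \bar R).

Definition weakly_star_lsc {V : normedModType R} {I : Type}
    (f : (I -> dual V) -> \bar R) :=
  lower_semicontinuous (f : {ptws I -> weak_star_topology V} -> \bar R).

Definition is_subspace {V : lmodType R} (U : set V) :=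
  U 0 /\ forall (a : R) x y, U x -> U y -> U (a *: x + y).

Definition finite_dimensional {V : lmodType R} (U : set V) :=
  exists n (b : 'I_n -> V), (forall i, U (b i)) /\
    forall u, U u -> exists c : 'I_n -> R, u = \sum_i c i *: b i.

(* W need not be assumed closed: if U is closed, K = U `&` ker A for a
   bounded A, and |u| <= D |A u| on W, then W is closed. *)
Definition complement_in {V : lmodType R} (U K W : set V) :=
  [/\ is_subspace W, W `<=` U, K `&` W = [set 0] &
      forall u, U u -> exists2 k, K k & exists2 w, W w & u = k + w].

End functionals.

(* Main.v *)
From HB Require Import structures.
From mathcomp Require Import all_boot all_order all_algebra.
From mathcomp Require Import all_classical all_reals all_analysis.
From mathcomp Require Import ess_sup_inf measurable_realfun.
From mathcomp Require Import ring lra.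
Require Import Defs.
Set Implicit Arguments.
Unset Strict Implicit.
Unset Printing Implicit Defensive.
Import Order.TTheory GRing.Theory Num.Theory.
Import numFieldNormedType.Exports.
Local Open Scope classical_set_scope.
Local Open Scope ring_scope.

(* The direct method, run along an ultrafilter on nat. Writing
   v = first_layer mu theta, it suffices to minimise over (u, mu, theta). A minimising
   sequence has bounded measures and filters; subtracting from u an element of
   U `&` ker A changes neither A u nor Rg (u - v) and bounds u.

   Weak limits in L^q and L^2 need neither reflexivity nor the Hahn-Banach theorem: in a
   complete uniformly convex space, a bounded family has along any ultrafilter a point
   lying in all closed convex sets of the image filter. This point is the limit of the
   family against every functional, and D o A is lower semicontinuous at it because its
   sublevel sets are closed and convex. Measures converge weak* by Banach-Alaoglu.

   The convolution passes to the limit: for f in C_c, integrating mu * g against f gives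
   mu applied to the correlation of f and g, and weak convergence of g_k makes the
   correlations converge uniformly. The convolution exists as the L^2 function minimising
   |h|^2 / 2 - mu (correlation of h and g), since by translation invariance and
   Cauchy-Schwarz the correlation is bounded by the L^2 norms of its arguments. *)

(** * Weak limits along an ultrafilter *)

(** The obstacle is the bilinearity of the convolution: both factors converge only weakly, and
    products of such families need not converge to the product of the limits. Moving the filter to
    the side of the test function leaves a single weakly converging factor, the measure. One
    ultrafilter serves all components at once: every bounded real family converges along it, so no
    successive extraction of subsequences and no separability or metrizability enters. Minimising
    over triples makes the infimum that defines the prior a part of the same minimisation, so that
    attainment and lower semicontinuity of the prior need no separate treatment. The bound [1 < q]
    gives uniform convexity of L^q; [q <= 2] turns the L^2 bound on convolutions into an L^q bound,
    the domains having finite measure. *)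

Definition convex_set (R : realType) (V : lmodType R) (K : set V) :=
  forall (t : R) x y, 0 <= t <= 1 -> K x -> K y -> K (t *: x + (1 - t) *: y).

(** Stated at an arbitrary radius [r], including 0, with one slack [del] for both the points and
    their midpoint: in this form it applies directly at a supremum of distances from the origin,
    without rescaling to the unit sphere. *)
Definition uniformly_convex (R : realType) (V : normedModType R) :=
  forall r e : R, 0 <= r -> 0 < e -> exists2 del : R, 0 < del &
    forall x y : V, `|x| <= r + del -> `|y| <= r + del ->
      r - del <= `|2^-1 *: (x + y)| -> `|x - y| <= e.

Section dual_elements.
Context {R : realType} {V : normedModType R}.
Implicit Types m : dual V.

Lemma dual_linear m : linear m.
Proof. by have := valP m; rewrite inE => -[]. Qed.

Lemma dual_continuous m : continuous m.
Proof. by have := valP m; rewrite inE => -[]. Qed.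

Definition dual_lin m : {linear V -> R^o} :=
  HB.pack (m : V -> R^o) (GRing.isLinear.Build _ _ _ _ (m : V -> R^o) (dual_linear m)).

Lemma dualB m u v : m (u - v) = m u - m v.
Proof. exact: (linearB (dual_lin m)). Qed.

Lemma dualD m u v : m (u + v) = m u + m v.
Proof. exact: (linearD (dual_lin m)). Qed.

Lemma dualZ m a v : m (a *: v) = a * m v.
Proof. exact: (linearZZ (dual_lin m)). Qed.

Lemma dualv0 m : m 0 = 0.
Proof. exact: (linear0 (dual_lin m)). Qed.

Lemma dual_predP (f : V -> R^o) (K : R) : linear f ->
  (forall v, `|f v| <= K * `|v|) -> f \in dual_pred.
Proof.
move=> lf fK; rewrite inE; split=> //.
pose F : {linear V -> R^o} := HB.pack f (GRing.isLinear.Build _ _ _ _ f lf).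
apply: (@bounded_linear_continuous _ _ _ F).
apply/linear_boundedP; near=> r => v /=; rewrite (le_trans (fK v))//.
by rewrite ler_wpM2r//; near: r; exact: nbhs_pinfty_ge.
Unshelve. all: by end_near. Qed.

Lemma dual_bounded m : exists2 K : R, 0 < K & forall v, `|m v| <= K * `|v|.
Proof.
have : bounded_near (dual_lin m) (nbhs 0).
  exact: (@continuous_linear_bounded _ _ _ 0 (dual_lin m) (@dual_continuous m 0)).
move/linear_boundedP/pinfty_ex_gt0 => -[K K0 Km]; by exists K.
Qed.

Lemma dual_norm_has_sup m : has_sup [set `|m x| | x in [set x | `|x| <= 1]].
Proof.
split; first by exists `|m 0|, 0 => //=; rewrite normr0.
have [K K0 Km] := dual_bounded m; exists K => _ [x /= x1 <-].
by rewrite (le_trans (Km x))// ler_piMr// ltW.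
Qed.

Lemma dual_norm_ge0 m : 0 <= dual_norm m.
Proof.
apply: le_trans (normr_ge0 (m 0)) _; apply: ub_le_sup.
  exact: (dual_norm_has_sup m).2.
by exists 0 => //=; rewrite normr0.
Qed.

Lemma dual_normP m v : `|m v| <= dual_norm m * `|v|.
Proof.
have [->|v0] := eqVneq v 0; first by rewrite dualv0 !normr0 mulr0.
have nv : 0 < `|v| by rewrite normr_gt0.
rewrite -ler_pdivrMr// mulrC -[X in X * _](ger0_norm (ltW _)) ?invr_gt0//.
rewrite -normrM -dualZ; apply: ub_le_sup; first exact: (dual_norm_has_sup m).2.
by exists (`|v|^-1 *: v) => //=; rewrite normrZ normfV normr_id mulVf// gt_eqF.
Qed.

End dual_elements.

Section ultralimits.
Context {R : realType} {I : Type} (G : set_system I) {GU : UltraFilter G}.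

Lemma ultra_cvg (f : I -> R) (M : R) : (forall i, `|f i| <= M) ->
  exists l : R, f i @[i --> G] --> l.
Proof.
move=> fM.
have fG : (f @ G) `[- M, M]%classic.
  by apply: (@filterE _ G) => i; rewrite /= in_itv/= -ler_norml.
have [p [_ pf]] := segment_compact _ fG.
(* A cluster point of an ultrafilter is a limit: otherwise the preimage of the complement of some
   neighbourhood would belong to [G], and that complement would have to meet the neighbourhood. *)
exists p => A pA; have [//|GA] := in_ultra_setVsetC (f @^-1` A) GU.
by have [z []] := pf (~` A) A GA pA.
Qed.

Lemma ultra_limit_le (f : I -> R) (l M : R) : f i @[i --> G] --> l ->
  G [set i | f i <= M] -> l <= M.
Proof.
by move=> fl GM; apply: (closed_cvg (fun x => x <= M) _ GM _ fl);
  exact: closed_le.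
Qed.

Lemma convex_ball (V : normedModType R) (r : R) :
  convex_set [set v : V | `|v| <= r].
Proof.
move=> t u v /andP[t0 t1] /= ur vr.
rewrite (le_trans (ler_normD _ _))// !normrZ (ger0_norm t0).
rewrite ger0_norm ?subr_ge0//.
rewrite (_ : r = t * r + (1 - t) * r); last by rewrite -mulrDl addrC subrK mul1r.
by rewrite lerD// ler_wpM2l// subr_ge0.
Qed.

Lemma closed_ballN (V : normedModType R) (r : R) :
  closed [set v : V | `|v| <= r].
Proof.
apply: (@closed_comp _ _ (fun v : V => `|v|) [set t : R | t <= r]).
  by move=> v _; exact: norm_continuous.
exact: closed_le.
Qed.

(* The elements of almost minimal norm of the closed convex sets in the image
   filter form a Cauchy filter, by uniform convexity. *)
Lemma weak_ultralimit (V : completeNormedModType R) (x : I -> V) (M : R) :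
  uniformly_convex V -> (forall i, `|x i| <= M) ->
  exists z, forall K, closed K -> convex_set K -> G (x @^-1` K) -> K z.
Proof.
move=> ucV xM.
pose CC := [set K : set V | [/\ closed K, convex_set K & G (x @^-1` K)]].
have CCI K K' : CC K -> CC K' -> CC (K `&` K').
  move=> [cK vK GK] [cK' vK' GK']; split; first exact: closedI.
    by move=> t u v t01 [Ku K'u] [Kv K'v]; split; [exact: vK|exact: vK'].
  exact: filterI.
have CCne K : CC K -> exists2 v, K v & `|v| <= M.
  by move=> [_ _ /filter_ex[i Ki]]; exists (x i).
pose dist (K : set V) := inf [set `|v| | v in K].
have dist_lb K v : K v -> dist K <= `|v|.
  move=> Kv; apply: ge_inf; last by exists v.
  by exists 0 => _ [w _ <-].
have distP K e : CC K -> 0 < e -> exists2 v, K v & `|v| < dist K + e.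
  move=> CK e0; have [v Kv _] := CCne _ CK.
  have hi : has_inf [set `|v| | v in K].
    split; first by exists `|v|, v.
    by exists 0 => _ [w _ <-].
  have [_ [w Kw <-] wd] := inf_adherent e0 hi.
  by exists w.
have CCT : CC setT by split => //; exact: filterT.
(* The distance from the origin grows as the sets of [CC] shrink and never exceeds [M]. The sets [K]
   cut by balls slightly larger than the supremum [r] are still nonempty, and they will shrink to
   the limit point. *)
pose r := sup [set dist K | K in CC].
have supr : has_sup [set dist K | K in CC].
  split; first by exists (dist setT); exists setT.
  by exists M => _ [K CK <-]; have [v Kv vM] := CCne _ CK;
    apply: le_trans vM; exact: dist_lb.
have rub K : CC K -> dist K <= r.
  by move=> CK; apply: ub_le_sup; [exact: supr.2|exists K].
have dist_ge0 K : CC K -> 0 <= dist K.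
  move=> CK; have [v Kv _] := CCne _ CK.
  by apply: lb_le_inf => [|_ [w _ <-]//]; exists `|v|, v.
have r0 : 0 <= r by apply: le_trans (rub _ CCT); exact: dist_ge0.
pose B := [set Kd : set V * R | CC Kd.1 /\ 0 < Kd.2].
pose F := filter_from B (fun Kd => Kd.1 `&` [set v | `|v| <= r + Kd.2]).
have FF : ProperFilter F.
  apply: filter_from_proper.
    apply: filter_from_filter; first by exists (setT, 1); split.
    move=> [K a] [K' b] [/= CK a0] [/= CK' b0].
    exists (K `&` K', Num.min a b).
      by split => /=; [exact: CCI|rewrite lt_min a0].
    move=> v /= [[Kv K'v]]; rewrite minEle; case: ifPn => ab vr.
      by split; split => //; rewrite (le_trans vr)// lerD2l.
    split; split => //; rewrite (le_trans vr)// lerD2l// ltW//.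
    by rewrite ltNge.
  move=> [K a] [/= CK a0]; have [v Kv vd] := distP K a CK a0.
  exists v; split => //=; rewrite (le_trans (ltW vd))// lerD2r; exact: rub.
have Fc : cauchy F.
  apply/cauchy_exP => e e0.
  have [|del del0 uc] := ucV r (e / 2) r0; first by rewrite divr_gt0.
  (* This [K] is at distance more than [r - del] from the origin. Being convex, it contains the
     midpoint of any two of its points, which therefore has norm at least [r - del], as uniform
     convexity requires. *)
  have [_ [K CK <-] rK] := @sup_adherent _ [set dist K | K in CC] del del0 supr.
  have [v Kv vd] := distP K del CK del0.
  have vr : `|v| <= r + del by rewrite (le_trans (ltW vd))// lerD2r; exact: rub.
  exists v; exists (K, del) => // w /= [Kw wr].
  rewrite -ball_normE /=; apply: (@le_lt_trans _ _ (e / 2)); last first.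
    by rewrite ltr_pdivrMr// ltr_pMr// ltr1n.
  apply: uc => //; rewrite (le_trans (ltW rK))//; apply: dist_lb.
  have [_ cvK _] := CK; rewrite scalerDr.
  rewrite [X in _ + X *: _](_ : _ = 1 - 2^-1); last by lra.
  by apply: cvK => //; apply/andP; split; lra.
have [z Fz] : exists z : V, F --> z by exists (lim F); exact: cauchy_cvg.
exists z => K cK cvK GK.
apply: (@closed_cvg _ _ F _ id K cK _ z Fz).
by exists (K, 1); [split|move=> v []].
Qed.

Lemma closed_convex_strip (V : normedModType R) (m : dual V) (l e : R) :
  closed [set v | `|m v - l| <= e] /\ convex_set [set v | `|m v - l| <= e].
Proof.
split.
  apply: (@closed_comp _ _ (m : V -> R) [set t : R | `|t - l| <= e]).
    by move=> v _; exact: dual_continuous.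
  apply: (@closed_comp _ _ (fun t : R => `|t - l|) [set t : R | t <= e]).
    by move=> v _; apply: cvg_norm; apply: cvgB; [exact: cvg_id|exact: cvg_cst].
  exact: closed_le.
move=> t u v t01 /= ul vl; rewrite dualD !dualZ.
rewrite (_ : _ - l = t *: (m u - l) + (1 - t) *: (m v - l)).
  exact: (@convex_ball R^o e t _ _ t01 ul vl).
by rewrite /GRing.scale /=; ring.
Qed.

(** Boundedness alone gives the values [m (x i)] some limit [l]; the strips of points where [m] is
    within [e] of [l] are closed, convex and in the image filter, so they contain [z] for every
    [e]. *)
Lemma ultra_functional (V : normedModType R) (x : I -> V) (M : R) z (m : dual V) :
  (forall i, `|x i| <= M) ->
  (forall K, closed K -> convex_set K -> G (x @^-1` K) -> K z) ->
  (m (x i) : R) @[i --> G] --> (m z : R).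
Proof.
move=> xM zK; have [C C0 mC] := dual_bounded m.
have [i|l ml] := @ultra_cvg (fun i => m (x i)) (C * M).
  by rewrite (le_trans (mC _))// ler_pM2l.
rewrite (_ : m z = l) //; apply/eqP; rewrite -subr_eq0 -normr_le0.
apply/ler_addgt0Pr => e e0; rewrite add0r.
have [cK vK] := closed_convex_strip m l e.
apply: (zK _ cK vK); move/cvgrPdist_le : ml => /(_ e e0).
by apply: filterS => j /=; rewrite distrC.
Qed.

(** Pointwise limits along the ultrafilter take the place of Tychonoff's theorem; linearity and the
    bound [M] pass to the limit. *)
Lemma banach_alaoglu (V : normedModType R) (m : I -> dual V) (M : R) :
  (forall i, dual_norm (m i) <= M) ->
  exists m' : dual V, forall v, (m i v : R) @[i --> G] --> (m' v : R).
Proof.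
move=> mM.
have mv v i : `|m i v| <= M * `|v|.
  by rewrite (le_trans (dual_normP _ _))// ler_wpM2r.
have lm v : exists l : R, (m i v : R) @[i --> G] --> l.
  exact: ultra_cvg (mv v).
pose f (v : V) : R^o := projT1 (cid (lm v)).
have fP v : (m i v : R) @[i --> G] --> (f v : R) := projT2 (cid (lm v)).
have lf : linear f.
  move=> a u v; apply: (@cvg_unique _ (@Rhausdorff R) _ _ _ _ (fP _)).
  rewrite (_ : (fun i => _) = fun i => a * m i u + m i v).
    by apply: cvgD; [apply: cvgMr; exact: fP|exact: fP].
  by apply/funext => i; rewrite dualD dualZ.
have fM v : `|f v| <= M * `|v|.
  apply: (@ultra_limit_le (fun i => `|m i v|)); first by apply: cvg_norm; exact: fP.
  by apply: filterE => i; exact: mv.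
by exists (Dual (dual_predP lf fM)).
Qed.

(** Says that [a] is at most the lower limit of [t] along [G]. Testing with real levels strictly
    below [a] treats finite and infinite [a] alike. *)
Definition liminf_ge (t : I -> \bar R) (a : \bar R) :=
  forall r : R, (r%:E < a)%E -> G [set i | r%:E < t i]%E.

Lemma liminf_ge_le t a (m : \bar R) : liminf_ge t a ->
  (forall r : R, (m < r%:E)%E -> G [set i | t i <= r%:E]%E) -> (a <= m)%E.
Proof.
move=> ta tm; rewrite leNgt; apply/negP => ma.
have [r mr ra] : exists2 r : R, (m < r%:E)%E & (r%:E < a)%E.
  move: ma; case: a m {ta tm} => [a||] [m||] //= ma.
  - rewrite lte_fin in ma; exists ((m + a) / 2); rewrite lte_fin; lra.
  - by exists (a - 1); rewrite ?ltNyr ?lte_fin// ltrBlDr ltrDl.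
  - by exists (m + 1); rewrite ?ltry// lte_fin ltrDl.
  - by exists 0; rewrite ?ltNyr ?ltry.
have [i /= []] := filter_ex (@filterI _ G _ _ _ (ta r ra) (tm r mr)).
by rewrite ltNge => /negbTE ->.
Qed.

Lemma liminf_geD s t a b : (forall i, 0 <= s i)%E -> (forall i, 0 <= t i)%E ->
  (0 <= a)%E -> (0 <= b)%E -> liminf_ge s a -> liminf_ge t b ->
  liminf_ge (fun i => s i + t i)%E (a + b)%E.
Proof.
move=> s0 t0 a0 b0 sa tb r rab.
(* The level [r] is split into levels below [a] and below [b]. If exactly one of them is infinite,
   the level -1 lies below the other, which is nonnegative, and [r + 1] goes to the infinite one. *)
have [r1 [r2 [r1a r2b r12]]] :
    exists r1 r2 : R, [/\ (r1%:E < a)%E, (r2%:E < b)%E & r <= r1 + r2].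
  move: a b a0 b0 rab {sa tb} => [a||] [b||] //= a0 b0 rab.
  - exists (a - (a + b - r) / 2), (b - (a + b - r) / 2).
    by move: rab; rewrite -EFinD !lte_fin => rab; split; lra.
  - exists (-1), (r + 1); split; rewrite ?ltry//; last by lra.
    by rewrite (lt_le_trans _ a0)// lte_fin.
  - exists (r + 1), (-1); split; rewrite ?ltry//; last by lra.
    by rewrite (lt_le_trans _ b0)// lte_fin.
  - by exists r, 0; split; rewrite ?ltry// addr0.
apply: filterS2 (sa _ r1a) (tb _ r2b) => i /= r1s r2t.
by rewrite (@le_lt_trans _ _ (r1 + r2)%:E)// EFinD lteD.
Qed.

Lemma liminf_geZ t a (c : R) : 0 < c -> liminf_ge t a ->
  liminf_ge (fun i => c%:E * t i)%E (c%:E * a)%E.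
Proof.
move=> c0 ta r; rewrite -[c]invrK -lte_pdivrMl ?invr_gt0// -EFinM => ra.
apply: filterS (ta _ ra) => i /=.
by rewrite EFinM lte_pdivrMl ?invr_gt0// invrK.
Qed.

Lemma liminf_ge_sum n (t : 'I_n -> I -> \bar R) (a : 'I_n -> \bar R) :
  (forall k i, 0 <= t k i)%E -> (forall k, 0 <= a k)%E ->
  (forall k, liminf_ge (t k) (a k)) ->
  liminf_ge (fun i => \sum_(k < n) t k i)%E (\sum_(k < n) a k)%E.
Proof.
elim: n t a => [|n IH] t a t0 a0 ta.
  by move=> r; rewrite big_ord0 => r0; apply: filterE => i; rewrite /= big_ord0.
rewrite big_ord_recl; under [X in liminf_ge X]eq_fun do rewrite big_ord_recl.
apply: liminf_geD => //; first by move=> i; exact: sume_ge0.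
  exact: sume_ge0.
by apply: IH => // k; exact: ta.
Qed.

Lemma liminf_ge_dual_norm (V : normedModType R) (m : I -> dual V) (m' : dual V) :
  (forall v, (m i v : R) @[i --> G] --> (m' v : R)) ->
  liminf_ge (fun i => (dual_norm (m i))%:E) (dual_norm m')%:E.
Proof.
move=> mm r; rewrite lte_fin => rm.
have [_ [v /= v1 <-] rv] := sup_gt (dual_norm_has_sup m').1 rm.
have Gr : G [set i | r < `|m i v|] by exact: (cvgr_gt _ (cvg_norm (mm v)) _ rv).
apply: filterS Gr => i /= ri.
rewrite lte_fin (lt_le_trans ri)//; apply: ub_le_sup; last by exists v.
exact: (dual_norm_has_sup _).2.
Qed.

End ultralimits.

Section weak_cvg.
Context {R : realType} {I : Type} (G : set_system I) {GF : Filter G}.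

Lemma cvg_initial (S : choiceType) (T : topologicalType) (f : S -> T)
    (x : I -> S) (z : S) :
  f (x i) @[i --> G] --> f z ->
  (x i : initial_topology f) @[i --> G] --> (z : initial_topology f).
Proof.
move=> fxz A; rewrite nbhsE => -[_ [[B oB <-] Bz] BA].
have /fxz GB : nbhs (f z) B by exact: open_nbhs_nbhs.
by apply: (@filterS _ G _ _ _ _ GB) => i Bi; exact: BA.
Qed.

Lemma cvg_ptws (T : Type) (S : topologicalType) (g : I -> T -> S) (h : T -> S) :
  (forall t, g i t @[i --> G] --> h t) ->
  (g i : {ptws T -> S}) @[i --> G] --> (h : {ptws T -> S}).
Proof.
move=> gh; apply/cvg_sup => t. apply: cvg_initial. exact: gh.
Qed.

Lemma weakly_lsc_liminf (V : normedModType R) (f : V -> \bar R) x z :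
  weakly_lsc f -> (forall m : dual V, (m (x i) : R) @[i --> G] --> (m z : R)) ->
  liminf_ge G (f \o x) (f z).
Proof.
move=> lf xz r rz; have [A Az Ar] := lf _ _ rz.
suff : (x i : weak_topology V) @[i --> G] --> (z : weak_topology V).
  by move=> /(_ _ Az) GA; apply: (@filterS _ G _ _ _ _ GA) => i; exact: Ar.
apply: cvg_initial; apply: cvg_ptws; exact: xz.
Qed.

Lemma weakly_star_lsc_liminf (V : normedModType R) (T : Type)
    (f : (T -> dual V) -> \bar R) (m : I -> T -> dual V) (m' : T -> dual V) :
  weakly_star_lsc f ->
  (forall t v, (m i t v : R) @[i --> G] --> (m' t v : R)) ->
  liminf_ge G (f \o m) (f m').
Proof.
move=> lf xz r rz; have [A Az Ar] := lf _ _ rz.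
suff : (m i : {ptws T -> weak_star_topology V}) @[i --> G] -->
    (m' : {ptws T -> weak_star_topology V}).
  by move=> /(_ _ Az) GA; apply: (@filterS _ G _ _ _ _ GA) => i; exact: Ar.
apply: cvg_ptws => t; apply: cvg_initial; apply: cvg_ptws; exact: xz.
Qed.

End weak_cvg.

(** * Coercivity and kernels *)

Section normalisation.
Context {R : realType}.

Lemma norm_coord_le n (c : 'rV[R]_n) i : `|c ord0 i| <= `|c|.
Proof.
rewrite [leRHS]mx_normrE.
exact: (le_bigmax _ (fun ij : 'I_1 * 'I_n => `|c ij.1 ij.2|) (ord0, i)).
Qed.

Lemma coercive_sublevel (Y : normedModType R) (f : Y -> \bar R) (c : R) :
  coercive f -> exists M : R, forall z, (f z <= c%:E)%E -> `|z| <= M.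
Proof.
move=> cf; apply: contrapT => /forallNP nb.
have /choice[z zP] n : exists z : Y, (f z <= c%:E)%E /\ n%:R < `|z|.
  have /existsNP[z /not_implyP[fz /negP]] := nb n%:R.
  by rewrite -ltNge; exists z.
have zoo : `|z n| @[n --> \oo] --> +oo.
  apply/cvgryPge => A; near=> n; rewrite (le_trans _ (ltW (zP n).2))//.
  by near: n; exact: nbhs_infty_ger.
have /cvgeyPge/(_ (c + 1)) := cf _ zoo.
case=> N _ /(_ N (leqnn N)) /= h; have := le_trans h (zP N).1.
by rewrite lee_fin gerDl ler10.
Unshelve. all: by end_near. Qed.

(* A row vector almost nearest to the closed kernel is bounded by its image, by
   compactness of the row vectors of norm at most 2 at distance at least 1 from
   the kernel. *)
Lemma kernel_representative (V W : normedModType R) (A : {linear V -> W}) n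
    (b : 'I_n -> V) : exists D : R, forall c : 'I_n -> R, exists k : 'I_n -> R,
  A (\sum_i k i *: b i) = 0 /\
  `|\sum_i c i *: b i - \sum_i k i *: b i| <= D * `|A (\sum_i c i *: b i)|.
Proof.
(* In the space of coefficients bounded closed sets are compact, and linear relations between the
   [b i] are absorbed by the kernel [K] of [A \o s]. *)
pose s (c : 'rV[R]_n) := \sum_i c 0 i *: b i.
have sD u v : s (u + v) = s u + s v.
  by rewrite -big_split; apply: eq_bigr => i _; rewrite !mxE scalerDl.
have sZ a u : s (a *: u) = a *: s u.
  by rewrite scaler_sumr; apply: eq_bigr => i _; rewrite !mxE scalerA.
have sB u v : s (u - v) = s u - s v by rewrite -scaleN1r sD sZ scaleN1r.
have sn c : `|s c| <= (\sum_i `|b i|) * `|c|.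
  rewrite (le_trans (ler_norm_sum _ _ _))// mulr_suml ler_sum// => i _.
  by rewrite normrZ mulrC ler_wpM2l// norm_coord_le.
have An c : `|A (s c)| <= (\sum_i `|A (b i)|) * `|c|.
  rewrite linear_sum.
  rewrite (le_trans (ler_norm_sum _ _ _))// mulr_suml ler_sum// => i _.
  by rewrite (linearZZ A) normrZ mulrC ler_wpM2l// norm_coord_le.
have Ac : continuous (fun c => `|A (s c)|).
  move=> c; apply/(@cvgrPdist_le _ _ _ (nbhs c)) => e e0; near=> t.
  rewrite (le_trans (ler_dist_dist _ _))// -linearB -sB (le_trans (An _))//.
  rewrite (le_trans (ler_wpM2r (normr_ge0 _) (_ : _ <= \sum_i `|A (b i)| + 1)))//.
    by rewrite lerDl.
  rewrite mulrC -ler_pdivlMr ?ltr_wpDl ?sumr_ge0//.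
  near: t; apply: cvgr_dist_le; first exact: cvg_id.
  by rewrite divr_gt0// ltr_wpDl ?sumr_ge0.
pose K := [set k | A (s k) = 0].
pose S := [set c : 'rV[R]_n | `|c| <= 2] `&`
  [set c | forall k, K k -> 1 <= `|c - k|].
have cS : compact S.
  apply: bounded_closed_compact.
    by exists 2; split => // x x2 c [/= c2 _]; rewrite (le_trans c2)// ltW.
  apply: closedI; first exact: closed_ballN.
  rewrite (_ : mkset _ = \bigcap_(k in K) [set c : 'rV[R]_n | 1 <= `|c - k|]).
    apply: closed_bigI => k _.
    apply: (@closed_comp _ _ (fun c : 'rV[R]_n => `|c - k|) [set t : R | 1 <= t]).
      move=> v _; apply: (@cvg_norm _ _ _ (nbhs v)).
      by apply: (@cvgB _ _ _ (nbhs v)); [exact: cvg_id|exact: cvg_cst].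
    exact: closed_ge.
  by apply/seteqP; split => c h k; exact: h.
have KD k k' (a : R) : K k -> K k' -> K (k + a *: k').
  by rewrite /K/= => Kk Kk'; rewrite sD linearD Kk sZ (linearZZ A) Kk' scaler0 addr0.
have K0 : K 0 by rewrite /K /=; have := sZ 0 0; rewrite !scale0r => ->; rewrite linear0.
have [D1 D1_ge0 D1P] : exists2 D1 : R, 0 <= D1 & forall c, S c -> 1 <= D1 * `|A (s c)|.
  have [->|/set0P Sne] := eqVneq S set0; first by exists 0.
  have [t0 t0S tmin] := EVT_min_rV Sne cS (@continuous_subspaceT _ _ S _ Ac).
  have [_ t0K] : S t0 by rewrite -in_setE.
  have m0 : 0 < `|A (s t0)|.
    rewrite normr_gt0; apply/eqP => At0; have := t0K t0 At0.
    by rewrite subrr normr0 ler10.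
  exists `|A (s t0)|^-1; first by rewrite invr_ge0 ltW.
  by move=> c Sc; rewrite ler_pdivlMl// mulr1 tmin// inE.
have key (c : 'rV[R]_n) : exists2 k, K k & `|c - k| <= 2 * D1 * `|A (s c)|.
  pose E := [set `|c - k| | k in K].
  have hE : has_inf E.
    split; first by exists `|c - 0|, 0.
    by exists 0 => _ [k _ <-].
  have : 0 <= inf E by apply: lb_le_inf; [exact: hE.1|move=> _ [k _ <-]].
  (* If [c] is at distance 0 from the kernel, then [A (s c) = 0] by continuity, and [c] represents
     itself. *)
  rewrite le_eqVlt => /orP[/eqP E0|E0].
    exists c; last by rewrite subrr normr0 !mulr_ge0.
    apply/eqP; rewrite -normr_eq0 eq_le normr_ge0 andbT.
    apply/ler_addgt0Pr => e e0; rewrite add0r.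
    pose B := \sum_i `|A (b i)| + 1.
    have B0 : 0 < B by rewrite ltr_wpDl// sumr_ge0.
    have [|_ [k Kk <-]] := @inf_adherent _ E (e / B) _ hE; first exact: divr_gt0.
    rewrite -E0 add0r ltr_pdivlMr// => ck.
    rewrite -[A (s c)]subr0 -Kk -linearB -sB (le_trans (An _))//.
    by rewrite mulrC (le_trans _ (ltW ck))// ler_wpM2l// /B lerDl.
  have [_ [k Kk <-] ck] := inf_adherent E0 hE.
  (* Since [k] is within twice the distance [dl] from [c] to the kernel, dividing [c - k] by [dl]
     gives a point of [S]. *)
  exists k => //; set dl := inf E in E0 ck *.
  have St : S (dl^-1 *: (c - k)).
    split => /=.
      rewrite normrZ ger0_norm ?invr_ge0 ?(ltW E0)// ler_pdivrMl// (le_trans (ltW ck))//.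
      by rewrite mulr_natr mulr2n.
    move=> k' Kk'.
    rewrite (_ : _ - k' = dl^-1 *: (c - (k + dl *: k'))); last first.
      by rewrite opprD addrA [RHS]scalerBr scalerA mulVf ?scale1r// gt_eqF.
    rewrite normrZ ger0_norm ?invr_ge0 ?(ltW E0)// ler_pdivlMl// mulr1.
    by apply: ge_inf; [exact: hE.2|exists (k + dl *: k') => //; exact: KD].
  have := D1P _ St; rewrite sZ (linearZZ A) normrZ sB linearB Kk subr0.
  rewrite ger0_norm ?invr_ge0 ?(ltW E0)// mulrCA ler_pdivlMl// mulr1 => h.
  by rewrite (le_trans (ltW ck))// -mulrA mulr_natl mulr2n lerD.
exists ((\sum_i `|b i|) * (2 * D1)) => c.
have [k Kk ck] := key (\row_i c i).
have sc : \sum_i c i *: b i = s (\row_i c i).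
  by apply: eq_bigr => i _; rewrite mxE.
exists (fun i => k 0 i); split; first exact: Kk.
rewrite sc -[X in _ - X]/(s k) -sB (le_trans (sn _))// -mulrA ler_wpM2l//.
by rewrite sumr_ge0.
Unshelve. all: by end_near. Qed.
End normalisation.

(** * Uniform convexity of L^p *)

Section power_inequalities.
Context {R : realType}.
Implicit Types x y a b r e t : R.

Lemma ln_lt_subr1 y : 0 < y -> y != 1 -> ln y < y - 1.
Proof.
move=> y0 y1; have := @expR_gt1Dx R (ln y); rewrite lnK ?posrE// ln_eq0// y1.
by move=> /(_ isT); rewrite -ltrBrDl.
Qed.

Lemma ln_le_subr1 y : 0 < y -> ln y <= y - 1.
Proof.
by move=> y0; have [->|/(ln_lt_subr1 y0)/ltW//] := eqVneq y 1; rewrite ln1 subrr.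
Qed.

(** With [A] the left-hand side, assumed positive, [ln A - r * ln x] is the sum of [ln (A / x)] and
    [(r - 1) * ln x^-1]. Bounding both logarithms by [ln y <= y - 1], strictly in the second, gives
    upper bounds that add up to exactly 0. *)
Lemma bernoulli_powR_lt r x : 1 < r -> 0 <= x -> x != 1 -> 1 + r * (x - 1) < x `^ r.
Proof.
move=> r1 x0 x1; have r0 : 0 < r by exact: lt_trans r1.
have [A0|A0] := leP (1 + r * (x - 1)) 0.
  have [->|xn0] := eqVneq x 0; first by rewrite powR0 ?gt_eqF//; lra.
  by rewrite (le_lt_trans A0)// powR_gt0// lt_def xn0.
have [xe0|xn0] := eqVneq x 0; first by move: A0; rewrite xe0; lra.
have xp : 0 < x by rewrite lt_def xn0.
rewrite -ltr_ln ?posrE ?powR_gt0// ln_powR.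
set A := 1 + _ in A0 *.
have h1 : ln A - ln x <= A / x - 1.
  by rewrite -ln_div ?posrE// ln_le_subr1// divr_gt0.
have h2 : - ln x < x^-1 - 1.
  rewrite -lnV ?posrE// ln_lt_subr1 ?invr_gt0//.
  by rewrite -[X in _ != X]invr1 (inj_eq invr_inj).
have h3 : A / x = r + (1 - r) * x^-1.
  by rewrite /A; field.
have : ln A - ln x + (r - 1) * (- ln x) < A / x - 1 + (r - 1) * (x^-1 - 1).
  by rewrite ler_ltD// ltr_pM2l// subr_gt0.
rewrite h3; nra.
Qed.

Lemma bernoulli_powR r x : 1 < r -> 0 <= x -> 1 + r * (x - 1) <= x `^ r.
Proof.
move=> r1 x0; have [->|/(bernoulli_powR_lt r1 x0)/ltW//] := eqVneq x 1.
by rewrite subrr mulr0 addr0 powR1.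
Qed.

(** Strict convexity of the power. With [m] the mean of 1 and the absolute value of [t], Bernoulli's
    inequality is applied to the two numbers divided by [m]; their mean is 1, so the linear terms
    cancel. When [t] is -1 the midpoint is 0. *)
Lemma powR_midpoint_lt r t : 1 < r -> t != 1 ->
  `|2^-1 * (1 + t)| `^ r < 2^-1 * (1 + `|t| `^ r).
Proof.
move=> r1 t1; have r0 : 0 < r by exact: lt_trans r1.
set m := 2^-1 * (1 + `|t|).
have m0 : 0 < m by rewrite mulr_gt0// ltr_wpDr.
have [t1'|t1'] := eqVneq `|t| 1.
  have -> : t = - 1.
    by have [t0|t0] := leP 0 t; move: t1' t1;
      [rewrite ger0_norm// => -> /[!eqxx]|rewrite ltr0_norm// => <-; rewrite opprK].
  by rewrite subrr mulr0 normr0 powR0 ?gt_eqF// mulr_gt0// ltr_wpDr// powR_ge0.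
apply: (@le_lt_trans _ _ (m `^ r)).
  rewrite ge0_ler_powR ?(ltW r0) ?nnegrE ?normr_ge0 ?(ltW m0)//.
  rewrite normrM ger0_norm// ler_wpM2l//.
  by rewrite (le_trans (ler_normD _ _))// normr1.
have h1 : 1 + r * (m^-1 - 1) < (m^-1) `^ r.
  apply: bernoulli_powR_lt => //; first by rewrite invr_ge0 ltW.
  rewrite invr_eq1; apply: contra t1' => /eqP; rewrite /m => m1.
  by apply/eqP; lra.
have h2 : 1 + r * (`|t| / m - 1) <= (`|t| / m) `^ r.
  by apply: bernoulli_powR => //; rewrite divr_ge0// ltW.
have h3 : 2 < (m^-1) `^ r + (`|t| / m) `^ r.
  apply: le_lt_trans (ltr_leD h1 h2).
  have em : m^-1 + `|t| / m = 2 by rewrite /m; field; rewrite gt_eqF// ltr_wpDr.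
  rewrite (_ : _ + _ = 2 + r * (m^-1 + `|t| / m - 2)); last by ring.
  by rewrite em subrr mulr0 addr0.
rewrite powRM ?invr_ge0 ?(ltW m0)// -[X in X + _]mul1r -mulrDl in h3.
have mr : m^-1 `^ r = (m `^ r)^-1.
  have mr0 : m `^ r != 0 by rewrite gt_eqF// powR_gt0.
  apply: (mulfI mr0); rewrite -powRM ?invr_ge0 ?(ltW m0)//.
  by rewrite !mulfV ?powR1// gt_eqF.
rewrite mr ltr_pdivlMr ?powR_gt0// in h3.
lra.
Qed.

Lemma continuous_norm_powR r : 0 < r -> continuous (fun x => `|x| `^ r).
Proof.
move=> r0 x; have [->|x0] := eqVneq x 0.
  apply/cvgrPdist_lt => e e0; rewrite normr0 powR0 ?gt_eqF//; near=> y.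
  rewrite sub0r normrN ger0_norm ?powR_ge0//.
  have -> : e = (e `^ r^-1) `^ r.
    by rewrite -powRrM mulVf ?gt_eqF// powRr1// ltW.
  rewrite gt0_ltr_powR// ?nnegrE ?powR_ge0//.
  near: y; apply: (@cvgr0_norm_lt _ _ _ (nbhs (0 : R)) _ id); first exact: cvg_id.
  by rewrite powR_gt0.
apply: (@continuous_comp _ _ _ (fun x : R => `|x|) (fun a => a `^ r)).
  exact: norm_continuous.
apply: differentiable_continuous; apply/derivable1_diffP.
by apply: ex_derive; apply: is_derive1_powR; rewrite normr_gt0.
Unshelve. all: by end_near. Qed.

(* By homogeneity and symmetry it suffices to treat a = 1 and b in [-1, 1], where the
   midpoint defect is bounded below on the compact set |1 - b|^r >= e. *)
Lemma powR_midpoint r e : 1 < r -> 0 < e -> exists2 C : R, 0 <= C &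
  forall a b, `|a - b| `^ r + C * `|2^-1 * (a + b)| `^ r <=
              (e + C / 2) * (`|a| `^ r + `|b| `^ r).
Proof.
move=> r1 e0; have r0 : 0 < r by exact: lt_trans r1.
pose phi t : R := 2^-1 * (1 + `|t| `^ r) - `|2^-1 * (1 + t)| `^ r.
have phi_ge0 t : 0 <= phi t.
  have [->|/(powR_midpoint_lt r1)] := eqVneq t 1; last by rewrite /phi; lra.
  rewrite /phi normr1 powR1 (_ : 2^-1 * (1 + 1) = 1) ?normr1 ?powR1 ?subrr//.
  by lra.
have cp (f : R -> R) : continuous f -> continuous (fun t => `|f t| `^ r).
  move=> cf t; apply: (@continuous_comp _ _ _ f (fun x : R => `|x| `^ r)).
    exact: cf.
  exact: continuous_norm_powR.
have cphi : continuous phi.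
  move=> t; apply: cvgB.
    apply: cvgMr; apply: cvgD; [exact: cvg_cst|exact: continuous_norm_powR].
  apply: (cp (fun t => 2^-1 * (1 + t))) => u; apply: cvgMr.
  by apply: cvgD; [exact: cvg_cst|exact: cvg_id].
pose A := [set t | t \in `[-1, 1]] `&` [set t | e <= `|1 - t| `^ r].
have cA : compact A.
  apply: compact_closedI; first exact: segment_compact.
  apply: (@closed_comp _ _ (fun t : R => `|1 - t| `^ r) [set x | e <= x]).
    move=> t _; apply: (cp (fun t => 1 - t)) => u.
    by apply: cvgB; [exact: cvg_cst|exact: cvg_id].
  exact: closed_ge.
have [C C0 CP] : exists2 C : R, 0 <= C & forall t, -1 <= t <= 1 ->
    `|1 - t| `^ r <= e * (1 + `|t| `^ r) + C * phi t.
  have small t : `|1 - t| `^ r <= e -> forall C, 0 <= C ->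
      `|1 - t| `^ r <= e * (1 + `|t| `^ r) + C * phi t.
    move=> te C C0; rewrite (le_trans te)// mulrDr mulr1 -addrA lerDl.
    by rewrite addr_ge0// mulr_ge0// ?powR_ge0// ltW.
  have [A0|/set0P Ane] := eqVneq A set0.
    exists 0 => // t t1; apply: small => //; rewrite leNgt; apply/negP => te.
    suff : set0 t by []; rewrite -A0; split; [by rewrite /= in_itv|exact: ltW].
  have [t0 /[!inE] -[t01 t0e] tmin] :=
    compact_EVT_min Ane cA (@continuous_subspaceT _ _ A _ cphi).
  have m0 : 0 < phi t0.
    rewrite /phi subr_gt0 powR_midpoint_lt//; apply/eqP => t0E.
    move: t0e; rewrite /= t0E subrr normr0 powR0 ?gt_eqF//.
    by rewrite leNgt e0.
  (* On the compact set [A] the defect [phi] is at least its minimum [phi t0], while the distance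
     from 1 to [t] is at most 2; this ratio makes [C * phi t] dominate [2 ^ r]. *)
  exists (2 `^ r / phi t0); first by rewrite divr_ge0 ?powR_ge0// ltW.
  move=> t t1; have [te|te] := leP (`|1 - t| `^ r) e.
    by apply: small => //; rewrite divr_ge0 ?powR_ge0// ltW.
  apply: (@le_trans _ _ (2 `^ r)).
    rewrite ge0_ler_powR ?(ltW r0) ?nnegrE//.
    by rewrite ler_norml; lra.
  apply: (@le_trans _ _ (2 `^ r / phi t0 * phi t)); last first.
    by rewrite lerDr mulr_ge0 ?addr_ge0 ?powR_ge0// ltW.
  rewrite -mulrA ler_peMr ?powR_ge0// ler_pdivlMl// mulr1 tmin// inE.
  by split; [rewrite /= in_itv|exact: ltW].
exists C => // a b.
wlog ab : a b / `|b| <= `|a|.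
  move=> H; have [ba|ba] := leP `|b| `|a|; first exact: H.
  by rewrite distrC (addrC a) (addrC (`|a| `^ r)) H// ltW.
have [a0|a0] := eqVneq a 0.
  move: ab; rewrite a0 normr0 normr_le0 => /eqP ->.
  by rewrite subrr addr0 mulr0 normr0 powR0 ?gt_eqF// !mulr0 !addr0 mulr0.
have na : 0 < `|a| by rewrite normr_gt0.
have := CP (b / a); rewrite /phi.
have hb : b = a * (b / a) by field.
set t := b / a in hb *; rewrite {}hb.
have t1 : -1 <= t <= 1.
  by rewrite -ler_norml /t normrM normfV ler_pdivrMr// mul1r.
move=> /(_ t1) h.
rewrite (_ : a - a * t = a * (1 - t)); last by ring.
rewrite (_ : 2^-1 * (a + a * t) = a * (2^-1 * (1 + t))); last by ring.
rewrite !(normrM a) !(@powRM _ `|a|)//.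
rewrite -(ler_pM2l (powR_gt0 r na)) in h.
move: h; set u := `|1 - t| `^ r; set v := `|2^-1 * (1 + t)| `^ r.
set w := `|t| `^ r; set s := `|a| `^ r => h.
rewrite -subr_ge0 (_ : _ - _ = s * (e * (1 + w) + C * (2^-1 * (1 + w) - v)) - s * u).
  by rewrite subr_ge0.
by field.
Qed.
End power_inequalities.

Section Lp_theory.
Context d (T : measurableType d) (R : realType).
Variables (mu : {measure set T -> \bar R}).

Section any_exponent.
Variables (p : \bar R) (p1 : (1 <= p)%E).
Local Notation Lp := (Lp mu p1).
Implicit Types u v : Lp.

Lemma Lp_funD u v : \forall x \ae mu, Lp_fun (u + v) x = u x + v x.
Proof.
by apply: filterS (repr_Lp (repr u + repr v)) => x /(_ I).
Qed.

Lemma Lp_funN u : \forall x \ae mu, Lp_fun (- u) x = - u x.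
Proof. by apply: filterS (repr_Lp (- repr u)) => x /(_ I). Qed.

Lemma Lp_funB u v : \forall x \ae mu, Lp_fun (u - v) x = u x - v x.
Proof. by apply: filterS2 (Lp_funD u (- v)) (Lp_funN v) => x -> ->. Qed.

Lemma Lp_funZ a u : \forall x \ae mu, Lp_fun (a *: u) x = a * u x.
Proof. by apply: filterS (repr_Lp (a *: repr u)) => x /(_ I). Qed.

Lemma measurable_Lp u : measurable_fun setT u.
Proof. exact: measurable_funPT. Qed.

Lemma Lp_ext u v : (\forall x \ae mu, u x = v x) -> u = v.
Proof.
move=> uv; rewrite -[u]reprK -[v]reprK; apply/Lp_eqP.
by apply: filterS uv => x uvx _.
Qed.

Lemma Lp_Lfun u : (u : T -> R) \in Lfun mu p.
Proof. exact: LfunP. Qed.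

Lemma Lp_norm_ae u (h : T -> R) : measurable_fun setT h ->
  (\forall x \ae mu, u x = h x) -> `|u|%:E = Lnorm mu p (EFin \o h).
Proof.
move=> mh uh; rewrite finite_norm_fine.
have mh' : h \in mfun by rewrite inE.
rewrite -[h]/(mfun_Sub mh' : T -> R).
apply: (@ae_eq_Lnorm _ _ _ mu p (repr u) (mfun_Sub mh')).
by apply: filterS uh => x /= uhx _.
Qed.

Lemma Lp_of_Lfun (h : T -> R) : h \in Lfun mu p ->
  exists u : Lp, \forall x \ae mu, u x = h x.
Proof.
move=> hL; exists (\pi_Lp (Lfun_Sub p1 hL))%qT.
by apply: filterS (repr_Lp (Lfun_Sub p1 hL)) => x /(_ I).
Qed.

End any_exponent.

Variables (r : R) (r1 : (1 <= r%:E)%E).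
Local Notation Lp := (Lp mu r1).
Implicit Types u v : Lp.

Let r_gt0 : 0 < r. Proof. by rewrite (lt_le_trans ltr01)// -lee_fin. Qed.

Lemma Lp_norm_powR u : (\int[mu]_x (`|u x| `^ r)%:E)%E = (`|u| `^ r)%:E.
Proof.
rewrite -poweR_EFin.
rewrite [X in (X `^ _)%E](_ : _ = Lnorm mu r%:E (EFin \o u)); last first.
  exact: (@finite_norm_fine _ _ _ mu _ r1 (repr u)).
rewrite powR_Lnorm ?gt_eqF//.
Qed.

Lemma measurable_norm_powR u : measurable_fun setT (fun x => `|u x| `^ r).
Proof.
apply: (measurableT_comp (measurable_powR r)).
by apply: measurableT_comp => //; exact: measurable_Lp.
Qed.

Lemma Lp_midpoint (r_gt1 : 1 < r) (e : R) : 0 < e -> exists2 C : R, 0 <= C &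
  forall u v, `|u - v| `^ r + C * `|2^-1 *: (u + v)| `^ r <=
              (e + C / 2) * (`|u| `^ r + `|v| `^ r).
Proof.
move=> e0; have [C C0 CP] := powR_midpoint r_gt1 e0; exists C => // u v.
have : 0 <= e + C / 2 by rewrite addr_ge0 ?divr_ge0// ltW.
move: (e + C / 2) CP => c CP c0.
have mE (w : Lp) : measurable_fun setT (fun x => (`|w x| `^ r)%:E).
  by apply/measurable_EFinP; exact: measurable_norm_powR.
have p0 (w : Lp) x : setT x -> (0 <= (`|w x| `^ r)%:E)%E.
  by rewrite lee_fin powR_ge0.
have mC (w : Lp) (a : R) : measurable_fun setT (fun x => a%:E * (`|w x| `^ r)%:E)%E.
  exact: emeasurable_funM.
rewrite -lee_fin !EFinD !EFinM !EFinD -!Lp_norm_powR.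
rewrite -ge0_integralZl_EFin// -ge0_integralD//; last first.
  by move=> x _; rewrite mule_ge0.
rewrite -(@ge0_integralD _ _ _ _ _ _ (fun x => (`|u x| `^ r)%:E))//.
rewrite -ge0_integralZl_EFin//; last 2 first.
- by move=> x _; rewrite adde_ge0.
- exact: emeasurable_funD.
apply: ae_ge0_le_integral => //.
- by move=> x _; rewrite adde_ge0// mule_ge0.
- exact: emeasurable_funD.
- by move=> x _; rewrite mule_ge0 ?adde_ge0.
- by apply: emeasurable_funM => //; exact: emeasurable_funD.
apply: filterS3 (Lp_funB u v) (Lp_funD u v) (Lp_funZ 2^-1 (u + v)).
by move=> x -> + -> _ => ->; rewrite lee_fin; exact: CP.
Qed.

Lemma Lp_uniformly_convex (r_gt1 : 1 < r) : uniformly_convex Lp.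
Proof.
move=> s e; rewrite le_eqVlt => /predU1P[<-|s0] e0.
  exists (e / 2); first by rewrite divr_gt0.
  move=> u v; rewrite add0r => ue ve _.
  by rewrite (le_trans (ler_normB _ _))// [leRHS]splitr lerD.
have er : 0 < e `^ r by rewrite powR_gt0.
pose N := (s + 1) `^ r.
have N0 : 0 < N by rewrite powR_gt0// addr_gt0.
(* The factor 4 lets the term without [C] contribute at most half of [e ^ r]: two norms to the power
   [r], each at most [N]. The other half is left for the oscillation [k] of the power around [s]. *)
have [|C C0 CP] := @Lp_midpoint r_gt1 (e `^ r / (4 * N)).
  by rewrite divr_gt0// mulr_gt0.
pose k (t : R) := C * (`|s + t| `^ r - `|s - t| `^ r).
have ck : k t @[t --> (0 : R)] --> (0 : R).
  rewrite [X in _ --> X](_ : _ = k 0); last first.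
    by rewrite /k addr0 subr0 subrr mulr0.
  apply: cvgMr; apply: cvgB.
    apply: (@continuous_comp _ _ _ (fun t => s + t) (fun x : R => `|x| `^ r)).
      by apply: cvgD; [exact: cvg_cst|exact: cvg_id].
    exact: continuous_norm_powR.
  apply: (@continuous_comp _ _ _ (fun t => s - t) (fun x : R => `|x| `^ r)).
    by apply: cvgB; [exact: cvg_cst|exact: cvg_id].
  exact: continuous_norm_powR.
have e2 : 0 < e `^ r / 2 by rewrite divr_gt0.
have /nbhs_ballP[dl /= dl0 kdl] : nbhs (0 : R) [set t | `|k t| < e `^ r / 2].
  by move/cvgrPdist_lt : ck => /(_ _ e2); apply: filterS => t; rewrite sub0r normrN.
(* The three bounds keep [k] small, keep [s + t] below the radius defining [N], and keep [s - t]
   nonnegative. *)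
exists (Num.min (dl / 2) (Num.min 1 s)); first by rewrite !lt_min ltr01 s0 divr_gt0.
set t := Num.min _ _ => u v us vs uvs.
have t0 : 0 < t by rewrite !lt_min ltr01 s0 divr_gt0.
have : t <= t by []; rewrite {2}/t !le_min => /and3P[tdl t1 ts].
have /kdl : ball 0 dl t.
  rewrite /ball /= sub0r normrN gtr0_norm// (le_lt_trans tdl)//.
  by rewrite ltr_pdivrMr// ltr_pMr// ltr1n.
move=> /ltW/(le_trans (ler_norm _)); rewrite /k.
rewrite gtr0_norm ?addr_gt0// ger0_norm ?subr_ge0// => kt.
have r0 := ltW r_gt0.
have uN : `|u| `^ r <= (s + t) `^ r by rewrite ge0_ler_powR ?nnegrE ?addr_ge0 ?(ltW s0) ?(ltW t0).
have vN : `|v| `^ r <= (s + t) `^ r by rewrite ge0_ler_powR ?nnegrE ?addr_ge0 ?(ltW s0) ?(ltW t0).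
have mN : (s - t) `^ r <= `|2^-1 *: (u + v)| `^ r.
  by rewrite ge0_ler_powR ?nnegrE ?subr_ge0.
have sN : (s + t) `^ r <= N.
  by rewrite ge0_ler_powR ?lerD2l ?nnegrE ?addr_ge0 ?(ltW s0) ?(ltW t0).
have [c [c0 cN uv]] : exists c : R, [/\ 0 < c, c * (4 * N) = e `^ r &
    `|u - v| `^ r + C * `|2^-1 *: (u + v)| `^ r <=
    (c + C / 2) * (`|u| `^ r + `|v| `^ r)].
  exists (e `^ r / (4 * N)); split; last exact: CP.
    by rewrite divr_gt0// mulr_gt0.
  by rewrite divfK// gt_eqF// mulr_gt0.
suff : `|u - v| `^ r <= e `^ r.
  rewrite leNgt => H; rewrite leNgt; apply/negP => euv; move/negP: H; apply.
  by rewrite gt0_ltr_powR ?nnegrE ?(ltW e0).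
have h1 : (c + C / 2) * (`|u| `^ r + `|v| `^ r) <= (c + C / 2) * (2 * (s + t) `^ r).
  by rewrite ler_wpM2l ?addr_ge0 ?divr_ge0 ?(ltW c0)// mulr_natl mulr2n lerD.
have h2 : C * (s - t) `^ r <= C * `|2^-1 *: (u + v)| `^ r by rewrite ler_wpM2l.
have h3 : c * (s + t) `^ r <= c * N by rewrite ler_pM2l.
move: kt cN uv h1 h2 h3; set A := (s + t) `^ r; set B := (s - t) `^ r.
set D := `|2^-1 *: (u + v)| `^ r.
by move=> kt cN uv h1 h2 h3; lra.
Qed.

End Lp_theory.

(** * Completeness of L^p *)

Section Lp_complete.
Context d (T : measurableType d) (R : realType).
Variables (mu : {measure set T -> \bar R}) (r : R) (r1 : (1 <= r%:E)%E).
Local Notation Lp := (Lp mu r1).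
Implicit Types u v : Lp.

Let r_ge1 : 1 <= r. Proof. by rewrite -lee_fin. Qed.
Let r_gt0 : 0 < r. Proof. exact: lt_le_trans r_ge1. Qed.
Let h n : R := 2^-1 ^+ n.
Let h_gt0 n : 0 < h n. Proof. by rewrite exprn_gt0. Qed.

(** The squared rate leaves room for a weight: multiplied by [2 ^ n], the increments still have norm
    at most [2 ^ - n], so the sum of their [r]-th powers is integrable and hence finite almost
    everywhere. Its value bounds each term, which makes the increments at such a point decay
    geometrically. *)
Lemma fast_cauchy_ae (z : nat -> Lp) : (forall n, `|z n.+1 - z n| <= h n * h n) ->
  \forall x \ae mu, cvgn (fun n => z n x : R).
Proof.
move=> zh.
pose g n x := ((2 ^+ n * `|Lp_fun (z n.+1 - z n) x|) `^ r)%:E.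
have gE n x : g n x = (((2 ^+ n) `^ r)%:E * (`|Lp_fun (z n.+1 - z n) x| `^ r)%:E)%E.
  by rewrite /g powRM// exprn_ge0.
have mg n : measurable_fun setT (g n).
  rewrite (funext (gE n)).
  apply: emeasurable_funM => //; apply/measurable_EFinP.
  exact: measurable_norm_powR.
have g0 n x : setT x -> (0 <= g n x)%E by rewrite lee_fin powR_ge0.
have ig : (\int[mu]_x (\sum_(0 <= n <oo) g n x) <= 2%:E)%E.
  rewrite integral_nneseries//.
  apply: le_trans (@epsilon_trick0 R 2 xpredT _) => //.
  apply: lee_nneseries => [n _ _|n _]; first by apply: integral_ge0 => x _; exact: g0.
  under eq_integral do rewrite gE.
  rewrite ge0_integralZl_EFin ?powR_ge0//; last first.
    by apply/measurable_EFinP; exact: measurable_norm_powR.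
  rewrite Lp_norm_powR -EFinM lee_fin -powRM ?exprn_ge0//.
  have hn : 2 ^+ n * `|z n.+1 - z n| <= h n.
    rewrite -ler_pdivlMl ?exprn_gt0// (le_trans (zh n))//.
    by rewrite /h exprVn.
  rewrite (@le_trans _ _ (h n `^ r))//.
    by rewrite ge0_ler_powR ?nnegrE ?mulr_ge0 ?exprn_ge0 ?(ltW r_gt0) ?(ltW (h_gt0 n)).
  rewrite (@le_trans _ _ (h n))//.
    by apply: ge1r_powR => //; rewrite h_gt0 /h exprn_ile1//; lra.
  rewrite natrX exprS invfM mulrA mulfV ?mul1r// /h exprVn.
  by [].
have gi : mu.-integrable setT (fun x => \sum_(0 <= n <oo) g n x)%E.
  apply/integrableP; split.
    by apply: (@ge0_emeasurable_sum _ _ _ setT g xpredT) => [n x _ _|n _]; [exact: g0|exact: mg].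
  rewrite (eq_integral (fun x => \sum_(0 <= n <oo) g n x)%E).
    by rewrite (le_lt_trans ig)// ltry.
  by move=> x _; rewrite gee0_abs//; apply: nneseries_ge0 => n _ _; exact: g0.
have zB : \forall x \ae mu, forall n, Lp_fun (z n.+1 - z n) x = z n.+1 x - z n x.
  by apply/ae_foralln => n; exact: Lp_funB.
apply: filterS2 (integrable_ae measurableT gi) zB => x /(_ I) gx zx.
set S := (\sum_(0 <= n <oo) g n x)%E in gx.
have gS n : (g n x <= S)%E.
  apply: le_trans (nneseries_lim_ge n.+1 _); last by move=> *; exact: g0.
  rewrite big_nat_recr//= lee_paddl//; apply: sume_ge0 => *; exact: g0.
have [s Ss] : exists s : R, S = s%:E by exists (fine S); rewrite fineK.
have s0 : 0 <= s by rewrite -lee_fin -Ss (le_trans _ (gS 0%N))// g0.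
have dz n : `|z n.+1 x - z n x| <= s `^ r^-1 * h n.
  rewrite /h exprVn ler_pdivlMr ?exprn_gt0// mulrC.
  have := gS n; rewrite Ss lee_fin zx => gs.
  rewrite -[leLHS]powRr1 ?mulr_ge0 ?exprn_ge0//.
  rewrite -[X in _ `^ X](mulfV (_ : r != 0)) ?gt_eqF// powRrM.
  by rewrite ge0_ler_powR ?nnegrE ?powR_ge0// invr_ge0 ltW.
have cs : cvgn (series (telescope (fun n => z n x : R))).
  apply: normed_cvg.
  apply: (@series_le_cvg _ _ (geometric (s `^ r^-1) 2^-1)) => [n|n|n|].
  - exact: normr_ge0.
  - by rewrite /= mulr_ge0 ?powR_ge0// ltW// h_gt0.
  - exact: dz.
  - by apply: is_cvg_geometric_series; rewrite gtr0_norm//; lra.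
rewrite (_ : (fun n => _) =
    (fun n => (z 0%N x : R) + series (telescope (fun n => z n x : R)) n)).
  by apply: is_cvgD => //; exact: is_cvg_cst.
by apply/funext => n; exact: eq_sum_telescope.
Qed.

Lemma fast_cauchy_dist (z : nat -> Lp) : (forall n, `|z n.+1 - z n| <= h n * h n) ->
  forall k n, `|z (k + n)%N - z k| <= 2 * h k.
Proof.
move=> zh k n.
(* The sharper bound is what the induction can carry: one increment is at most [h m], which equals
   [2 * (h m - h m.+1)]. *)
have : `|z (k + n)%N - z k| <= 2 * (h k - h (k + n)).
  elim: n => [|n IH]; first by rewrite addn0 !subrr normr0 mulr0.
  rewrite addnS -(subrK (z (k + n)%N) (z (k + n).+1)) -addrA.
  rewrite (le_trans (ler_normD _ _))//.
  have h1 : h (k + n) <= 1 by rewrite /h exprn_ile1//; lra.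
  have hS : h (k + n).+1 = 2^-1 * h (k + n) by rewrite /h exprS.
  have := zh (k + n)%N; have := h_gt0 (k + n); rewrite hS; nra.
by have := h_gt0 (k + n); lra.
Qed.

(** Convergence holds only almost everywhere, so the limit is taken as an upper limit, which is
    measurable everywhere. Fatou's lemma then transfers the bounds on [z (n + k) - z k] to the limit
    in [n]. *)
Lemma fast_cauchy_cvg (z : nat -> Lp) : (forall n, `|z n.+1 - z n| <= h n * h n) ->
  exists u : Lp, forall n, `|u - z n| <= 2 * h n.
Proof.
move=> zh.
pose f x : R := fine (limn_esup (fun n => (z n x)%:E)).
have mf : measurable_fun setT f.
  apply: (measurableT_comp (fine_measurable measurableT)).
  apply: measurable_fun_limn_esup => n; apply/measurable_EFinP.
  exact: measurable_Lp.
have zf : \forall x \ae mu, (z n x : R) @[n --> \oo] --> f x.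
  apply: filterS (fast_cauchy_ae zh) => x zx.
  rewrite /f (cvg_limn_einf_sup
    (_ : (z n x)%:E @[n --> \oo] --> (limn (fun n => z n x : R))%:E)).2//.
  by apply/cvg_EFin => //; exact: nearW.
have mfz k : measurable_fun setT (fun x => `|f x - z k x| `^ r).
  apply: (measurableT_comp (measurable_powR r)); apply: measurableT_comp => //.
  by apply: measurable_funB => //; exact: measurable_Lp.
have fk k : (\int[mu]_x (`|f x - z k x| `^ r)%:E <= ((2 * h k) `^ r)%:E)%E.
  pose F n x := (`|Lp_fun (z (n + k)%N - z k) x| `^ r)%:E.
  have mF n : measurable_fun setT (F n).
    by apply/measurable_EFinP; exact: measurable_norm_powR.
  have F0 n x : setT x -> (0 <= F n x)%E by rewrite lee_fin powR_ge0.
  apply: (@le_trans _ _ (\int[mu]_x limn_einf (F^~ x))%E).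
    apply: ae_ge0_le_integral => //.
    - by apply/measurable_EFinP; exact: mfz.
    - move=> x _; rewrite limn_einf_lim; apply: lime_ge; first exact: is_cvg_einfs.
      by apply: nearW => n; apply: le_ereal_inf_tmp => _ [m /= _ <-]; exact: F0.
    - rewrite (_ : (fun x => _) = -%E \o (fun x => limn_esup (fun n => - F n x)%E))//.
      apply: measurableT_comp => //; apply: measurable_fun_limn_esup => n.
      exact: measurableT_comp.
    have FB : \forall x \ae mu, forall n,
        Lp_fun (z (n + k)%N - z k) x = z (n + k)%N x - z k x.
      by apply/ae_foralln => n; exact: Lp_funB.
    apply: filterS2 zf FB => x zx Fx _.
    rewrite (cvg_limn_einf_sup (_ : F n x @[n --> \oo] --> (`|f x - z k x| `^ r)%:E)).1//.
    apply/cvg_EFin; first exact: nearW.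
    rewrite (_ : _ \o _ = fun n => `|(z (n + k)%N x : R) - z k x| `^ r).
      have zk : (z (n + k)%N x : R) @[n --> \oo] --> f x.
        by rewrite (cvg_shiftn k (fun n => z n x : R)).
      have cf : continuous (fun t : R => `|t - z k x| `^ r).
        move=> t.
        apply: (@continuous_comp _ _ _ (fun t => t - z k x) (fun x : R => `|x| `^ r)).
          by apply: cvgB; [exact: cvg_id|exact: cvg_cst].
        exact: continuous_norm_powR.
      exact: (cvg_comp _ _ zk (cf (f x))).
    by apply/funext => n; rewrite /= /F Fx.
  apply: le_trans (fatou mu measurableT mF F0) _.
  rewrite limn_einf_lim; apply: lime_le; first exact: is_cvg_einfs.
  apply: nearW => n; rewrite (@le_trans _ _ (\int[mu]_x F n x)%E)//.
    by apply: ereal_inf_lbound; exists n => /=.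
  rewrite Lp_norm_powR lee_fin ge0_ler_powR ?nnegrE ?(ltW r_gt0)//.
    by rewrite mulr_ge0// ltW.
  by rewrite addnC fast_cauchy_dist.
have fL : (fun x => f x - z 0%N x) \in Lfun mu r%:E.
  rewrite inE; apply/andP; split.
    by rewrite inE /=; apply: measurable_funB => //; exact: measurable_Lp.
  rewrite inE /= /finite_norm unlock; apply: poweR_lty.
  exact: le_lt_trans (fk 0%N) (ltry _).
(* Finite norm has been obtained for the differences [f - z k], so the limit is assembled from the
   class of [f - z 0] and [z 0]. *)
have [w wf] := Lp_of_Lfun r1 fL; exists (w + z 0%N) => n.
have uf : \forall x \ae mu, Lp_fun (w + z 0%N - z n) x = f x - z n x.
  apply: filterS3 (Lp_funB (w + z 0%N) (z n)) (Lp_funD w (z 0%N)) wf.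
  by move=> x -> -> ->; rewrite subrK.
have h0 : 0 <= 2 * h n by rewrite mulr_ge0// ltW.
have : ((`|w + z 0%N - z n| `^ r)%:E <= ((2 * h n) `^ r)%:E)%E.
  rewrite -Lp_norm_powR (le_trans _ (fk n))//; apply: ae_ge0_le_integral => //.
  - by apply/measurable_EFinP; exact: measurable_norm_powR.
  - by apply/measurable_EFinP; exact: mfz.
  - by apply: filterS uf => x -> _.
rewrite lee_fin leNgt => H; rewrite leNgt; apply/negP => hw; move/negP: H; apply.
by rewrite gt0_ltr_powR ?nnegrE.
Qed.

Lemma Lp_cauchy_cvg (F : set_system Lp) : ProperFilter F -> cauchy F -> cvg F.
Proof.
move=> FF Fc0; have Fc : cauchy_ex F := iffLR (cauchyP F) Fc0.
have /choice[x xF] n : exists x, F (ball x (h n * h n / 2)).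
  by apply: Fc; rewrite divr_gt0// mulr_gt0.
(* Choosing [z n] in both the ball of index [n] and the next one links [z n] to [z n.+1] through the
   common centre [x n.+1]. *)
have /choice[z zx] n : exists z, ball (x n) (h n * h n / 2) z /\
    ball (x n.+1) (h n.+1 * h n.+1 / 2) z.
  by have [z] := filter_ex (filterI (xF n) (xF n.+1)); exists z.
have hS n : h n.+1 <= h n by have := h_gt0 n; rewrite /h exprS -/(h n); lra.
have [n|u uz] := @fast_cauchy_cvg z.
  have [_ z1] := zx n; have [z2 _] := zx n.+1.
  rewrite -!ball_normE /= in z1 z2.
  rewrite -(subrK (x n.+1) (z n.+1)) -addrA (le_trans (ler_normD _ _))//.
  rewrite distrC; have := hS n; have := h_gt0 n.+1; nra.
suff Fu : F --> u by exact: cvgP Fu.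
apply/cvgrPdist_lt => e e0.
have [n hn] : exists n, 4 * h n < e.
  have : geometric (4 : R) 2^-1 n @[n --> \oo] --> 0.
    by apply: cvg_geometric; rewrite gtr0_norm//; lra.
  move/cvgrPdist_lt => /(_ e e0)[n _ /(_ n (leqnn n))] /=.
  by rewrite sub0r normrN gtr0_norm ?mulr_gt0 ?exprn_gt0//; exists n.
apply: filterS (xF n) => y; rewrite -ball_normE/= => xy.
have [+ _] := zx n; rewrite -ball_normE/= => xz.
have := uz n => uzn.
rewrite -(subrK (z n) u) -addrA (le_lt_trans (ler_normD _ _))//.
have -> : z n - y = (z n - x n) + (x n - y) by rewrite addrA subrK.
have := ler_normD (z n - x n) (x n - y); rewrite (distrC (z n)) => t.
have h1 : h n <= 1 by rewrite /h exprn_ile1//; lra.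
have := h_gt0 n => h0.
have : h n * h n <= h n by rewrite ler_piMr// ltW.
lra.
Unshelve. all: by end_near. Qed.

End Lp_complete.

HB.instance Definition _ d (T : measurableType d) (R : realType)
    (mu : {measure set T -> \bar R}) (r : R) (r1 : (1 <= r%:E)%E) :=
  Uniform_isComplete.Build (Lp mu r1) (@Lp_cauchy_cvg d T R mu r r1).

(** * Integration on R^n *)

Section restricted_integral.
Context d (T : measurableType d) (R : realType) (mu : {measure set T -> \bar R}).
Variables (D : set T) (mD : measurable D).

Lemma integral_mrestr (f : T -> \bar R) : measurable_fun setT f ->
  (\int[mrestr mu mD]_x f x = \int[mu]_(x in D) f x)%E.
Proof.
have H (g : T -> \bar R) : measurable_fun setT g -> (forall x, 0 <= g x)%E ->
    (\int[mrestr mu mD]_x g x = \int[mu]_(x in D) g x)%E.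
  move=> mg g0; rewrite [LHS](@ge0_negligible_integral _ _ _ _ setT (~` D))//.
  - rewrite setTD setCK; apply: eq_measure_integral => A mA AD.
    by rewrite /= /mrestr setIidl.
  - exact: measurableC.
  - by rewrite /= /mrestr setICl measure0.
move=> mf; rewrite [LHS]integralE [RHS]integralE !H//.
- exact: measurable_funeneg.
- exact: measurable_funepos.
Qed.

Lemma Rintegral_mrestr (f : T -> R) : measurable_fun setT f ->
  \int[mu]_(x in D) f x = \int[mrestr mu mD]_x f x.
Proof.
by move=> mf; rewrite /Rintegral integral_mrestr//; exact/measurable_EFinP.
Qed.

End restricted_integral.

(** * Pairings of L^p with bounded functions on a finite measure space *)

Section finite_measure_pairing.
Context d (T : measurableType d) (R : realType) (m : {measure set T -> \bar R}).
Hypothesis m_fin : m setT \is a fin_num.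

Lemma Lfun_integrable1 (r : R) (h : T -> R) : 1 <= r -> h \in Lfun m r%:E ->
  m.-integrable setT (EFin \o h).
Proof.
move=> r1 hL; apply/Lfun1_integrable.
by apply: (@Lfun_subset _ _ _ _ 1%:E r%:E) hL => //; rewrite lee_fin.
Qed.

Lemma measurable_Lfun (p : \bar R) (h : T -> R) : h \in Lfun m p ->
  measurable_fun setT h.
Proof. by move=> /sub_Lfun_mfun; rewrite inE. Qed.

Lemma integrable_scale (a : R) (h : T -> R) : m.-integrable setT (EFin \o h) ->
  m.-integrable setT (EFin \o (fun x => a * h x)).
Proof.
move=> ih; rewrite (_ : _ \o _ = (fun x => a%:E * (EFin \o h) x)%E).
  exact: integrableZl.
by apply/funext => x /=; rewrite EFinM.
Qed.

Lemma integrable_bounded_mul (h f : T -> R) (B : R) :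
  m.-integrable setT (EFin \o h) -> measurable_fun setT f ->
  (forall x, `|f x| <= B) -> m.-integrable setT (EFin \o (fun x => h x * f x)).
Proof.
move=> ih mf fB.
rewrite (_ : _ \o _ = (EFin \o h) \* (EFin \o f))%E; last first.
  by apply/funext => x; rewrite /= EFinM.
apply: integrableMl => //; exists B; split; first exact: num_real.
by move=> c Bc x _ /=; rewrite (le_trans (fB x))// ltW.
Qed.

Lemma Rintegral_bounded_mul_le (h f : T -> R) (B : R) :
  m.-integrable setT (EFin \o h) -> measurable_fun setT f ->
  (forall x, `|f x| <= B) ->
  `|\int[m]_x (h x * f x)| <= B * \int[m]_x `|h x|.
Proof.
move=> ih mf fB.
have ihf := integrable_bounded_mul ih mf fB.
apply: le_trans (le_normr_Rintegral measurableT ihf) _.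
have inh : m.-integrable setT (EFin \o (fun x => `|h x|)).
  exact: (integrable_norm ih).
rewrite -RintegralZl//; apply: le_Rintegral => //.
- exact: (integrable_norm ihf).
- exact: integrable_scale.
- by move=> x _; rewrite normrM mulrC ler_wpM2r.
Qed.

Section exponent.
Variables (r : R) (r1 : (1 <= r%:E)%E).
Local Notation Lp := (Lp m r1).

Lemma Lp_integrable (u : Lp) : m.-integrable setT (EFin \o (u : T -> R)).
Proof. by apply: (@Lfun_integrable1 r); [rewrite -lee_fin|exact: Lp_Lfun]. Qed.

Lemma Rintegral_normZ (a : R) (u : Lp) :
  \int[m]_x `|Lp_fun (a *: u) x| = `|a| * \int[m]_x `|u x|.
Proof.
rewrite -RintegralZl//; last exact: (integrable_norm (Lp_integrable u)).
congr fine; apply: ae_eq_integral => //.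
- by apply/measurable_EFinP; apply: measurableT_comp => //; exact: measurable_Lp.
- apply/measurable_EFinP; apply: measurable_funM => //.
  by apply: measurableT_comp => //; exact: measurable_Lp.
by apply: filterS (Lp_funZ a u) => x -> _; rewrite normrM.
Qed.

(** Integrating [t <= 1 + t ^ r] bounds the L^1 norm by the total mass plus 1 on the unit sphere,
    and homogeneity does the rest. *)
Lemma Lp_norm1_le : exists2 K : R, 0 <= K &
  forall u : Lp, \int[m]_x `|u x| <= K * `|u|.
Proof.
have r1' : 1 <= r by rewrite -lee_fin.
pose c := fine (m setT).
have c0 : 0 <= c by exact: fine_ge0.
have H (u : Lp) : \int[m]_x `|u x| <= c + `|u| `^ r.
  have iur : m.-integrable setT (EFin \o (fun x => `|u x| `^ r)).
    exact: (Lfun_integrable r1' (Lp_Lfun u)).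
  have i1 : m.-integrable setT (EFin \o (cst (1 : R))).
    apply/integrableP; split; first by apply/measurable_EFinP; exact: measurable_cst.
    rewrite (eq_integral (cst 1%E)); last by move=> x _ /=; rewrite normr1.
    by rewrite integral_cst// mul1e ltey_eq m_fin.
  have -> : `|u| `^ r = \int[m]_x `|u x| `^ r by rewrite /Rintegral Lp_norm_powR.
  have -> : c = \int[m]_x (cst (1 : R) x).
    by rewrite Rintegral_cst// mul1r.
  rewrite -RintegralD//; apply: le_Rintegral => //.
  - exact: (integrable_norm (Lp_integrable u)).
  - exact: (integrableD measurableT i1 iur).
  move=> x _ /=; have [x1|x1] := leP 1 `|u x|.
    by rewrite (le_trans (le1r_powR x1 r1'))// lerDr.
  by rewrite (le_trans (ltW x1))// lerDl powR_ge0.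
exists (c + 1); first by rewrite addr_ge0.
move=> u; have [->|u0] := eqVneq u 0.
  by rewrite -[X in Lp_fun X](scale0r 0) Rintegral_normZ !normr0 mul0r mulr0.
have nu : 0 < `|u| by rewrite normr_gt0.
have := H (`|u|^-1 *: u); rewrite Rintegral_normZ normrZ normfV normr_id.
by rewrite mulVf ?gt_eqF// powR1 ler_pdivrMl// mulrC.
Qed.

Lemma pairing_dual (f : T -> R) (B : R) : 0 <= B -> measurable_fun setT f ->
  (forall x, `|f x| <= B) ->
  exists phi : dual Lp, forall u : Lp, phi u = \int[m]_x (u x * f x).
Proof.
move=> B0 mf fB; have [K K0 KP] := Lp_norm1_le.
pose phi (u : Lp) : R^o := \int[m]_x (u x * f x).
have iuf (u : Lp) : m.-integrable setT (EFin \o (fun x => u x * f x)).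
  by apply: (integrable_bounded_mul (Lp_integrable u) mf fB).
have lphi : linear phi.
  move=> a u v; rewrite /phi.
  rewrite -[RHS]/(a * \int[m]_x (Lp_fun u x * f x) + \int[m]_x (Lp_fun v x * f x)).
  rewrite -RintegralZl// -RintegralD//; last first.
    exact: integrable_scale.
  congr fine; apply: ae_eq_integral => //.
  - by apply/measurable_EFinP; apply: measurable_funM => //; exact: measurable_Lp.
  - apply/measurable_EFinP; apply: measurable_funD.
      by apply: measurable_funM => //; apply: measurable_funM => //; exact: measurable_Lp.
    by apply: measurable_funM => //; exact: measurable_Lp.
  apply: filterS2 (Lp_funD (a *: u) v) (Lp_funZ a u) => x -> -> _.
  by rewrite mulrDl mulrA.
have bphi u : `|phi u| <= (B * K) * `|u|.
  rewrite (le_trans (Rintegral_bounded_mul_le (Lp_integrable u) mf fB))//.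
  by rewrite -mulrA ler_wpM2l.
by exists (Dual (dual_predP lphi bphi)).
Qed.
End exponent.
End finite_measure_pairing.

(** * Boxes and bump functions in R^n *)

Section row_vector_measure.
Context {R : realType} {n : nat}.
Implicit Types (w O : set 'rV[R]_n) (x y : 'rV[R]_n).
Local Notation leb := (lebesgue_rV R n).

Lemma measurable_continuous (f : 'rV[R]_n -> R) : continuous f ->
  measurable_fun setT f.
Proof.
move=> cf; apply: (measurability _ (RGenOInfty.measurableE R)) => //.
move=> _ [_ [x ->] <-]; rewrite setTI; apply: open_measurable_rV.
rewrite set_itvE; apply: open_comp; last exact: open_gt.
by move=> v _; exact: cf.
Qed.

Lemma bounded_set_norm w : bounded_set w -> exists M : R, forall x, w x -> `|x| <= M.
Proof.
move=> [M0 [_ wM]]; exists (M0 + 1) => x wx.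
by apply: (wM (M0 + 1)) => //; rewrite ltrDl.
Qed.

Definition rV_box (a b : 'rV[R]_n) : set 'rV[R]_n :=
  [set v | forall i, a ord0 i <= v ord0 i <= b ord0 i].

Lemma measurable_rV_box a b : measurable (rV_box a b).
Proof.
rewrite (_ : rV_box a b = \bigcap_(i in [set: 'I_n])
    (fun v : 'rV[R]_n => v ord0 i) @^-1` `[a ord0 i, b ord0 i]).
  apply: fin_bigcap_measurable => // i _; rewrite -[X in measurable X]setTI.
  exact: measurable_coord.
apply/seteqP; split => v h i /=; first by rewrite in_itv/= h.
by have := h i I; rewrite /= in_itv.
Qed.

Lemma rV_box_setI_closed : setI_closed (range (fun ab => rV_box ab.1 ab.2)).
Proof.
move=> _ _ [[a b] _ <-] [[a' b'] _ <-].
exists (\row_i Num.max (a ord0 i) (a' ord0 i), \row_i Num.min (b ord0 i) (b' ord0 i)) => //.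
apply/seteqP; split => v /= h.
  by split => i; have := h i; rewrite !mxE ge_max le_min;
    move=> /andP[/andP[p1 p2] /andP[p3 p4]]; rewrite ?p1 ?p2 ?p3 ?p4.
move=> i; rewrite !mxE ge_max le_min.
by have [/(_ i)/andP[-> ->] /(_ i)/andP[-> ->]] := h.
Qed.

(** Closed boxes are stable under intersection and have explicit Lebesgue measure, so a measure can
    be identified on them; this is how translation invariance is obtained. *)
Lemma sigma_algebra_rV_box : @measurable _ 'rV[R]_n =
  <<s range (fun ab : 'rV[R]_n * 'rV[R]_n => rV_box ab.1 ab.2) >>.
Proof.
apply/seteqP; split; last first.
  apply: smallest_sub; first exact: sigma_algebra_measurable.
  by move=> _ [[a b] _ <-]; exact: measurable_rV_box.
apply: smallest_sub; first exact: smallest_sigma_algebra.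
move=> U oU.
pose cb (c : 'rV[rat]_n * 'rV[rat]_n) := rV_box (map_mx ratr c.1) (map_mx ratr c.2).
have -> : U = \bigcup_(c in [set c | cb c `<=` U]) cb c.
  apply/seteqP; split => [v Uv|v [c cU /cU//]].
  have /nbhs_ballP[e /= e0 eU] : nbhs v U by exact: open_nbhs_nbhs.
  have /choice[p pP] i : exists q : rat, v ord0 i - e / 2 < ratr q < v ord0 i.
    have /rat_in_itvoo[q] : v ord0 i - e / 2 < v ord0 i.
      by rewrite ltrBlDr ltrDl divr_gt0.
    by rewrite in_itv/=; exists q.
  have /choice[q qP] i : exists q : rat, v ord0 i < ratr q < v ord0 i + e / 2.
    have /rat_in_itvoo[q] : v ord0 i < v ord0 i + e / 2.
      by rewrite ltrDl divr_gt0.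
    by rewrite in_itv/=; exists q.
  exists (\row_i p i, \row_i q i) => /=.
    move=> w wc; apply: eU; split => // i j; rewrite ord1.
    have := wc j; rewrite !mxE => /andP[w1 w2].
    have /andP[p1 p2] := pP j; have /andP[q1 q2] := qP j.
    by rewrite /ball/= ltr_distl; apply/andP; split; lra.
  move=> i; rewrite !mxE; have /andP[_ p2] := pP i; have /andP[q1 _] := qP i.
  by rewrite !ltW.
rewrite bigcup_mkcond.
pose G := range (fun ab : 'rV[R]_n * 'rV[R]_n => rV_box ab.1 ab.2).
change (@measurable _ (g_sigma_algebraType G)
  (\bigcup_c if c \in [set c | cb c `<=` U] then cb c else set0)).
apply: countable_bigcupT_measurable => // c; case: ifPn => // _.
by apply: sub_sigma_algebra; exists (map_mx ratr c.1, map_mx ratr c.2).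
Qed.

Lemma lebesgue_rV_bounded w : measurable w -> bounded_set w -> leb w \is a fin_num.
Proof.
move=> mw /bounded_set_norm[M wM].
pose a : 'rV[R]_n := const_mx (- `|M|); pose b : 'rV[R]_n := const_mx `|M|.
have ab i : a ord0 i <= b ord0 i.
  by rewrite !mxE (le_trans (_ : _ <= 0))// oppr_le0.
rewrite ge0_fin_numE//; apply: le_lt_trans (ltry (\prod_i (b ord0 i - a ord0 i))).
rewrite -lebesgue_rV_box//; apply: le_measure; rewrite ?inE//.
  exact: measurable_rV_box.
move=> x /wM xM i; rewrite !mxE -ler_norml.
by rewrite (le_trans (norm_coord_le _ _))// (le_trans xM)// ler_norm.
Qed.

(** The distance to the complement of [O], capped at 1 so that it is finite for the whole space. The
    radius 0, whose ball is empty, keeps the set of radii nonempty and gives the value 0 outside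
    [O]. *)
Definition inner_radius O x : R := sup [set s | 0 <= s <= 1 /\ ball x s `<=` O].

Lemma inner_radius_has_sup O x : has_sup [set s : R | 0 <= s <= 1 /\ ball x s `<=` O].
Proof.
split; last by exists 1 => s [/andP[]].
exists 0; split; first by rewrite lexx ler01.
by move=> y; rewrite -ball_normE /= ltNge normr_ge0.
Qed.

Lemma inner_radius_ge0 O x : 0 <= inner_radius O x.
Proof.
apply: ub_le_sup; first exact: (inner_radius_has_sup O x).2.
split; first by rewrite lexx ler01.
by move=> y; rewrite -ball_normE /= ltNge normr_ge0.
Qed.

Lemma inner_radius_gt0 O x : open O -> O x -> 0 < inner_radius O x.
Proof.
move=> oO Ox; have /nbhs_ballP[e /= e0 eO] : nbhs x O by exact: open_nbhs_nbhs.
have m0 : 0 < Num.min e 1 by rewrite lt_min e0 ltr01.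
apply: (lt_le_trans m0).
apply: ub_le_sup; first exact: (inner_radius_has_sup O x).2.
split; first by rewrite (ltW m0) ge_min lexx orbT.
by apply: subset_trans eO; apply: le_ball; rewrite ge_min lexx.
Qed.

Lemma inner_radius_mem O x : 0 < inner_radius O x -> O x.
Proof.
move=> /(sup_gt (inner_radius_has_sup O x).1)[s [/andP[_ _] sO] s0].
by apply: sO; exact: ballxx.
Qed.

Lemma inner_radius_le O x y : inner_radius O x <= inner_radius O y + `|x - y|.
Proof.
apply: ge_sup; first exact: (inner_radius_has_sup O x).1.
move=> s [/andP[s0 s1] sO]; rewrite -lerBlDr.
have [sxy|sxy] := leP (s - `|x - y|) 0; first exact: le_trans (inner_radius_ge0 _ _).
apply: ub_le_sup; first exact: (inner_radius_has_sup O y).2.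
split; first by rewrite (ltW sxy) (le_trans _ s1)// gerBl.
move=> z; rewrite -ball_normE /= => yz; apply: sO; rewrite -ball_normE /=.
rewrite (_ : x - z = (x - y) + (y - z)); last by rewrite addrA subrK.
by rewrite (le_lt_trans (ler_normD _ _))// -ltrBrDl.
Qed.

Lemma inner_radius_continuous O : continuous (inner_radius O).
Proof.
move=> x; apply/(@cvgrPdist_le _ _ _ (nbhs x)) => e e0; near=> y.
have h1 := inner_radius_le O x y; have h2 := inner_radius_le O y x.
rewrite distrC in h2.
apply: (@le_trans _ _ `|x - y|).
  by rewrite ler_norml; apply/andP; split; lra.
near: y; apply: cvgr_dist_le => //; exact: cvg_id.
Unshelve. all: by end_near. Qed.

Lemma clamp_continuous : continuous (fun t : R => Num.min 1 (Num.max 0 t)).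
Proof.
move=> t; apply/cvgrPdist_le => e e0; near=> s.
apply: (@le_trans _ _ `|t - s|); last first.
  by near: s; apply: cvgr_dist_le => //; exact: cvg_id.
have h1 := ler_norm (t - s); have h2 := ler_norm (s - t); rewrite distrC in h2.
move: h1 h2; case: (leP 0 t) => ? h1 h2; case: (leP 0 s) => ?;
  case: (@leP _ R 1) => ?; try case: (@leP _ R 1) => ?; rewrite ler_norml; apply/andP; split; lra.
Unshelve. all: by end_near. Qed.

(** Zero where the inner radius is at most [1 / k] and one where it is at least [2 / k]. The
    subtraction of 1 is what keeps the closed support inside [O]. *)
Definition bump O (k : nat) x : R :=
  Num.min 1 (Num.max 0 (k%:R * inner_radius O x - 1)).

Lemma bump_ge0 O k x : 0 <= bump O k x.
Proof. by rewrite le_min ler01 le_max lexx. Qed.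

Lemma bump_le1 O k x : bump O k x <= 1.
Proof. by rewrite ge_min lexx. Qed.

Lemma bump_Cc O w k : open O -> O `<=` w -> bounded_set w -> Cc w (bump O k).
Proof.
move=> oO Ow /bounded_set_norm[M wM].
have supp : tsupport (bump O k) `<=` [set x | 1 <= k%:R * inner_radius O x].
  rewrite /tsupport (_ : [set x | 1 <= _] =
      closure [set x | 1 <= k%:R * inner_radius O x]).
    apply: closure_subset => x /=; apply: contra_neqP => /negP.
    rewrite -ltNge -subr_lt0 => h.
    by rewrite /bump max_l ?(ltW h)// min_r.
  apply/closure_id; apply: (@closed_comp _ _ (fun x => k%:R * inner_radius O x)
    [set t : R | 1 <= t]).
    by move=> x _; apply: (@cvgMr _ _ (nbhs x)); exact: inner_radius_continuous.
  exact: closed_ge.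
have suppO : tsupport (bump O k) `<=` O.
  move=> x /supp /= h; apply: inner_radius_mem; rewrite ltNge; apply/negP => h0.
  by have := le_trans h (mulr_ge0_le0 (ler0n _ k) h0); rewrite ler10.
split.
- move=> x; apply: (@continuous_comp _ _ _ (fun x => k%:R * inner_radius O x - 1)
    (fun t => Num.min 1 (Num.max 0 t))).
    apply: (@cvgB _ _ _ (nbhs x)); last exact: cvg_cst.
    by apply: (@cvgMr _ _ (nbhs x)); exact: inner_radius_continuous.
  exact: clamp_continuous.
- apply: bounded_closed_compact; last exact: closed_closure.
  exists M; split; first exact: num_real.
  by move=> c Mc x /suppO/Ow/wM xM /=; rewrite (le_trans xM)// ltW.
- exact: subset_trans suppO Ow.
Qed.

Lemma bump_cvg O : open O -> forall x, bump O k x @[k --> \oo] --> (\1_O x : R).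
Proof.
move=> oO x; rewrite indicE; case: (asboolP (O x)) => Ox.
  rewrite mem_set//; have d0 := inner_radius_gt0 oO Ox.
  apply: cvg_near_cst; near=> k.
  have : 2 / inner_radius O x <= k%:R by near: k; exact: nbhs_infty_ger.
  rewrite ler_pdivrMr// => h; rewrite /bump min_l// le_max; apply/orP; right; lra.
rewrite memNset//.
have -> : bump O ^~ x = cst 0; last exact: cvg_cst.
apply/funext => k; rewrite /bump.
have -> : inner_radius O x = 0.
  apply/eqP; rewrite eq_le inner_radius_ge0 andbT leNgt; apply/negP.
  by move=> /inner_radius_mem.
by rewrite mulr0 sub0r max_l ?oppr_le0// min_r.
Unshelve. all: by end_near. Qed.

End row_vector_measure.

(** * The fundamental lemma of the calculus of variations *)

Section fundamental_lemma.
Context {R : realType} {n : nat} (w : openset R n).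
Hypothesis bw : bounded_set w.
Local Notation leb := (lebesgue_rV R n).
Local Notation m := (leb_on w).

Lemma leb_on_fin : m setT \is a fin_num.
Proof.
rewrite /leb_on /mrestr /= setTI; apply: lebesgue_rV_bounded => //.
exact: open_measurable_rV (oset_open w).
Qed.

Lemma leb_on_setC : m (~` w) = 0%E.
Proof. by rewrite /leb_on /mrestr /= setICl measure0. Qed.

(** Bump functions and dominated convergence make the integral of [h] vanish over open subsets of
    [w], hence over all open sets, as the measure lives on [w]. Open sets are stable under
    intersection and generate the Borel sets, so a Dynkin argument reaches every measurable set. *)
Lemma Cc_orthogonal_ae0 (h : 'rV[R]_n -> R) :
  m.-integrable setT (EFin \o h) ->
  (forall f, Cc w f -> \int[m]_x (h x * f x) = 0) ->
  \forall x \ae m, h x = 0.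
Proof.
move=> ih hf.
have mh : measurable_fun setT h by apply/measurable_EFinP; exact: measurable_int ih.
have mw : measurable w by exact: open_measurable_rV (oset_open w).
have step1 O : open O -> O `<=` w -> (\int[m]_(x in O) (h x)%:E = 0)%E.
  move=> oO Ow; have mO := open_measurable_rV oO.
  rewrite integral_mkcond.
  have mbump k : measurable_fun setT (bump O k).
    by have [cb _ _] := bump_Cc k oO Ow bw; exact: measurable_continuous.
  have iE k : (\int[m]_x (h x * bump O k x)%:E = 0)%E.
    have := hf _ (bump_Cc k oO Ow bw); rewrite /Rintegral => h0.
    rewrite -[LHS]fineK ?h0//; apply: integrable_fin_num => //.
    apply: (@integrable_bounded_mul _ _ _ _ h (bump O k) 1) => // x.
    by rewrite ger0_norm ?bump_ge0// bump_le1.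
  have [|||||_ _] := @dominated_convergence _ _ _ m setT measurableT
    (fun k => EFin \o (fun x => h x * bump O k x))
    (EFin \o (fun x => h x * \1_O x)) (EFin \o (fun x => `|h x|)).
  - by move=> k; apply/measurable_EFinP; exact: measurable_funM.
  - by apply/measurable_EFinP; apply: measurable_funM.
  - apply: nearW => x _; apply/cvg_EFin; first exact: nearW.
    by apply: cvgMr; exact: bump_cvg.
  - exact: (integrable_norm ih).
  - apply: nearW => x k _; rewrite /= lee_fin normrM ler_piMr//.
    by rewrite ger0_norm ?bump_ge0// bump_le1.
  move=> c.
  have : (\int[m]_x (h x * \1_O x)%:E = 0)%E.
    apply: (cvg_unique _ c) => //.
    rewrite (_ : (fun n => _) = cst 0%E); first exact: cvg_cst.
    by apply/funext => k; exact: iE.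
  move=> <-; apply: eq_integral => x _; rewrite /= patchE indicE.
  by case: ifPn => _; rewrite ?mulr1 ?mulr0.
have nullC B : measurable B -> (\int[m]_(x in B) (h x)%:E = \int[m]_(x in B `&` w) (h x)%:E)%E.
  move=> mB; rewrite (@negligible_integral _ _ _ m B (~` w)) ?setDE ?setCK//.
  - exact: measurableC.
  - exact: (integrableS measurableT).
  - exact: leb_on_setC.
have step2 (B : set 'rV[R]_n) : measurable B -> (\int[m]_(x in B) (h x)%:E = 0)%E.
  have OI : setI_closed (@open 'rV[R]_n) by move=> *; exact: openI.
  have Po (O : set 'rV[R]_n) : open O -> (\int[m]_(x in O) (h x)%:E = 0)%E.
    move=> oO; rewrite nullC; last exact: open_measurable_rV.
    by apply: step1; [apply: openI => //; exact: oset_open|].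
  have PT := Po _ (@openT _).
  move=> mB; pose P B := (\int[m]_(x in B) (h x)%:E = 0)%E.
  apply: (@dynkin_induction _ 'rV[R]_n (@open 'rV[R]_n) P _ OI PT Po) => //.
  - move=> S mS PS; move: PT; rewrite /P.
    have -> : [set: 'rV[R]_n] = S `|` ~` S by rewrite setUv.
    rewrite integral_setU ?PS ?add0e//.
    - exact: measurableC.
    - by rewrite setUv; apply/measurable_EFinP.
    - by apply/disj_setPS => x [].
  - move=> F mF tF PF; rewrite /P.
    rewrite integral_bigcup//.
      by apply: eseries0 => i _ _; exact: PF.
    apply: (integrableS measurableT) => //; exact: bigcup_measurable.
have H : ae_eq m setT (EFin \o h) (cst 0%E).
  apply: integral_ae_eq => // E _ mE.
  by rewrite step2// integral0.
by apply: filterS H => x /(_ I) [].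
Qed.
End fundamental_lemma.

(** * Translation invariance of Lebesgue measure *)

Section translation_invariance.
Context {R : realType} {n : nat}.
Local Notation leb := (lebesgue_rV R n).

Lemma measurable_shift (y : 'rV[R]_n) :
  measurable_fun setT (fun x : 'rV[R]_n => x + y).
Proof.
apply: measurable_fun_rV => i.
rewrite (_ : (fun x => _) = fun x : 'rV[R]_n => x ord0 i + y ord0 i).
  apply: measurable_funD; [exact: measurable_coord|exact: measurable_cst].
by apply/funext => x; rewrite mxE.
Qed.

Lemma lebesgue_rV_boxE (a b : 'rV[R]_n) : leb (rV_box a b) =
  if `[< forall i, a ord0 i <= b ord0 i >] then (\prod_i (b ord0 i - a ord0 i))%:E else 0%E.
Proof.
case: asboolP => ab; first exact: lebesgue_rV_box.
rewrite (_ : rV_box a b = set0) ?measure0//; apply/seteqP; split => // v /= vab.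
by apply: ab => i; have /andP[] := vab i; exact: le_trans.
Qed.

Lemma lebesgue_rV_shift (y : 'rV[R]_n) (A : set 'rV[R]_n) : measurable A ->
  leb ((fun x => x + y) @^-1` A) = leb A.
Proof.
move=> mA.
pose nu := measure_function_pushforward__canonical__measure_function_Measure
  leb (measurable_shift y).
rewrite -[LHS]/(nu A).
apply: (measure_unique (range (fun ab : 'rV[R]_n * 'rV[R]_n => rV_box ab.1 ab.2))
  (fun k => rV_box (const_mx (- k%:R)) (const_mx k%:R))) => //.
- exact: sigma_algebra_rV_box.
- exact: rV_box_setI_closed.
- by move=> k; exists (const_mx (- k%:R), const_mx k%:R).
- apply/seteqP; split => // v _; exists (Num.bound `|v|) => // i.
  rewrite !mxE -ler_norml (le_trans (norm_coord_le _ _))// ltW//.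
  by apply: archi_boundP.
- move=> _ [[a b] _ <-]; rewrite /nu /= /pushforward.
  rewrite (_ : _ @^-1` _ = rV_box (a - y) (b - y)).
    rewrite !lebesgue_rV_boxE.
    rewrite (_ : `[< _ >] = `[< forall i, a ord0 i <= b ord0 i >]).
      case: ifP => // _; congr EFin; apply: eq_bigr => i _; rewrite !mxE.
      by ring.
    by apply/asboolP/asboolP => ab i; have := ab i; rewrite !mxE lerD2r.
  by apply/seteqP; split => v /= h i; have := h i; rewrite !mxE lerBlDr lerBrDr.
- move=> k; rewrite /nu /= /pushforward.
  rewrite (_ : _ @^-1` _ = rV_box (const_mx (- k%:R) - y) (const_mx k%:R - y)).
    by rewrite lebesgue_rV_boxE; case: ifP => _; rewrite ltry.
  by apply/seteqP; split => v /= h i; have := h i; rewrite !mxE lerBlDr lerBrDr.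
Qed.

Lemma ge0_integral_shift (y : 'rV[R]_n) (f : 'rV[R]_n -> \bar R) :
  measurable_fun setT f -> (forall x, 0 <= f x)%E ->
  (\int[leb]_x f (x + y)%R = \int[leb]_x f x)%E.
Proof.
move=> mf f0.
pose nu := measure_function_pushforward__canonical__measure_function_Measure
  leb (measurable_shift y).
have := @ge0_integral_pushforward _ _ _ _ R _ (measurable_shift y) leb setT f measurableT mf.
rewrite preimage_setT => <-; last by move=> x _; exact: f0.
apply: (@eq_measure_integral _ _ _ _ _ nu) => A mA _.
by rewrite -[LHS]/(leb _) lebesgue_rV_shift.
Qed.

End translation_invariance.

(** * Correlations and convolutions *)

Section C0_facts.
Context {R : realType} {n : nat} (w : set 'rV[R]_n).
Implicit Types (f : 'rV[R]_n -> R^o) (p : C0 w).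

Lemma Cc_bounded f : Cc w f -> exists2 B : R, 0 <= B & forall x, `|f x| <= B.
Proof.
move=> [cf kf _].
have : compact (f @` tsupport f).
  by apply: continuous_compact => //; exact: continuous_subspaceT.
move=> /compact_bounded[M [_ gM]]; exists (Num.max (M + 1) 0); first by rewrite le_max lexx orbT.
move=> x; rewrite le_max; have [->|gx] := eqVneq (f x) 0; first by rewrite normr0 lexx orbT.
by rewrite (gM (M + 1)) ?ltrDl//; exists x => //; exact: subset_closure.
Qed.

Lemma Cc_sub0 : Cc w 0.
Proof.
have s0 : tsupport (0 : 'rV[R]_n -> R^o) = set0.
  rewrite /tsupport (_ : mkset _ = set0) ?closure0//.
  by apply/seteqP; split => x //=; rewrite eqxx.
split; first exact: (@cst_continuous _ _ (0 : R^o)).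
  by rewrite s0; exact: compact0.
by rewrite s0.
Qed.

Lemma Cc_comb a f g : Cc w f -> Cc w g -> Cc w (fun x => f x + a * g x).
Proof.
move=> [cf kf sf] [cg kg sg].
have sfg : tsupport (fun x => f x + a * g x : R^o) `<=` tsupport f `|` tsupport g.
  rewrite /tsupport -closureU; apply: closure_subset => x /=.
  have [f0|] := eqVneq (f x) 0; last by left.
  have [g0|] := eqVneq (g x) 0; last by right.
  by rewrite f0 g0 mulr0 addr0 eqxx.
split.
- move=> x; apply: (@cvgD _ _ _ (nbhs x)); first exact: cf.
  by apply: (@cvgMr _ _ (nbhs x)); exact: cg.
- exact: (@subclosed_compact _ _ _ (@closed_closure _ _) (compactU kf kg) sfg).
- by move=> x /sfg[/sf|/sg].
Qed.

Lemma Cc_out f x : Cc w f -> ~ w x -> f x = 0.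
Proof.
move=> [_ _ sf] wx; apply: contra_notP wx => /eqP fx.
by apply: sf; exact: subset_closure.
Qed.

Lemma C0_approx p (e : R) : 0 < e -> exists2 g, Cc w g & forall x, `|p x - g x| <= e.
Proof. by have := valP p; rewrite inE; exact. Qed.

Lemma C0_ub p x : `|p x| <= `|p|.
Proof.
apply: ub_le_sup; last by exists x.
have [g gw pg] := C0_approx p ltr01; have [B B0 gB] := Cc_bounded gw.
exists (1 + B) => _ [z _ <-]; rewrite -(subrK (g z) (p z)).
by rewrite (le_trans (ler_normD _ _))// lerD.
Qed.

Lemma C0_norm_le p (c : R) : (forall x, `|p x| <= c) -> `|p| <= c.
Proof.
move=> pc; apply: ge_sup; first by exists `|p 0|, 0.
by move=> _ [x _ <-].
Qed.

Lemma C0_ext p p' : (forall x, p x = p' x) -> p = p'.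
Proof. by move=> pp; apply/val_inj/funext. Qed.

Lemma C0_continuous p : continuous p.
Proof.
move=> x; apply/(@cvgrPdist_le _ _ _ (nbhs x)) => e e0.
have [|g [cg _ _] pg] := C0_approx p (_ : 0 < e / 3); first by rewrite divr_gt0.
near=> y.
have gxy : `|g x - g y| <= e / 3.
  by near: y; apply: (@cvgr_dist_le _ _ _ (nbhs x)); [exact: cg|rewrite divr_gt0].
have := pg x; have := pg y; rewrite distrC => h1 h2.
rewrite (_ : p x - p y = (p x - g x) + (g x - g y) + (g y - p y)); last by ring.
rewrite (le_trans (ler_normD _ _))// (_ : e = e / 3 + e / 3 + e / 3); last by field.
by rewrite lerD// (le_trans (ler_normD _ _))// lerD.
Unshelve. all: by end_near. Qed.

Lemma C0_of_approx f :
  (forall e : R, 0 < e -> exists2 g, Cc w g & forall x, `|f x - g x| <= e) ->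
  exists p : C0 w, forall x, p x = f x.
Proof.
move=> fP; have pf : f \in C0_pred w by rewrite inE.
by exists (MkC0 pf).
Qed.

Hypothesis bw : bounded_set w.

(* Outside a fixed ball both translates vanish, and on the ball the estimate is uniform
   by compactness. *)
Lemma Cc_shift_near f y0 (e : R) : Cc w f -> 0 < e ->
  \forall y \near y0, forall x, `|f (x + y) - f (x + y0)| <= e.
Proof.
move=> fw e0; have [cf _ _] := fw; have [M wM] := bounded_set_norm bw.
pose K := [set x : 'rV[R]_n | `|x| <= M + `|y0| + 1].
have cK : compact K.
  apply: bounded_closed_compact; last exact: closed_ballN.
  exists (M + `|y0| + 1); split; first exact: num_real.
  by move=> c Mc x /= xM; rewrite (le_trans xM)// ltW.
pose P (y x : 'rV[R]_n) := `|f (x + y) - f (x + y0)| <= e.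
have : \forall y \near y0, K `<=` P y.
  apply: (iffLR (compact_near_coveringP K) cK _ (nbhs y0) P _) => x Kx.
  pose F (z : 'rV[R]_n * 'rV[R]_n) : R := f (z.1 + z.2) - f (z.1 + y0).
  have c1 (g : 'rV[R]_n * 'rV[R]_n -> 'rV[R]_n) : {for (x, y0), continuous g} ->
      {for (x, y0), continuous (f \o g)}.
    by move=> cg; apply: continuous_comp => //; exact: cf.
  have cF : {for (x, y0), continuous F}.
    apply: (@cvgB _ _ _ (nbhs (x, y0))).
      apply: (c1 (fun z => z.1 + z.2)); apply: (@cvgD _ _ _ (nbhs (x, y0))).
        exact: cvg_fst.
      exact: cvg_snd.
    apply: (c1 (fun z => z.1 + y0)); apply: (@cvgD _ _ _ (nbhs (x, y0))).
      exact: cvg_fst.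
    exact: cvg_cst.
  have := @cvgrPdist_le _ _ _ (nbhs (x, y0)) _ F (F (x, y0)).
  case=> /(_ cF e e0) H _; apply: filterS H => -[x' y] /=.
  by rewrite /P /F /= subrr sub0r normrN.
move=> H; near=> y; have KP : K `<=` P y by near: y.
move=> x; have yy0 : `|y0 - y| <= 1.
  by near: y; apply: (@cvgr_dist_le _ _ _ (nbhs y0)); [exact: cvg_id|exact: ltr01].
have [xK|xK] := leP `|x| (M + `|y0| + 1); first exact: KP.
have out z : `|z| <= `|y0| + 1 -> f (x + z) = 0.
  move=> zy; apply: (Cc_out fw) => /wM; rewrite leNgt => /negP; apply.
  have := ler_normD (x + z) (- z); rewrite addrK normrN; lra.
rewrite !out ?subrr ?normr0 ?(ltW e0)//; first by rewrite lerDl.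
have := ler_normB y0 (y0 - y); rewrite opprB addrCA subrr addr0; lra.
Unshelve. all: by end_near. Qed.

End C0_facts.

Section correlation.
Context {R : realType} {n : nat} (w S : openset R n).
Hypotheses (bw : bounded_set w) (bS : bounded_set S).
Implicit Types (f : 'rV[R]_n -> R^o) (a : 'rV[R]_n -> R) (y : 'rV[R]_n).
Local Notation leb := (lebesgue_rV R n).
Local Notation mS := (leb_on S).

(** The inner integral in the definition of the convolution: [f |-> correlation f a] is the map
    whose adjoint is convolution with [a]. *)
Definition correlation f a y : R := \int[mS]_x (a x * f (x + y)).

Lemma measurable_Cc_shift f y : Cc w f -> measurable_fun setT (fun x : 'rV[R]_n => f (x + y) : R).
Proof.
move=> [cf _ _]; apply: measurable_continuous => x.
apply: (@continuous_comp 'rV[R]_n 'rV[R]_n R (fun x => x + y) f); last exact: cf.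
by apply: (@cvgD _ _ _ (nbhs x)); [exact: cvg_id|exact: cvg_cst].
Qed.

Lemma integrable_correlation f a y : Cc w f -> mS.-integrable setT (EFin \o a) ->
  mS.-integrable setT (EFin \o (fun x : 'rV[R]_n => a x * f (x + y))).
Proof.
move=> fw ia; have [B B0 fB] := Cc_bounded fw.
apply: (@integrable_bounded_mul _ _ _ _ a (fun x => f (x + y)) B) => //.
exact: measurable_Cc_shift.
Qed.

(** The neighbourhood is chosen before [a]: correlations with filters bounded in L^1 are
    equicontinuous. *)
Lemma correlation_near f y0 (e : R) : Cc w f -> 0 < e ->
  \forall y \near y0, forall a, mS.-integrable setT (EFin \o a) ->
    `|correlation f a y - correlation f a y0| <= e * \int[mS]_x `|a x|.
Proof.
move=> fw e0; near=> y.
have H : forall x, `|f (x + y) - f (x + y0)| <= e.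
  by near: y; exact: (Cc_shift_near bw).
move=> a ia; rewrite /correlation -RintegralB//; try exact: integrable_correlation.
rewrite (_ : \int[mS]_x _ = \int[mS]_x (a x * (f (x + y) - f (x + y0)))).
  apply: Rintegral_bounded_mul_le => //.
  by apply: measurable_funB; exact: measurable_Cc_shift.
by apply: eq_Rintegral => x _; rewrite mulrBr.
Unshelve. all: by end_near. Qed.

Lemma correlation_continuous f a : Cc w f -> mS.-integrable setT (EFin \o a) ->
  continuous (correlation f a).
Proof.
move=> fw ia y0; apply/(@cvgrPdist_le _ _ _ (nbhs y0)) => e e0.
pose N := \int[mS]_x `|a x| + 1.
have N0 : 0 < N by rewrite ltr_wpDl// Rintegral_ge0.
have := @correlation_near f y0 (e / N) fw (divr_gt0 e0 N0).
apply: filterS => y /(_ _ ia) H; rewrite distrC (le_trans H)// mulrAC ler_pdivrMr//.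
by rewrite ler_pM2l// /N lerDl.
Qed.

(* Cutting a off outside compact subsets of S makes the support compact. *)
Lemma correlation_C0 f a : Cc w f -> mS.-integrable setT (EFin \o a) ->
  exists p : C0 (openset_sub w S), forall y, p y = correlation f a y.
Proof.
move=> fw ia; have [B B0 fB] := Cc_bounded fw; have [cf kf sf] := fw.
have oS := oset_open S.
have ma : measurable_fun setT a by apply/measurable_EFinP; exact: measurable_int ia.
have bC k := bump_Cc k oS (@subset_refl _ S) bS.
have mb k : measurable_fun setT (bump S k).
  by have [cb _ _] := bC k; exact: measurable_continuous.
have b1 k x : `|bump S k x| <= 1 by rewrite ger0_norm ?bump_ge0// bump_le1.
have iab k : mS.-integrable setT (EFin \o (fun x => a x * bump S k x)).
  exact: (integrable_bounded_mul ia (mb k) (b1 k)).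
have ne k y : correlation f (fun x => a x * bump S k x) y != 0 ->
    exists2 x, f (x + y) != 0 & bump S k x != 0.
  move=> h; apply: contrapT => H; move/eqP : h; apply.
  rewrite /correlation (_ : (fun x => _) = cst 0).
    by rewrite Rintegral_cst// mul0r.
  apply/funext => x /=; have [->|fx] := eqVneq (f (x + y)) 0; first by rewrite mulr0.
  have [->|bx] := eqVneq (bump S k x) 0; first by rewrite mulr0 mul0r.
  by exfalso; apply: H; exists x.
(* The cut-off filters converge to [a] in L^1 of [S], and the error in the correlation is at most
   [B] times this L^1 distance, uniformly in [y]. *)
have tail : \int[mS]_x `|a x - a x * bump S k x| @[k --> \oo] --> 0.
  have inS : \forall x \ae mS, oset S x.
    exists (~` S); split => //; last exact: leb_on_setC.
    by apply: measurableC; exact: open_measurable_rV.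
  have [|||||_ _ c] := @dominated_convergence _ _ _ mS setT measurableT
    (fun k => EFin \o (fun x => `|a x - a x * bump S k x|)) (cst 0%E)
    (EFin \o (fun x => `|a x|)).
  - move=> k; apply/measurable_EFinP; apply: measurableT_comp => //.
    by apply: measurable_funB => //; exact: measurable_funM.
  - exact: measurable_cst.
  - apply: filterS inS => x Sx _; apply/cvg_EFin; first exact: nearW.
    rewrite [X in _ --> X](_ : _ = `|a x - a x * 1|); last by rewrite mulr1 subrr normr0.
    apply: cvg_norm; apply: cvgB; first exact: cvg_cst.
    by apply: cvgMr; have := @bump_cvg _ _ _ oS x; rewrite indicE mem_set.
  - exact: (integrable_norm ia).
  - apply: nearW => x k _; rewrite /= lee_fin normr_id -{1}(mulr1 (a x)) -mulrBr normrM.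
    rewrite ler_piMr// ger0_norm ?subr_ge0 ?bump_le1//.
    by rewrite gerBl bump_ge0.
  rewrite integral0 in c; exact: (fine_cvg c).
apply: C0_of_approx => e e0.
have [k ke] : exists k, B * \int[mS]_x `|a x - a x * bump S k x| <= e.
  move/cvgrPdist_le : tail => /(_ (e / (B + 1))).
  rewrite divr_gt0 ?ltr_wpDl// => /(_ isT)[k _ /(_ k (leqnn k))] /=.
  rewrite sub0r normrN ger0_norm; last by apply: Rintegral_ge0.
  rewrite ler_pdivlMr ?ltr_wpDl// => h; exists k.
  by rewrite mulrC (le_trans _ h)// ler_wpM2l ?Rintegral_ge0// lerDl.
exists (correlation f (fun x => a x * bump S k x)); last first.
  move=> y; rewrite /correlation -RintegralB//; try exact: integrable_correlation.
  rewrite (_ : \int[mS]_x _ =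
      \int[mS]_x ((a x - a x * bump S k x) * f (x + y))); last first.
    by apply: eq_Rintegral => x _; rewrite mulrBl.
  apply: le_trans ke; apply: Rintegral_bounded_mul_le => //.
    exact: (integrableB measurableT ia (iab k)).
  exact: measurable_Cc_shift.
have [_ kb sb] := bC k.
(* If the correlation with the cut-off filter is nonzero at [y], then some [x] in the support of the
   bump has [x + y] in that of [f]; so [y] lies in the difference of two compact supports, itself
   compact and contained in [w - S]. *)
pose K := [set z.1 - z.2 | z in tsupport f `*` tsupport (bump S k)].
have cK : compact K.
  apply: continuous_compact; last exact: compact_setX.
  apply: continuous_subspaceT => z; apply: (@cvgB _ _ _ (nbhs z)); first exact: cvg_fst.
  exact: cvg_snd.
have sK : tsupport (correlation f (fun x => a x * bump S k x)) `<=` K.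
  have clK : closed K by apply: compact_closed => //; exact: norm_hausdorff.
  rewrite /tsupport (closure_id K).1//; apply: closure_subset => y /= /ne[x fx bx].
  exists (x + y, x); last by rewrite /= addrAC subrr add0r.
  by split; exact: subset_closure.
split.
- exact: correlation_continuous.
- exact: (@subclosed_compact _ _ _ (@closed_closure _ _) cK sK).
- by move=> y /sK[[z x] /= [fz bx] <-]; exists z; [exact: sf|exists x => //; exact: sb].
Qed.
End correlation.

Lemma LnormE d (T : measurableType d) (R : realType)
    (m : {measure set T -> \bar R}) (r : R) (f : T -> R) :
  Lnorm m r%:E (EFin \o f) = ((\int[m]_x (`|f x| `^ r)%:E) `^ r^-1)%E.
Proof. by rewrite unlock. Qed.

Lemma bounded_Lfun d (T : measurableType d) (R : realType)
    (m : {measure set T -> \bar R}) (r : R) (f : T -> R) (B : R) :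
  m setT \is a fin_num -> 0 < r -> measurable_fun setT f ->
  (forall x, `|f x| <= B) -> f \in Lfun m r%:E.
Proof.
move=> mfin r0 mf fB; rewrite inE; apply/andP; split; first by rewrite inE.
rewrite inE /= /finite_norm LnormE; apply: poweR_lty.
apply: (@le_lt_trans _ _ (\int[m]_x (cst (B `^ r)%:E) x)%E).
  apply: ge0_le_integral => //.
  - by apply/measurable_EFinP; apply: (measurableT_comp (measurable_powR r));
    exact: measurableT_comp.
  - by move=> x _; rewrite /= lee_fin ge0_ler_powR ?nnegrE ?(ltW r0)// (le_trans _ (fB x)).
by rewrite integral_cst// lte_mul_pinfty ?lee_fin ?powR_ge0// ltey_eq mfin.
Qed.

Section correlation_L2.
Context {R : realType} {n : nat} (w S : openset R n).
Hypotheses (bw : bounded_set w) (bS : bounded_set S).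
Implicit Types (f : 'rV[R]_n -> R^o) (a : 'rV[R]_n -> R) (y : 'rV[R]_n).
Local Notation leb := (lebesgue_rV R n).
Local Notation mS := (leb_on S).
Local Notation mw := (leb_on w).

Lemma measurable_Cc f : Cc w f -> measurable_fun setT (f : 'rV[R]_n -> R).
Proof. by move=> [cf _ _]; exact: measurable_continuous. Qed.

Lemma Cc_Lp f (q : R) (q1 : 1 < q) : Cc w f ->
  exists u : Lq w q1, \forall x \ae mw, u x = f x.
Proof.
move=> fw; have [B _ fB] := Cc_bounded fw; apply: Lp_of_Lfun.
apply: (bounded_Lfun (leb_on_fin bw) _ (measurable_Cc fw) fB).
exact: lt_trans q1.
Qed.

(** Enlarging [S] to the whole space allows the translation to be removed; since [f] vanishes
    outside [w], what remains is the norm on [w]. *)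
Lemma Lnorm_correlation f (u : L2 w) y : Cc w f -> (\forall x \ae mw, u x = f x) ->
  (Lnorm mS 2%:E (EFin \o (fun x : 'rV[R]_n => f (x + y)%R : R)) <= `|u|%:E)%E.
Proof.
move=> fw uf; rewrite (Lp_norm_ae (measurable_Cc fw) uf) !LnormE.
have mF : measurable_fun setT (fun x : 'rV[R]_n => (`|f x| `^ 2)%:E).
  apply/measurable_EFinP; apply: (measurableT_comp (measurable_powR 2)).
  by apply: measurableT_comp => //; exact: measurable_Cc.
have mFy : measurable_fun setT (fun x : 'rV[R]_n => (`|f (x + y)| `^ 2)%:E).
  apply/measurable_EFinP; apply: (measurableT_comp (measurable_powR 2)).
  by apply: measurableT_comp => //; exact: (measurable_Cc_shift y fw).
have i0 (m : {measure set 'rV[R]_n -> \bar R}) (h : 'rV[R]_n -> R) :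
    (\int[m]_x (`|h x| `^ 2)%:E)%E \in `[0%E, +oo%E].
  by rewrite in_itv /= leey andbT integral_ge0// => x _; rewrite lee_fin powR_ge0.
apply: gt0_ler_poweR; [by rewrite invr_ge0|exact: i0|exact: i0|].
rewrite [leLHS]integral_mrestr//.
apply: (@le_trans _ _ (\int[leb]_x (`|f (x + y)| `^ 2)%:E)%E).
  by apply: ge0_subset_integral => //; exact: open_measurable_rV (oset_open S).
rewrite (@ge0_integral_shift _ _ y (fun x => (`|f x| `^ 2)%:E))//.
rewrite [leRHS]integral_mrestr// [leRHS]integral_mkcond.
rewrite le_eqVlt; apply/orP; left; apply/eqP; apply: eq_integral => x _.
rewrite patchE; case: ifPn => //; rewrite notin_setE => wx.
by rewrite (Cc_out fw wx) normr0 powR0.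
Qed.

Lemma correlation_le f (u : L2 w) (g : L2 S) y : Cc w f -> (\forall x \ae mw, u x = f x) ->
  `|correlation S f g y| <= `|g| * `|u|.
Proof.
move=> fw uf; have ig := Lp_integrable (leb_on_fin bS) g.
rewrite /correlation; apply: (le_trans (le_normr_Rintegral measurableT
  (integrable_correlation y fw ig))).
rewrite -lee_fin /Rintegral fineK; last first.
  by apply: integrable_fin_num => //; apply: (integrable_norm (integrable_correlation y fw ig)).
pose gf : 'rV[R]_n -> R := Lp_fun g \* (fun x : 'rV[R]_n => f (x + y)).
rewrite [leLHS](_ : _ = Lnorm mS 1 (EFin \o gf)); last by rewrite Lnorm1.
apply: (le_trans (@hoelder _ _ _ mS g (fun x : 'rV[R]_n => f (x + y)) 2 2 _ _ _ _ _)) => //.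
- exact: (measurable_Cc_shift y fw).
- by rewrite [RHS]splitr !div1r.
rewrite EFinM lee_pmul ?Lnorm_ge0//; last exact: Lnorm_correlation.
by rewrite (Lp_norm_ae (measurable_Lp g) (nearW _ (fun=> erefl))).
Qed.
End correlation_L2.

(** * Existence of the convolution *)

Section convolution_existence.
Context {R : realType} {n : nat} (w S : openset R n).
Hypotheses (bw : bounded_set w) (bS : bounded_set S).
Implicit Types (f : 'rV[R]_n -> R^o) (y : 'rV[R]_n) (g : L2 S)
  (mu : Radon (openset_sub w S)).
Local Notation leb := (lebesgue_rV R n).
Local Notation mS := (leb_on S).
Local Notation mw := (leb_on w).

(** For [f] in [Cc w] the default 0 is not reached, by [correlation_C0]. *)
Definition correl_C0 f g : C0 (openset_sub w S) :=
  xget 0 [set p : C0 (openset_sub w S) | forall y, p y = correlation S f g y].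

Lemma L2_integrable g : mS.-integrable setT (EFin \o (g : 'rV[R]_n -> R)).
Proof. exact: (Lp_integrable (leb_on_fin bS)). Qed.

Lemma correl_C0E f g : Cc w f -> forall y, correl_C0 f g y = correlation S f g y.
Proof.
move=> fw; have [p pP] := correlation_C0 bw bS fw (L2_integrable g).
exact: (@xgetPex _ 0 [set p : C0 (openset_sub w S) | forall y, p y = correlation S f g y]
  (ex_intro _ p pP)).
Qed.

Lemma correl_C0_comb f f' (a : R) g : Cc w f -> Cc w f' ->
  correl_C0 (fun x => f x + a * f' x) g = correl_C0 f g + a *: correl_C0 f' g.
Proof.
move=> fw fw'; apply: C0_ext => y; rewrite correl_C0E; last exact: Cc_comb.
rewrite -[RHS]/(correl_C0 f g y + a * correl_C0 f' g y) !correl_C0E//.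
have i1 := integrable_correlation y fw (L2_integrable g).
have i2 := integrable_correlation y fw' (L2_integrable g).
rewrite /correlation -RintegralZl// -RintegralD//; last exact: integrable_scale.
by apply: eq_Rintegral => x _; rewrite mulrDr mulrCA.
Qed.

Lemma correl_C0_norm f (u : L2 w) g : Cc w f -> (\forall x \ae mw, u x = f x) ->
  `|correl_C0 f g| <= `|g| * `|u|.
Proof.
move=> fw uf; apply: C0_norm_le => y; rewrite correl_C0E//.
exact: correlation_le.
Qed.

Lemma Cc_mul_integrable f f' : Cc w f -> Cc w f' ->
  mw.-integrable setT (EFin \o (fun x => f x * f' x : R)).
Proof.
move=> fw fw'; have [u uf] := Cc_Lp bw lt12 fw; have [B B0 fB] := Cc_bounded fw'.
have := Lfun_integrable1 (leb_on_fin bw) (lexx 1) (_ : (f : 'rV[R]_n -> R) \in _).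
have [B' _ fB'] := Cc_bounded fw.
move=> /(_ (bounded_Lfun (leb_on_fin bw) ltr01 (measurable_Cc fw) fB')) ifw.
exact: (integrable_bounded_mul ifw (measurable_Cc fw') fB).
Qed.

Lemma L2_norm_sqr f (u : L2 w) : Cc w f -> (\forall x \ae mw, u x = f x) ->
  `|u| ^+ 2 = \int[mw]_x (f x * f x).
Proof.
move=> fw uf.
rewrite -powR_mulrn//.
have := Lp_norm_powR u => /(congr1 fine) /= <-.
congr fine; apply: ae_eq_integral => //.
- by apply/measurable_EFinP; exact: measurable_norm_powR.
- by apply/measurable_EFinP; apply: measurable_funM; exact: (measurable_Cc fw).
by apply: filterS uf => x -> _; rewrite powR_mulrn// -expr2 real_normK// num_real.
Qed.

(* Minimise |f|^2 / 2 - mu (correl_C0 f g) over C_c(w); a weak limit h of a minimising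
   sequence satisfies the Euler equation. *)
Lemma convolution_riesz mu g : exists h : L2 w,
  `|h| <= 2 * (dual_norm mu * `|g|) + 2 /\
  forall f, Cc w f -> \int[mw]_x (h x * f x) = mu (correl_C0 f g).
Proof.
set K := dual_norm mu * `|g|.
have K0 : 0 <= K by rewrite mulr_ge0// dual_norm_ge0.
pose ell f : R := mu (correl_C0 f g).
pose Q f f' : R := \int[mw]_x (f x * f' x).
have ellb f (u : L2 w) : Cc w f -> (\forall x \ae mw, u x = f x) -> `|ell f| <= K * `|u|.
  move=> fw uf; rewrite (le_trans (dual_normP _ _))// /K -mulrA ler_wpM2l ?dual_norm_ge0//.
  exact: correl_C0_norm.
pose E f := 2^-1 * Q f f - ell f.
have E_ge f (u : L2 w) : Cc w f -> (\forall x \ae mw, u x = f x) ->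
    2^-1 * `|u| ^+ 2 - K * `|u| <= E f.
  move=> fw uf; rewrite /E /Q -(L2_norm_sqr fw uf) lerD2l lerN2.
  by rewrite (le_trans (ler_norm _))// ellb.
pose EE := [set E f | f in Cc w].
have hE : has_inf EE.
  split; first by exists (E 0), 0 => //; exact: Cc_sub0.
  exists (- (2^-1 * K ^+ 2)) => _ [f fw <-]; have [u uf] := Cc_Lp bw lt12 fw.
  rewrite (le_trans _ (E_ge f u fw uf))//.
  have := sqr_ge0 (`|u| - K); rewrite !expr2; nra.
have /choice[f fP] k : exists f, Cc w f /\ E f < inf EE + k.+1%:R^-1.
  have [|_ [f fw <-] Ef] := @inf_adherent _ EE k.+1%:R^-1 _ hE; first by rewrite invr_gt0.
  by exists f.
have fw k := (fP k).1.
have /choice[u uf] k := Cc_Lp bw lt12 (fw k).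
have E00 : E 0 = 0.
  rewrite /E /Q /ell (_ : (fun x => _) = cst 0); last first.
    by apply/funext => x /=; rewrite mulr0.
  rewrite Rintegral_cst// mul0r mulr0 (_ : correl_C0 0 g = 0) ?dualv0 ?subr0//.
  apply: C0_ext => y; rewrite correl_C0E; last exact: Cc_sub0.
  rewrite /correlation (_ : (fun x => _) = cst 0).
    by rewrite Rintegral_cst// mul0r.
  by apply/funext => x; rewrite mulr0.
(* Since [E 0 = 0], the infimum is at most 0 and [E (f k) <= 1]. But the lower bound
   [t ^ 2 / 2 - K * t] of [E_ge], with [t] the norm of [u k], exceeds 1 once [t] exceeds
   [2 * K + 2]. *)
have ub k : `|u k| <= 2 * K + 2.
  have h1 := E_ge _ _ (fw k) (uf k).
  have h2 : E (f k) <= 1.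
    rewrite (le_trans (ltW (fP k).2))// -[leRHS]add0r -E00 lerD//.
      by apply: ge_inf; [exact: hE.2|exists 0 => //; exact: Cc_sub0].
    by rewrite invf_le1// ler1n.
  rewrite leNgt; apply/negP => h3; rewrite expr2 in h1; nra.
have [G [GU GN]] := ultraFilterLemma (eventually_filter).
have [h hP] := @weak_ultralimit _ _ G GU (L2 w) u _ (@Lp_uniformly_convex _ _ _ _ _ _ lt12) ub.
exists h; split.
  apply: (hP [set v | `|v| <= 2 * K + 2]); [exact: closed_ballN|exact: convex_ball|].
  exact: filterE.
move=> f' fw'; have [B B0 fB] := Cc_bounded fw'.
have [phi phiP] := pairing_dual (leb_on_fin bw) (lee1_exponent lt12) B0 (measurable_Cc fw') fB.
have lim : Q (f k) f' @[k --> G] --> (\int[mw]_x (Lp_fun h x * f' x) : R).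
  rewrite -phiP; rewrite (_ : (fun k => _) = fun k => phi (u k)); last first.
    apply/funext => k; rewrite phiP; congr fine; apply: ae_eq_integral => //.
    - apply/measurable_EFinP; apply: measurable_funM; last exact: (measurable_Cc fw').
      exact: (measurable_Cc (fw k)).
    - apply/measurable_EFinP; apply: measurable_funM; last exact: (measurable_Cc fw').
      exact: measurable_Lp.
    - by apply: filterS (uf k) => x ->.
  exact: (@ultra_functional R nat G GU (L2 w) u _ h phi ub hP).
(* Perturbing [f k] by [t * f'] cannot lower [E] by more than [1 / (k + 1)]. The term quadratic in
   [f k] cancels in this comparison, so only quantities linear in [f k] have to converge. *)
have key (t : R) : 0 <= t * (\int[mw]_x (Lp_fun h x * f' x) - ell f') + 2^-1 * t ^+ 2 * Q f' f'.
  have Ek k : - k.+1%:R^-1 <= t * (Q (f k) f' - ell f') + 2^-1 * t ^+ 2 * Q f' f'.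
    have fkw := Cc_comb t (fw k) fw'.
    have h1 : inf EE <= E (fun x => f k x + t * f' x).
      by apply: ge_inf; [exact: hE.2|exists (fun x => f k x + t * f' x)].
    have h2 := (fP k).2.
    have i1 := Cc_mul_integrable (fw k) (fw k).
    have i2 := Cc_mul_integrable (fw k) fw'.
    have i3 := Cc_mul_integrable fw' fw'.
    have QE : Q (fun x => f k x + t * f' x) (fun x => f k x + t * f' x) =
        Q (f k) (f k) + ((2 * t) * Q (f k) f' + t ^+ 2 * Q f' f').
      rewrite /Q -!RintegralZl// -!RintegralD//; try exact: integrable_scale.
        by apply: eq_Rintegral => x _; ring.
      exact: (integrableD measurableT (integrable_scale _ i2) (integrable_scale _ i3)).
    have lE : ell (fun x => f k x + t * f' x) = ell (f k) + t * ell f'.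
      by rewrite /ell correl_C0_comb// dualD dualZ.
    move: h1 h2; rewrite /E QE lE; move: (k.+1%:R^-1) (inf EE) => z i.
    move: (Q (f k) (f k)) (Q (f k) f') (Q f' f') (ell (f k)) (ell f') => q1 q2 q3 l1 l2.
    nra.
  rewrite -oppr_le0; apply/ler_addgt0Pr => e e0; rewrite add0r.
  apply: (@ultra_limit_le _ _ G GU
    (fun k => - (t * (Q (f k) f' - ell f') + 2^-1 * t ^+ 2 * Q f' f'))).
    apply: cvgN; apply: cvgD; last exact: cvg_cst.
    by apply: cvgMr; apply: cvgB; [exact: lim|exact: cvg_cst].
  apply: GN; have := @near_infty_natSinv_lt R (PosNum e0).
  by apply: filterS => k /= ke; rewrite lerNl (le_trans _ (Ek k))// lerN2 ltW.
apply/eqP; rewrite -subr_eq0 -/(ell f').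
set c := _ - _ in key *; set Q0 := Q f' f' in key.
have Q00 : 0 <= Q0.
  by apply: Rintegral_ge0 => x _; rewrite -expr2 sqr_ge0.
have Q1 : 0 < Q0 + 1 by rewrite ltr_wpDl.
(* With [s = c / (Q0 + 1)] the inequality reads [0 <= - s ^ 2 * (1 + Q0 / 2)], forcing [s = 0];
   adding 1 keeps the denominator positive when [Q0] is 0. *)
have := key (- (c / (Q0 + 1))).
have cE : c = c / (Q0 + 1) * (Q0 + 1) by rewrite divfK// gt_eqF.
move: (c / (Q0 + 1)) cE => s ->; rewrite expr2 => hs.
have s0 : s * s = 0 by have := sqr_ge0 s; rewrite expr2 => ?; nra.
by move/eqP : s0; rewrite -expr2 sqrf_eq0 => /eqP ->; rewrite mul0r.
Qed.

End convolution_existence.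

(** * Bounds and limits of convolutions *)

Section convolution.
Context {R : realType} {n : nat} (w S : openset R n).
Hypotheses (bw : bounded_set w) (bS : bounded_set S).
Implicit Types (f : 'rV[R]_n -> R^o) (y : 'rV[R]_n) (g : L2 S)
  (mu : Radon (openset_sub w S)).
Local Notation leb := (lebesgue_rV R n).
Local Notation mS := (leb_on S).
Local Notation mw := (leb_on w).

Lemma Lfun_mono (q p : R) (h : 'rV[R]_n -> R) : 1 <= q -> q <= p ->
  h \in Lfun mw p%:E -> h \in Lfun mw q%:E.
Proof.
move=> q1 qp; apply: Lfun_subset => //; rewrite ?lee_fin ?(le_trans q1 qp)//.
exact: leb_on_fin.
Qed.

Lemma Rintegral_leb_on (v : openset R n) (h : 'rV[R]_n -> R) :
  measurable_fun setT h -> \int[leb]_(x in v) h x = \int[leb_on v]_x h x.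
Proof. exact: Rintegral_mrestr. Qed.

Lemma conv_spec mu g : is_conv mu g (conv mu g).
Proof.
have [h [_ hP]] := convolution_riesz bw bS mu g.
apply: (@xgetPex _ (cst 0) [set h | is_conv mu g h]).
exists (Lp_fun h); split=> [q /andP[q1 q2]|f fw].
  by apply: (Lfun_mono (ltW q1) q2); exact: Lp_Lfun.
exists (correl_C0 w f g).
  move=> y; rewrite (correl_C0E bw bS)// /correlation Rintegral_leb_on.
    by apply: eq_Rintegral => x _; rewrite mulrC.
  apply: measurable_funM; first exact: (measurable_Cc_shift y fw).
  exact: measurable_Lp.
rewrite -hP// Rintegral_leb_on//; apply: measurable_funM; first exact: measurable_Lp.
exact: (measurable_Cc fw).
Qed.

Lemma conv_Lfun mu g (q : R) : 1 <= q <= 2 -> conv mu g \in Lfun mw q%:E.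
Proof.
move=> /andP[q1 q2]; apply: (Lfun_mono q1 q2).
by apply: (conv_spec mu g).1; rewrite lexx andbT ltr1n.
Qed.

Lemma conv_integrable mu g : mw.-integrable setT (EFin \o conv mu g).
Proof.
apply: (Lfun_integrable1 (leb_on_fin bw) (lexx 1)).
by apply: conv_Lfun; rewrite lexx ler1n.
Qed.

Lemma conv_integral mu g f : Cc w f ->
  \int[mw]_x (conv mu g x * f x) = mu (correl_C0 w f g).
Proof.
move=> fw; have [psi psiE psiP] := (conv_spec mu g).2 f fw.
rewrite -Rintegral_leb_on; last first.
  apply: measurable_funM; last exact: (measurable_Cc fw).
  by apply: measurable_Lfun; apply: (@conv_Lfun _ _ 1); rewrite lexx ler1n.
rewrite psiP; congr (mu _); apply: C0_ext => y; rewrite psiE (correl_C0E bw bS)//.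
rewrite /correlation Rintegral_leb_on.
  by apply: eq_Rintegral => x _; rewrite mulrC.
apply: measurable_funM; first exact: (measurable_Cc_shift y fw).
exact: measurable_Lp.
Qed.

Lemma Cc_ae_unique (h h' : 'rV[R]_n -> R) :
  mw.-integrable setT (EFin \o h) -> mw.-integrable setT (EFin \o h') ->
  (forall f, Cc w f -> \int[mw]_x (h x * f x) = \int[mw]_x (h' x * f x)) ->
  \forall x \ae mw, h x = h' x.
Proof.
move=> ih ih' hh'.
have i2 : mw.-integrable setT (EFin \o (fun x => h x - h' x)).
  exact: (integrableB measurableT ih ih').
have H : \forall x \ae mw, h x - h' x = 0.
  apply: (Cc_orthogonal_ae0 bw i2) => f fw.
  have [B _ fB] := Cc_bounded fw.
  under eq_Rintegral do rewrite mulrBl.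
  rewrite RintegralB//; first by rewrite hh'// subrr.
    exact: (integrable_bounded_mul ih (measurable_Cc fw) fB).
  exact: (integrable_bounded_mul ih' (measurable_Cc fw) fB).
by apply: filterS H => x /eqP; rewrite subr_eq0 => /eqP.
Qed.

(** The bound is inherited from the minimisation and is not homogeneous in [mu] and [g]; it serves
    as a uniform bound over bounded families of both. *)
Lemma conv_L2 mu g : exists u : L2 w,
  `|u| <= 2 * (dual_norm mu * `|g|) + 2 /\ \forall x \ae mw, u x = conv mu g x.
Proof.
have [h [hle hP]] := convolution_riesz bw bS mu g; exists h; split=> //.
apply: Cc_ae_unique; [exact: (Lp_integrable (leb_on_fin bw))|exact: conv_integrable|].
by move=> f fw; rewrite hP// conv_integral.
Qed.

Section Lq_norm.
Variables (q : R) (q1 : 1 < q) (q2 : q <= 2).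

Lemma Lq_classE mu g : \forall x \ae mw, Lq_class w q1 (conv mu g) x = conv mu g x.
Proof.
have hL : conv mu g \in Lfun mw q%:E by apply: conv_Lfun; rewrite (ltW q1).
have [u uh] := Lp_of_Lfun (lee1_exponent q1) hL.
have H : [set u : Lq w q1 | (u : 'rV[R]_n -> R) = conv mu g %[ae mw]] (Lq_class w q1 (conv mu g)).
  apply: xgetPex; exists u => /=; apply: filterS uh => x ux _; exact: ux.
by apply: filterS H => x /(_ I).
Qed.

Lemma Lq_class_bounded (M : R) : exists C : R, forall mu g,
  dual_norm mu <= M -> `|g| <= 1 -> `|Lq_class w q1 (conv mu g)| <= C.
Proof.
pose c := fine (mw setT).
exists (1 + (c + (2 * M + 2) ^+ 2)) => mu g muM g1.
have M0 : 0 <= M := le_trans (dual_norm_ge0 mu) muM.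
have [u [uM uc]] := conv_L2 mu g.
have uM' : `|u| <= 2 * M + 2.
  rewrite (le_trans uM)// lerD2r ler_wpM2l// (le_trans (ler_wpM2l (dual_norm_ge0 mu) g1))//.
  by rewrite mulr1.
set v := Lq_class _ _ _.
have vu : \forall x \ae mw, v x = u x.
  by apply: filterS2 (Lq_classE mu g) uc => x -> ->.
have c0 : 0 <= c by exact: fine_ge0.
(* Pointwise, [t ^ q <= 1 + t ^ 2] because [q <= 2]; integrating the constant 1 gives the mass
   [c]. *)
have H : `|v| `^ q <= c + `|u| ^+ 2.
  rewrite -lee_fin EFinD -Lp_norm_powR -powR_mulrn// -(@Lp_norm_powR _ _ _ mw 2 _ u).
  rewrite /c fineK ?leb_on_fin//.
  rewrite [X in (_ <= X + _)%E](_ : _ = \int[mw]_x (cst 1%E) x)%E; last first.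
    by rewrite integral_cst// mul1e.
  have mu2 : measurable_fun setT (fun x => (`|u x| `^ 2)%:E).
    by apply/measurable_EFinP; exact: measurable_norm_powR.
  rewrite -ge0_integralD//.
  apply: ae_ge0_le_integral => //.
  - by apply/measurable_EFinP; exact: measurable_norm_powR.
  - by move=> x _; rewrite adde_ge0 ?lee_fin ?powR_ge0.
  - exact: emeasurable_funD.
  apply: filterS vu => x -> _; rewrite -EFinD lee_fin.
  have [x1|x1] := leP 1 `|u x|.
    by rewrite (le_trans (ler_powR x1 q2))// lerDr.
  have : `|u x| `^ q <= 1 `^ q.
    by rewrite ge0_ler_powR ?nnegrE ?(ltW x1)// (le_trans ler01)// ltW.
  by rewrite powR1 => h; rewrite (le_trans h)// lerDl powR_ge0.
have u2 : `|u| ^+ 2 <= (2 * M + 2) ^+ 2.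
  by rewrite ler_pXn2r ?nnegrE// addr_ge0// mulr_ge0.
have [v1|v1] := leP 1 `|v|.
  rewrite (le_trans (le1r_powR v1 (ltW q1)))// (le_trans H)//.
  by rewrite (le_trans _ (_ : c + (2 * M + 2) ^+ 2 <= _)) ?lerD2l// lerDr.
by rewrite (le_trans (ltW v1))// lerDl addr_ge0// sqr_ge0.
Qed.
End Lq_norm.

Lemma measurable_C0 (v : set 'rV[R]_n) (p : C0 v) :
  measurable_fun setT (p : 'rV[R]_n -> R).
Proof. exact: measurable_continuous (@C0_continuous _ _ _ p). Qed.

Lemma Radon_ofE (h : 'rV[R]_n -> R) (p : C0 w) : mw.-integrable setT (EFin \o h) ->
  Radon_of w h p = \int[mw]_x (h x * p x).
Proof.
move=> ih.
have mh : measurable_fun setT h by apply/measurable_EFinP; exact: measurable_int ih.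
pose phi (p0 : C0 w) : R^o := \int[mw]_x (h x * p0 x).
have ip (p0 : C0 w) : mw.-integrable setT (EFin \o (fun x => h x * p0 x)).
  exact: (integrable_bounded_mul ih (measurable_C0 p0) (C0_ub p0)).
have lphi : linear phi.
  move=> a p1 p2.
  rewrite -[RHS]/(a * \int[mw]_x (h x * C0_fun p1 x) + \int[mw]_x (h x * C0_fun p2 x)).
  rewrite -RintegralZl// -RintegralD//; last exact: integrable_scale.
  apply: eq_Rintegral => x _.
  by rewrite -[C0_fun (a *: p1 + p2) x]/(a * p1 x + p2 x) mulrDr mulrCA.
have bphi p1 : `|phi p1| <= (\int[mw]_x `|h x|) * `|p1|.
  by rewrite mulrC; exact: (Rintegral_bounded_mul_le ih (measurable_C0 p1) (C0_ub p1)).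
have H : [set m : Radon w | forall f : C0 w, m f = \int[leb]_(x in w) (h x * f x)]
    (Radon_of w h).
  apply: xgetPex; exists (Dual (dual_predP lphi bphi)) => f.
  rewrite Rintegral_leb_on//; apply: measurable_funM => //; exact: measurable_C0.
rewrite H Rintegral_leb_on//; apply: measurable_funM => //; exact: measurable_C0.
Qed.

Lemma conv_norm1_bounded (M : R) : exists2 C : R, 0 <= C & forall mu g,
  dual_norm mu <= M -> `|g| <= 1 -> \int[mw]_x `|conv mu g x| <= C.
Proof.
have [K K0 KP] := Lp_norm1_le (leb_on_fin bw) (lee1_exponent lt12).
exists (K * `|2 * M + 2|) => [|mu g muM g1]; first by rewrite mulr_ge0.
have [u [uM uc]] := conv_L2 mu g.
have -> : \int[mw]_x `|conv mu g x| = \int[mw]_x `|u x|.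
  congr fine; apply: ae_eq_integral => //.
  - apply/measurable_EFinP; apply: measurableT_comp => //.
    by apply: measurable_Lfun; apply: (@conv_Lfun _ _ 1); rewrite lexx ler1n.
  - by apply/measurable_EFinP; apply: measurableT_comp => //; exact: measurable_Lp.
  - by apply: filterS uc => x ->.
rewrite (le_trans (KP u))// ler_wpM2l// (le_trans _ (ler_norm _))// (le_trans uM)//.
rewrite lerD2r ler_wpM2l// (le_trans (ler_wpM2l (dual_norm_ge0 mu) g1))//.
by rewrite mulr1.
Qed.

Section limits.
Context {I : Type} (G : set_system I) {GU : UltraFilter G}.
Variables (mu_ : I -> Radon (openset_sub w S)) (mu : Radon (openset_sub w S)).
Variables (g_ : I -> L2 S) (g : L2 S) (M : R).
Hypothesis mu_le : forall i, dual_norm (mu_ i) <= M.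
Hypothesis mu_lim_le : dual_norm mu <= M.
Hypothesis mu_cvg : forall p, (mu_ i p : R) @[i --> G] --> (mu p : R).
Hypothesis g_le : forall i, `|g_ i| <= 1.
Hypothesis g_lim_le : `|g| <= 1.
Hypothesis g_cvg : forall phi : dual (L2 S), (phi (g_ i) : R) @[i --> G] --> (phi g : R).

Lemma correlation_cvg f y : Cc w f ->
  correlation S f (g_ i) y @[i --> G] --> correlation S f g y.
Proof.
move=> fw; have [B B0 fB] := Cc_bounded fw.
have [phi phiP] := pairing_dual (leb_on_fin bS) (lee1_exponent lt12) B0
  (measurable_Cc_shift y fw) (fun x => fB (x + y)).
rewrite /correlation -phiP; under eq_fun do rewrite -phiP.
exact: g_cvg.
Qed.

Lemma C0_out (v : set 'rV[R]_n) (p : C0 v) y : ~ v y -> p y = 0.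
Proof.
move=> vy; apply/eqP; rewrite -normr_le0; apply/ler_addgt0Pr => e e0; rewrite add0r.
have [f fv pf] := C0_approx p e0.
by have := pf y; rewrite (Cc_out fv vy) subr0.
Qed.

(* Weak convergence of g_ becomes uniform convergence of the correlations, which are
   equicontinuous and supported in a fixed compact set. *)
Lemma correl_C0_cvg f (e : R) : Cc w f -> 0 < e ->
  G [set i | `|correl_C0 w f (g_ i) - correl_C0 w f g| <= e].
Proof.
move=> fw e0.
have [N1 wN] := bounded_set_norm bw; have [N2 SN] := bounded_set_norm bS.
pose K := [set y : 'rV[R]_n | `|y| <= N1 + N2].
have cK : compact K.
  apply: bounded_closed_compact; last exact: closed_ballN.
  exists (N1 + N2); split; first exact: num_real.
  by move=> c Mc x /= xM; rewrite (le_trans xM)// ltW.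
have [A A0 AP] := Lp_norm1_le (leb_on_fin bS) (lee1_exponent lt12).
pose P i y := `|correlation S f (g_ i) y - correlation S f g y| <= e.
have : \forall i \near G, K `<=` P i.
  apply: (iffLR (compact_near_coveringP K) cK _ G P _) => y0 _.
  have e3 : 0 < e / 3 by rewrite divr_gt0.
  (* The constant [A] bounds the L^1 norm by the L^2 norm, which is at most 1 here, so the variation
     of every correlation near [y0] is at most [e / 3], uniformly in [i]. *)
  have eA : 0 < e / 3 / (A + 1) by rewrite divr_gt0// ltr_wpDl.
  have H1 := correlation_near S bw y0 fw eA.
  have H2 : G [set i | `|correlation S f (g_ i) y0 - correlation S f g y0| <= e / 3].
    move/cvgrPdist_le : (@correlation_cvg f y0 fw) => /(_ _ e3).
    by apply: filterS => i; rewrite distrC.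
  have small (b : L2 S) : `|b| <= 1 -> e / 3 / (A + 1) * \int[mS]_x `|b x| <= e / 3.
    move=> b1; rewrite mulrAC ler_pdivrMr ?ltr_wpDl// ler_pM2l//.
    rewrite (le_trans (AP b))// (le_trans (ler_wpM2l A0 b1))// mulr1.
    by rewrite lerDl.
  exists ([set y | forall a, mS.-integrable setT (EFin \o a) ->
    `|correlation S f a y - correlation S f a y0| <= e / 3 / (A + 1) * \int[mS]_x `|a x|],
    [set i | `|correlation S f (g_ i) y0 - correlation S f g y0| <= e / 3]) => //.
  move=> [y i] /= [yP iP]; rewrite /P.
  have h1 := le_trans (yP _ (L2_integrable bS (g_ i))) (small _ (g_le i)).
  have h2 := le_trans (yP _ (L2_integrable bS g)) (small _ g_lim_le).
  rewrite distrC in h2.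
  rewrite (_ : _ - _ = (correlation S f (g_ i) y - correlation S f (g_ i) y0) +
    (correlation S f (g_ i) y0 - correlation S f g y0) +
    (correlation S f g y0 - correlation S f g y)); last by ring.
  rewrite (le_trans (ler_normD _ _))// (_ : e = e / 3 + e / 3 + e / 3); last by field.
  by rewrite lerD// (le_trans (ler_normD _ _))// lerD.
apply: filterS => i KP; apply: C0_norm_le => y.
rewrite -[C0_fun _ y]/(correl_C0 w f (g_ i) y - correl_C0 w f g y).
have [yK|yK] := leP `|y| (N1 + N2).
  by rewrite !(correl_C0E bw bS)//; exact: KP.
have out : ~ oset (openset_sub w S) y.
  move=> [z wz [x Sx zxy]]; move: yK; rewrite -zxy ltNge => /negP; apply.
  by rewrite (le_trans (ler_normB _ _))// lerD// ?wN ?SN.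
by rewrite !(C0_out _ out) subrr normr0 ltW.
Qed.

Lemma conv_integral_cvg f : Cc w f ->
  \int[mw]_x (conv (mu_ i) (g_ i) x * f x) @[i --> G] -->
  (\int[mw]_x (conv mu g x * f x) : R).
Proof.
move=> fw; rewrite conv_integral//; under eq_fun do rewrite conv_integral//.
apply/cvgrPdist_le => e e0.
have MP : 0 < 2 * (`|M| + 1) by rewrite mulr_gt0// ltr_wpDl.
have H1 := @correl_C0_cvg f (e / (2 * (`|M| + 1))) fw (divr_gt0 e0 MP).
have e2 : 0 < e / 2 by rewrite divr_gt0.
have H2 : G [set i | `|mu (correl_C0 w f g) - mu_ i (correl_C0 w f g)| <= e / 2].
  by move/cvgrPdist_le : (@mu_cvg (correl_C0 w f g)) => /(_ _ e2).
apply: filterS2 H1 H2 => i h1 h2.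
set p := correl_C0 w f g in h1 h2 *; set pi := correl_C0 w f (g_ i) in h1 *.
(* The first difference is handled by weak* convergence at the fixed function [p], the second by the
   uniform bound on the [mu_ i] and the norm convergence of [pi] to [p]. *)
rewrite (_ : mu p - mu_ i pi = (mu p - mu_ i p) - mu_ i (pi - p)); last first.
  by rewrite dualB; ring.
rewrite (le_trans (ler_normB _ _))// [leRHS]splitr lerD//.
rewrite (le_trans (dual_normP _ _))//.
apply: (@le_trans _ _ ((`|M| + 1) * (e / (2 * (`|M| + 1))))).
  apply: ler_pM => //; first exact: dual_norm_ge0.
  by rewrite (le_trans (mu_le i))// (le_trans (ler_norm _))// lerDl.
by rewrite invfM mulrCA (mulrC e) mulrCA mulfV ?mulr1 ?gt_eqF ?ltr_wpDl// mulrC.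
Qed.

(** Extends [conv_integral_cvg] from [Cc w] to its closure: the convolutions are bounded in L^1
    uniformly in [i], so replacing [p] by a nearby [f] costs the same small amount for every [i] and
    for the limit. *)
Lemma Radon_conv_cvg (p : C0 w) :
  (Radon_of w (conv (mu_ i) (g_ i)) p : R) @[i --> G] -->
  (Radon_of w (conv mu g) p : R).
Proof.
have [C Cge0 CP] := conv_norm1_bounded M.
apply/cvgrPdist_le => e e0.
have e3 : 0 < e / 3 by rewrite divr_gt0.
have eC : 0 < e / 3 / (C + 1) by rewrite divr_gt0// ltr_wpDl.
have [f fw pf] := C0_approx p eC.
have close (m' : Radon (openset_sub w S)) (g' : L2 S) : dual_norm m' <= M -> `|g'| <= 1 ->
    `|Radon_of w (conv m' g') p - \int[mw]_x (conv m' g' x * f x)| <= e / 3.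
  move=> mM g1; have ic := conv_integrable m' g'; have [B _ fB] := Cc_bounded fw.
  rewrite Radon_ofE// -RintegralB//; last 2 first.
  - exact: (integrable_bounded_mul ic (measurable_C0 p) (C0_ub p)).
  - exact: (integrable_bounded_mul ic (measurable_Cc fw) fB).
  rewrite (_ : \int[mw]_x _ = \int[mw]_x (conv m' g' x * (p x - f x))); last first.
    by apply: eq_Rintegral => x _; rewrite mulrBr.
  apply: (le_trans (Rintegral_bounded_mul_le ic _ pf)).
    by apply: measurable_funB; [exact: measurable_C0|exact: (measurable_Cc fw)].
  rewrite mulrAC ler_pdivrMr ?ltr_wpDl// ler_pM2l//.
  by rewrite (le_trans (CP _ _ mM g1))// lerDl.
move/cvgrPdist_le : (conv_integral_cvg fw) => /(_ _ e3).
apply: filterS => i hi.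
have h1 := close _ _ (mu_le i) (g_le i); have h2 := close _ _ mu_lim_le g_lim_le.
rewrite distrC in h1.
move: h1 h2 hi.
set a := Radon_of w (conv mu g) p; set b := \int[mw]_x (conv mu g x * f x).
set c := \int[mw]_x (conv (mu_ i) (g_ i) x * f x); set d := Radon_of w _ p.
move=> h1 h2 hi; rewrite (_ : a - d = (a - b) + (b - c) + (c - d)); last by ring.
rewrite (le_trans (ler_normD _ _))// (_ : e = e / 3 + e / 3 + e / 3); last by field.
by rewrite lerD// (le_trans (ler_normD _ _))// lerD.
Qed.
End limits.

End convolution.

(** * Limits in the network *)

Lemma bounded_set_sub (R : realType) n (A B : set 'rV[R]_n) :
  bounded_set A -> bounded_set B -> bounded_set (set_sub A B).
Proof.
move=> /bounded_set_norm[M AM] /bounded_set_norm[N BN].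
exists (M + N); split; first exact: num_real.
move=> c Mc _ [x Ax [y By <-]]; rewrite /= (le_trans (ler_normB _ _))//.
by rewrite (le_trans _ (ltW Mc))// lerD ?AM ?BN.
Qed.

Lemma dual_sumE (R : realType) (V : normedModType R) (J : Type) (s : seq J)
    (P : pred J) (m : J -> dual V) (v : V) :
  (\sum_(j <- s | P j) m j) v = \sum_(j <- s | P j) (m j v).
Proof. by apply: (big_morph (fun m' : dual V => m' v)). Qed.

Lemma cvg_finsum (R : realType) (I : Type) (G : set_system I) {FG : Filter G}
    (J : finType) (P : pred J) (f : J -> I -> R) (l : J -> R) :
  (forall j, f j i @[i --> G] --> l j) ->
  (\sum_(j | P j) f j i) @[i --> G] --> (\sum_(j | P j) l j).
Proof.
move=> fl; elim: (index_enum J) => [|j s IH].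
  rewrite big_nil (_ : (fun i => _) = cst 0); first exact: cvg_cst.
  by apply/funext => i; rewrite big_nil.
rewrite big_cons; case: ifP => Pj.
  rewrite (_ : (fun i => _) = (fun i => f j i + \sum_(j <- s | P j) f j i)).
    exact: cvgD.
  by apply/funext => i; rewrite big_cons Pj.
rewrite (_ : (fun i => _) = (fun i => \sum_(j <- s | P j) f j i))//.
by apply/funext => i; rewrite big_cons Pj.
Qed.

Section network_limits.
Context {R : realType} {d : nat} (Omega Sigma : openset R d) (net : network).
Hypotheses (bO : bounded_set Omega) (bS : bounded_set Sigma).
Local Notation Om := (layer_set Omega Sigma).
Local Notation L := (depth net).
Local Notation measures := (measures Omega Sigma net).
Local Notation Theta := (Theta Sigma net).

Lemma bounded_layer_set l : bounded_set (Om l).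
Proof. by elim: l => //= l IH; exact: bounded_set_sub. Qed.

Lemma measures_norm_ub (mu : measures) i k : dual_norm (mu i k) <= measures_norm mu.
Proof.
rewrite /measures_norm (bigD1 i)//= (bigD1 k)//= -addrA lerDl addr_ge0//.
  by apply: sumr_ge0 => *; exact: dual_norm_ge0.
by apply: sumr_ge0 => *; apply: sumr_ge0 => *; exact: dual_norm_ge0.
Qed.

Variables (q : R) (q1 : 1 < q) (q2 : q <= 2).

Lemma first_layer_bounded (M : R) : exists C : R, forall (mu : measures) (th : Theta),
  measures_norm mu <= M -> (forall e, `|th e| <= 1) ->
  `|first_layer q1 mu th| <= C.
Proof.
have [C CP] := @Lq_class_bounded R d Omega Sigma bO bS q q1 q2 M.
exists (\sum_(e : edge (input_index net)) C) => mu th muM th1.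
rewrite (le_trans (ler_norm_sum _ _ _))//; apply: ler_sum => e _.
have H := le_trans (measures_norm_ub mu (val e).1) muM.
by rewrite /edge_conv; apply: CP; [exact: H|exact: th1].
Qed.

Section limit.
Context {I : Type} (G : set_system I) {GU : UltraFilter G}.
Variables (mu_ : I -> measures) (th_ : I -> Theta) (M : R).
Hypothesis mu_le : forall i, measures_norm (mu_ i) <= M.
Hypothesis th_le : forall i e, `|th_ i e| <= 1.

Lemma measures_ultralimit : exists mu : measures,
  forall l k p, (@mu_ i l k p : R) @[i --> G] --> (mu l k p : R).
Proof.
have H (l : 'I_L) (k : 'I_(width net l.+1)) : exists m' : Radon (Om l.+1),
    forall p, (@mu_ i l k p : R) @[i --> G] --> (m' p : R).
  apply: (@banach_alaoglu _ _ _ _ _ (fun i => @mu_ i l k) M) => i.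
  exact: le_trans (measures_norm_ub _ _) (mu_le i).
by exists (fun l k => projT1 (cid (H l k))) => l k; exact: projT2 (cid (H l k)).
Qed.

Lemma Theta_ultralimit : exists th : Theta, (forall e, `|th e| <= 1) /\
  forall e (phi : dual (L2 Sigma)), (phi (th_ i e) : R) @[i --> G] --> (phi (th e) : R).
Proof.
have H e : exists z : L2 Sigma, `|z| <= 1 /\
    forall phi : dual (L2 Sigma), (phi (th_ i e) : R) @[i --> G] --> (phi z : R).
  have [z zP] := @weak_ultralimit _ _ G GU (L2 Sigma) (fun i => th_ i e) 1
    (@Lp_uniformly_convex _ _ _ _ _ _ lt12) (fun i => th_le i e).
  exists z; split.
    apply: (zP [set v | `|v| <= 1]); [exact: closed_ballN|exact: convex_ball|].
    by apply: filterE => i; exact: th_le.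
  move=> phi.
  exact: (@ultra_functional R I G GU (L2 Sigma) (fun i => th_ i e) 1 z phi (fun i => th_le i e) zP).
exists (fun e => projT1 (cid (H e))).
by split=> e; have [? ?] := projT2 (cid (H e)).
Qed.

(** Each coordinate of [Z] is a finite sum over the edges of bounded functionals of a single filter,
    so the constraint passes to the weak limit edge by edge. *)
Lemma Z_ultralimit Nc (Z : {linear Theta -> 'rV[R]_Nc}) (th : Theta) :
  (exists K : R, forall th, `|Z th| <= K * \sum_(e : edges net) `|th e|) ->
  (forall e (phi : dual (L2 Sigma)), (phi (th_ i e) : R) @[i --> G] --> (phi (th e) : R)) ->
  (forall i, Z (th_ i) = 0) -> Z th = 0.
Proof.
move=> [K ZK] thc Z0.
pose single (e : edges net) (x : L2 Sigma) : Theta := fun e' => if e' == e then x else 0.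
have thE (t : Theta) : t = \sum_(e : edges net) single e (t e).
  apply/funext => e'; rewrite fct_sumE (bigD1 e')//= /single eqxx big1 ?addr0// => e ee'.
  by rewrite eq_sym (negbTE ee').
pose ph (j : 'I_Nc) (e : edges net) (x : L2 Sigma) : R^o := Z (single e x) ord0 j.
have lph j e : linear (ph j e).
  move=> a x y; rewrite /ph.
  have -> : single e (a *: x + y) = a *: single e x + single e y.
    apply/funext => e'; rewrite /single.
    rewrite -[RHS]/(a *: (if e' == e then x else 0) + (if e' == e then y else 0)).
    by case: ifP => // _; rewrite scaler0 addr0.
  by rewrite linearP !mxE.
have bph j e x : `|ph j e x| <= `|K| * `|x|.
  rewrite (le_trans (norm_coord_le _ _))// (le_trans (ZK _))//.
  rewrite (bigD1 e)//= /single eqxx big1 ?addr0; last first.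
    by move=> e' /negbTE ->; rewrite normr0.
  by rewrite ler_wpM2r// ler_norm.
apply/rowP => j; rewrite mxE.
pose phi e : dual (L2 Sigma) := Dual (dual_predP (lph j e) (bph j e)).
have ZE (t : Theta) : Z t ord0 j = \sum_e phi e (t e).
  rewrite {1}(thE t) linear_sum summxE; apply: eq_bigr => e _.
  by [].
rewrite ZE.
have c : (\sum_e phi e (th_ i e) : R) @[i --> G] --> (\sum_e phi e (th e) : R).
  by apply: cvg_finsum => e; exact: thc.
apply: (@cvg_unique _ (@Rhausdorff R) _ _ _ _ c).
rewrite (_ : (fun i => _) = cst 0); first exact: cvg_cst.
by apply/funext => i; rewrite -ZE Z0 mxE.
Qed.

Variables (mu : measures) (th : Theta).
Hypothesis mu_cvg : forall l k p, (@mu_ i l k p : R) @[i --> G] --> (@mu l k p : R).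
Hypothesis th1 : forall e, `|th e| <= 1.
Hypothesis th_cvg : forall e (phi : dual (L2 Sigma)),
  (phi (th_ i e) : R) @[i --> G] --> (phi (th e) : R).

Lemma dual_norm_limit_le l k : dual_norm (@mu l k) <= M.
Proof.
have H := @liminf_ge_dual_norm _ _ G GU _ (fun i => @mu_ i l k) (@mu l k) (@mu_cvg l k).
rewrite -lee_fin; apply: (liminf_ge_le H) => r Mr; apply: filterE => i.
by rewrite /= (le_trans _ (ltW Mr))// lee_fin (le_trans (measures_norm_ub _ _)).
Qed.

Lemma layer_conv_cvg (j : 'I_L.-1) (k : 'I_(width net j.+1)) p :
  (layer_conv (mu_ i) (th_ i) k p : R) @[i --> G] --> (layer_conv mu th k p : R).
Proof.
rewrite /layer_conv dual_sumE.
rewrite (_ : (fun i => _) = (fun i => \sum_(e : edge (upper_index j) | (val e).2 == k)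
    Radon_of (Om j.+1) (edge_conv (mu_ i) (th_ i) e) p)); last first.
  by apply/funext => i; rewrite dual_sumE.
apply: cvg_finsum => e; rewrite /edge_conv.
have mle i : dual_norm (@mu_ i (upper_index j) (val e).1) <= M.
  exact: le_trans (measures_norm_ub _ _) (mu_le i).
exact: (@Radon_conv_cvg R d (Om j.+1) Sigma (bounded_layer_set j.+1) bS I G GU
  (fun i => @mu_ i (upper_index j) (val e).1) (@mu (upper_index j) (val e).1)
  (fun i => th_ i (Tagged (@edge net) e)) (th (Tagged (@edge net) e)) M
  mle (@dual_norm_limit_le (upper_index j) (val e).1)
  (@mu_cvg (upper_index j) (val e).1) (fun i => th_le i _) (th1 _) (@th_cvg _) p).
Qed.

Lemma first_layer_weak_limit (v : Lq Omega q1) :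
  (forall phi : dual (Lq Omega q1),
     (phi (first_layer q1 (mu_ i) (th_ i)) : R) @[i --> G] --> (phi v : R)) ->
  v = first_layer q1 mu th.
Proof.
move=> vc.
have int u := @Lp_integrable _ _ _ _ (leb_on_fin bO) _ (lee1_exponent q1) u.
apply: Lp_ext; apply: (Cc_ae_unique bO) => // f fw.
have [B B0 fB] := Cc_bounded fw.
have [phi phiP] := pairing_dual (leb_on_fin bO) (lee1_exponent q1) B0 (measurable_Cc fw) fB.
rewrite -!phiP.
have phi_sum (m : measures) (t : Theta) : phi (first_layer q1 m t) =
    \sum_(e : edge (input_index net)) \int[leb_on Omega]_x (edge_conv m t e x * f x).
  rewrite /first_layer -[LHS]/(dual_lin phi _) linear_sum; apply: eq_bigr => e _.
  rewrite -[LHS]/(phi _) phiP; congr fine; apply: ae_eq_integral => //.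
  - apply/measurable_EFinP; apply: measurable_funM; last exact: (measurable_Cc fw).
    exact: measurable_Lp.
  - apply/measurable_EFinP; apply: measurable_funM; last exact: (measurable_Cc fw).
    apply/measurable_EFinP.
    exact: (measurable_int _ (@conv_integrable R d Omega Sigma bO bS _ _)).
  apply: filterS (@Lq_classE R d Omega Sigma bO bS q q1 q2
    (m (input_index net) (val e).1) (t (Tagged (@edge net) e))).
  by move=> x xE _ /=; rewrite /edge_conv -xE.
apply: (@cvg_unique _ (@Rhausdorff R) _ _ _ _ (vc phi)).
rewrite phi_sum (_ : (fun i => _) = (fun i => \sum_(e : edge (input_index net))
    \int[leb_on Omega]_x (edge_conv (mu_ i) (th_ i) e x * f x))); last first.
  by apply/funext => i; rewrite phi_sum.
apply: cvg_finsum => e; rewrite /edge_conv.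
have mle i : dual_norm (@mu_ i (input_index net) (val e).1) <= M.
  exact: le_trans (measures_norm_ub _ _) (mu_le i).
exact: (@conv_integral_cvg R d Omega Sigma bO bS I G GU
  (fun i => @mu_ i (input_index net) (val e).1) (@mu (input_index net) (val e).1)
  (fun i => th_ i (Tagged (@edge net) e)) (th (Tagged (@edge net) e)) M
  mle (@mu_cvg (input_index net) (val e).1) (fun i => th_le i _) (th1 _) (@th_cvg _) f fw).
Qed.

End limit.
End network_limits.

(** * The direct method *)

Lemma linear_norm_bound (R : realType) (V W : normedModType R) (A : {linear V -> W}) :
  bounded_near A (nbhs (0 : V)) -> exists2 K : R, 0 < K & forall v, `|A v| <= K * `|v|.
Proof.
move=> /linear_boundedP/pinfty_ex_gt0[K K0 KP]; exists K => // v; exact: KP.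
Qed.

Lemma subspace_sum (R : realType) (V : lmodType R) (U : set V) n (b : 'I_n -> V)
    (c : 'I_n -> R) :
  is_subspace U -> (forall i, U (b i)) -> U (\sum_i c i *: b i).
Proof.
move=> [U0 UP] Ub; elim/big_ind : _ => // [x y Ux Uy|i _].
  by rewrite -[x]scale1r; exact: UP.
by rewrite -[_ *: _]addr0; exact: UP.
Qed.

(** Brings the two alternatives on [U] to one estimate: modulo [U] and the kernel of [A], an element
    of [U] is controlled by its image. In the second alternative, [k] is the kernel component of the
    decomposition. *)
Lemma subspace_kernel_representative (R : realType) (V Y : normedModType R)
    (A : {linear V -> Y}) (U : set V) : is_subspace U ->
  finite_dimensional U \/
    (exists W, complement_in U (U `&` [set u | A u = 0]) W /\
      exists2 D : R, 0 < D & forall u, W u -> `|u| <= D * `|A u|) ->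
  exists2 D : R, 0 <= D & forall u, U u ->
    exists k, [/\ U k, A k = 0 & `|u - k| <= D * `|A u|].
Proof.
move=> subU [[n [b [Ub bU]]]|[W [[subW WU _ dec] [D D0 DP]]]].
  have [D DP] := kernel_representative A b.
  exists `|D| => // u /bU[c ->]; have [k [k0 kc]] := DP c.
  exists (\sum_i k i *: b i); split => //; first exact: subspace_sum.
  by rewrite (le_trans kc)// ler_wpM2r// ler_norm.
exists D; first exact: ltW.
move=> u /dec[k [Uk /= Ak] [v Wv ->]]; exists k; split=> //.
by rewrite (addrC k v) addrK linearD Ak addr0 DP.
Qed.

(** If the values were not eventually above [r], then by the ultrafilter dichotomy they would be
    eventually at most [r], and the closed convex sublevel set of [f \o A] would contain [z]. *)
Lemma convex_lsc_liminf (R : realType) (I : Type) (G : set_system I)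
    (GU : UltraFilter G) (V Y : normedModType R) (A : {linear V -> Y})
    (f : Y -> \bar R) (x : I -> V) (z : V) :
  continuous A -> lower_semicontinuous f -> convex_ereal f ->
  (forall K, closed K -> convex_set K -> G (x @^-1` K) -> K z) ->
  liminf_ge G (fun i => f (A (x i))) (f (A z)).
Proof.
move=> cA lf vf zP r rz.
have [//|Gr] := in_ultra_setVsetC [set i | (r%:E < f (A (x i)))%E] GU.
have : (f (A z) <= r%:E)%E; last by rewrite leNgt rz.
apply: (zP [set u | (f (A u) <= r%:E)%E]).
- rewrite (_ : mkset _ = A @^-1` ~` [set y | (r%:E < f y)%E]).
    apply: closed_comp; first by move=> v _; exact: cA.
    by apply: open_closedC; move/lower_semicontinuousP : lf; exact.
  by apply/seteqP; split => u /=; rewrite leNgt => /negP.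
- move=> t u v /[dup] t01 /andP[t0 t1] /= fu fv; rewrite linearD !(linearZZ A).
  apply: le_trans (vf _ _ _ t01) _.
  rewrite (_ : r%:E = t%:E * r%:E + (1 - t)%:E * r%:E)%E.
    by rewrite leeD// lee_wpmul2l// lee_fin// subr_ge0.
  by rewrite -!EFinM -EFinD -mulrDl addrC subrK mul1r.
- by apply: filterS Gr => i /=; rewrite leNgt => /negP.
Qed.

Theorem theorem2p12 (R : realType) (d : nat) (d_gt0 : (0 < d)%N)
    (Omega Sigma : openset R d)
    (dom_Omega : bounded_domain Omega) (dom_Sigma : bounded_domain Sigma)
    (Sigma0 : oset Sigma 0)
    (net : network)
    (q : R) (q1 : 1 < q) (q2 : q <= 2)
    (Y : completeNormedModType R) (y : Y) (lambda nu : R)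
    (lambda_gt0 : 0 < lambda) (nu_gt0 : 0 < nu) (nu_lt1 : nu < 1)
    (D : Y -> Y -> \bar R)
    (D_ge0 : forall z, (0 <= D y z)%E) (D_proper : proper_fun (D y))
    (D_coercive : coercive (D y)) (D_lsc : lower_semicontinuous (D y))
    (D_convex : convex_ereal (D y))
    (A : {linear Lq Omega q1 -> Y})
    (A_bounded : bounded_near A (nbhs (0 : Lq Omega q1)))
    (Nc : nat) (Z : {linear Theta Sigma net -> 'rV[R]_Nc})
    (Z_bounded : exists K : R, forall th,
       `|Z th| <= K * \sum_(e : edges net) `|th e|)
    (J : forall j : 'I_(depth net).-1,
       layer_measures Omega Sigma net j.+1 -> \bar R)
    (J_ge0 : forall j mu, (0 <= J j mu)%E)
    (J_lsc : forall j, weakly_star_lsc (J j))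
    (J0 : forall j, J j (fun=> 0) = 0%E)
    (Rg : Lq Omega q1 -> \bar R)
    (Rg_ge0 : forall u, (0 <= Rg u)%E) (Rg_proper : proper_fun Rg)
    (Rg_lsc : weakly_lsc Rg)
    (U : set (Lq Omega q1)) (U_subspace : is_subspace U) (U_closed : closed U)
    (P : {linear Lq Omega q1 -> Lq Omega q1}) (P_continuous : continuous P)
    (P_onto : range P = U) (P_id : forall u, U u -> P u = u)
    (C : R) (C_gt0 : 0 < C)
    (Rg_invariant : forall u w, U w -> Rg u = Rg (u + w))
    (Rg_bound : forall u, (`|u - P u|%:E <= C%:E * Rg u)%E)
    (U_cases : finite_dimensional U \/
       exists W, complement_in U (U `&` [set u | A u = 0]) W /\
         exists2 D' : R, 0 < D' & forall u, W u -> `|u| <= D' * `|A u|)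
    (finite_energy : exists u, (Rg u < +oo)%E /\ (D y (A u) < +oo)%E) :
  let s_R := nu / Num.min nu (1 - nu) in
  let s_G := (1 - nu) / Num.min nu (1 - nu) in
  let E u v := (lambda%:E * D y (A u) + s_R%:E * Rg (u - v)%R
                + s_G%:E * generative_prior Z J v)%E in
  exists u v, forall u' v', (E u v <= E u' v')%E.
Proof.
move=> s_R s_G E.
have m0 : 0 < Num.min nu (1 - nu) by rewrite lt_min nu_gt0 subr_gt0.
have sR0 : 0 < s_R by rewrite divr_gt0.
have sG0 : 0 < s_G by rewrite divr_gt0// subr_gt0.
clearbody s_R s_G.
have bO : bounded_set Omega by case: dom_Omega.
have bS : bounded_set Sigma by case: dom_Sigma.
pose X := (measures Omega Sigma net * Theta Sigma net)%type.
pose adm : set X := [set mt | (forall e, `|mt.2 e| <= 1) /\ Z mt.2 = 0].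
pose fl (mt : X) : Lq Omega q1 := first_layer q1 mt.1 mt.2.
pose pe (mt : X) := prior_energy J mt.1 mt.2.
pose T u mt := (lambda%:E * D y (A u) + s_R%:E * Rg (u - fl mt)%R + s_G%:E * pe mt)%E.
have J_sum_ge0 (mt : X) : (0 <= \sum_(j < (depth net).-1)
     J j (fun k => (mt.1 (lower_index j) k - @layer_conv _ _ _ _ _ mt.1 mt.2 j k)%R))%E.
  by apply: sume_ge0 => j _; exact: J_ge0.
have norm_ge0 (mu : measures Omega Sigma net) : 0 <= measures_norm mu.
  by apply: sumr_ge0 => i _; apply: sumr_ge0 => k _; exact: dual_norm_ge0.
have pe_ge0 mt : (0 <= pe mt)%E by rewrite /pe /prior_energy adde_ge0// lee_fin.
have D0 u : (0 <= lambda%:E * D y (A u))%E by rewrite mule_ge0// lee_fin ltW.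
have R0 u : (0 <= s_R%:E * Rg u)%E by rewrite mule_ge0// lee_fin ltW.
have G0 mt : (0 <= s_G%:E * pe mt)%E by rewrite mule_ge0// lee_fin ltW.
suff [u [mt [adm_mt Tmin]]] : exists u mt, adm mt /\
    forall u' mt', adm mt' -> (T u mt <= T u' mt')%E.
  exists u, (fl mt) => u' v'.
  apply: (@le_trans _ _ (T u mt)).
    rewrite /E /T leeD2l// lee_wpmul2l ?lee_fin ?(ltW sG0)//.
    apply: ereal_inf_lbound; exists mt => //.
    by have [? ?] := adm_mt.
  have [a aE] : exists a, a = (lambda%:E * D y (A u') + s_R%:E * Rg (u' - v')%R)%E by eexists.
  rewrite /E -aE; have a0 : (0 <= a)%E by rewrite aE adde_ge0.
  (* Each admissible representation of [v'] is a competitor for [T]; the infimum over them is the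
     prior at [v'], infinite when there are none. *)
  have Ta mt' : admissible Z v' mt' -> (T u mt <= a + s_G%:E * pe mt')%E.
    by move=> [v'E h1 h2]; rewrite aE v'E; apply: (Tmin u' mt').
  (* The infimum can be moved past [a] when [a] is finite; for infinite [a] the right-hand side is
     infinite, since the prior is nonnegative. *)
  move: a a0 Ta {aE} => [a| |] // a0 Ta; last first.
    rewrite addye ?leey// gt_eqF// (@lt_le_trans _ _ 0%E)// mule_ge0 ?lee_fin ?(ltW sG0)//.
    by apply: le_ereal_inf_tmp => _ [mt' _ <-]; exact: pe_ge0.
  rewrite -leeBlDl// -lee_pdivrMl//.
  apply: le_ereal_inf_tmp => _ [mt' adm' <-].
  by rewrite lee_pdivrMl// leeBlDl//; exact: Ta.
have subN k : U k -> U (- k).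
  by move=> Uk; rewrite -scaleN1r -[_ *: _]addr0; apply: U_subspace.2 => //; exact: U_subspace.1.
have cA : continuous A by exact: bounded_linear_continuous.
have [KA KA0 AK] := linear_norm_bound A_bounded.
have [KP KP0 PK] := linear_norm_bound (@continuous_linear_bounded _ _ _ 0 P (P_continuous 0)).
have [D1 D1_ge0 kerU] := subspace_kernel_representative U_subspace U_cases.
pose mt0 : X := (fun _ _ => 0, 0).
have adm0 : adm mt0.
  split; last exact: linear0.
  by move=> e; rewrite /= normr0 ler01.
pose VV := [set T x.1 x.2 | x in [set x | adm x.2]].
have T_ge0 u mt : (0 <= T u mt)%E by rewrite /T !adde_ge0.
have inf_ge0 : (0 <= ereal_inf VV)%E.
  by apply: le_ereal_inf_tmp => _ [x _ <-]; exact: T_ge0.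
have inf_lb u mt : adm mt -> (ereal_inf VV <= T u mt)%E.
  by move=> amt; apply: ereal_inf_lbound; exists (u, mt).
(* If the infimum is infinite, any admissible point attains it, for instance the zero one. *)
case infE : (ereal_inf VV) inf_ge0 => [m| |] // m_ge0; last first.
  exists 0, mt0; split=> // u' mt' amt'.
  by rewrite (le_trans (leey _))// -infE inf_lb.
have [Kv KvP] := @first_layer_bounded R d Omega Sigma net bO bS q q1 q2 ((m + 1) / s_G).
have [MA MAP] := coercive_sublevel ((m + 1) / lambda) D_coercive.
(* [Ka] bounds [u - P u], written as [(u - v) - P (u - v) + v - P v] with [v = fl mt]: one term for
   the regulariser and one for each of [v] and [P v]. Then [A (P u)] is at most [MA + KA * Ka], and
   [Ku] adds the resulting bound on [P u - k] for a kernel element [k] of [U]. *)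
pose Ka := C * ((m + 1) / s_R) + `|Kv| + KP * `|Kv|.
pose Ku := Ka + D1 * (MA + KA * Ka).
have summand (a b c : \bar R) (r : R) : (0 <= a)%E -> (0 <= b)%E -> (0 <= c)%E ->
    (a + b + c <= r%:E)%E ->
    [/\ (a <= r%:E)%E, (b <= r%:E)%E & (c <= r%:E)%E].
  move=> a0 b0 c0 abc; split; apply: le_trans abc.
  - by rewrite -addeA leeDl// adde_ge0.
  - by rewrite addeAC leeDr// adde_ge0.
  - by rewrite leeDr// adde_ge0.
have bounds u mt : adm mt -> (T u mt <= (m + 1)%:E)%E ->
    [/\ `|A u| <= MA, (Rg (u - fl mt)%R <= ((m + 1) / s_R)%:E)%E,
        measures_norm mt.1 <= (m + 1) / s_G & `|fl mt| <= `|Kv|].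
  move=> amt Tm.
  have [h1 h2 h3] := summand _ _ _ _ (D0 u) (R0 (u - fl mt)%R) (G0 mt) Tm.
  have h4 : measures_norm mt.1 <= (m + 1) / s_G.
    rewrite -lee_fin mulrC EFinM (le_trans (_ : _ <= pe mt)%E)//.
      by rewrite /pe /prior_energy leeDl.
    by rewrite lee_pdivlMl.
  split=> //.
  - by apply: MAP; rewrite mulrC EFinM lee_pdivlMl.
  - by rewrite mulrC EFinM lee_pdivlMl.
  - by rewrite (le_trans (KvP _ _ h4 amt.1))// ler_norm.
have normalise u mt : adm mt -> (T u mt <= (m + 1)%:E)%E ->
    exists2 u', `|u'| <= Ku & T u' mt = T u mt.
  move=> amt Tm; have [h1 h2 _ h4] := bounds u mt amt Tm.
  set v := fl mt in h2 h4.
  have e1 : `|(u - v) - P (u - v)| <= C * ((m + 1) / s_R).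
    rewrite -lee_fin (le_trans (Rg_bound _))// EFinM lee_wpmul2l// lee_fin ltW//.
  have e2 : `|u - P u| <= Ka.
    rewrite (_ : u - P u = ((u - v) - P (u - v)) + v - P v); last first.
      rewrite linearB opprB [X in _ = X + _ - _]addrC -[X in _ = X - _]addrA subrK.
      by rewrite -addrA addrC addrA subrK.
    rewrite (le_trans (ler_normB _ _))// lerD//.
      by rewrite (le_trans (ler_normD _ _))// lerD.
    by rewrite (le_trans (PK v))// ler_pM2l.
  have e3 : `|A (P u)| <= MA + KA * Ka.
    rewrite (_ : P u = u - (u - P u)); last by rewrite opprB addrCA subrr addr0.
    rewrite linearB (le_trans (ler_normB _ _))// lerD// (le_trans (AK _))//.
    by rewrite ler_pM2l.
  have UPu : U (P u) by rewrite -P_onto; exists u.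
  have [k [Uk Ak ke]] := kerU _ UPu.
  exists (u - k).
    rewrite (_ : u - k = (u - P u) + (P u - k)); last by rewrite addrA subrK.
    rewrite (le_trans (ler_normD _ _))// lerD// (le_trans ke)// ler_wpM2l//.
  rewrite /T linearB Ak subr0 -/v (_ : u - k - v = (u - v) + (- k)); last by rewrite addrAC.
  by rewrite -Rg_invariant//; exact: subN.
have /choice[x xP] k : exists x : Lq Omega q1 * X,
    [/\ adm x.2, `|x.1| <= Ku & (T x.1 x.2 <= (m + k.+1%:R^-1)%:E)%E].
  have k0 : 0 < k.+1%:R^-1 :> R by rewrite invr_gt0.
  have [|_ [[u mt] /= amt <-] Tk] := @lb_ereal_inf_adherent _ VV k.+1%:R^-1 k0.
    by rewrite infE.
  rewrite infE -EFinD in Tk.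
  have Tm : (T u mt <= (m + 1)%:E)%E.
    by rewrite (le_trans (ltW Tk))// lee_fin lerD2l invf_le1// ler1n.
  have [u' u'K Tu'] := normalise u mt amt Tm.
  by exists (u', mt); split=> //=; rewrite Tu' ltW.
have Tx k : (T (x k).1 (x k).2 <= (m + 1)%:E)%E.
  have [_ _ h] := xP k; rewrite (le_trans h)// lee_fin lerD2l invf_le1//.
  by rewrite ler1n.
have [G [GU GN]] := ultraFilterLemma eventually_filter.
have xadm k : adm (x k).2 by have [] := xP k.
have ux k : `|(x k).1| <= Ku by have [] := xP k.
have vx k : `|fl (x k).2| <= `|Kv| by have [] := bounds _ _ (xadm k) (Tx k).
have nx k : measures_norm (x k).2.1 <= (m + 1) / s_G by have [] := bounds _ _ (xadm k) (Tx k).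
have thx k e : `|(x k).2.2 e| <= 1 by exact: (xadm k).1.
have ucq : uniformly_convex (Lq Omega q1) by exact: Lp_uniformly_convex.
have [z zP] := @weak_ultralimit _ _ G GU (Lq Omega q1) (fun k => (x k).1) Ku ucq ux.
(* The limit of the first layers is taken in L^q and only afterwards identified with the first layer
   of the limits: the convergence of convolutions is tested on [Cc] alone, whereas [Rg] needs all
   functionals on L^q. *)
have [v vP] := @weak_ultralimit _ _ G GU (Lq Omega q1) (fun k => fl (x k).2) `|Kv| ucq vx.
have zc phi := @ultra_functional R nat G GU (Lq Omega q1) _ Ku z phi ux zP.
have vc phi := @ultra_functional R nat G GU (Lq Omega q1) _ `|Kv| v phi vx vP.
have [mu mu_cvg] := @measures_ultralimit R d Omega Sigma net nat G GU (fun k => (x k).2.1) _ nx.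
have [th [th1 th_cvg]] := @Theta_ultralimit R d Sigma net nat G GU (fun k => (x k).2.2) thx.
have Zth : Z th = 0.
  by apply: (@Z_ultralimit R d Sigma net nat G GU (fun k => (x k).2.2)) => // k; exact: (xadm k).2.
have vE : v = fl (mu, th).
  exact: (@first_layer_weak_limit R d Omega Sigma net bO bS q q1 q2 nat G GU
    (fun k => (x k).2.1) (fun k => (x k).2.2) _ nx thx mu th mu_cvg th1 th_cvg v vc).
exists z, (mu, th); split; first by [].
move=> u' mt' amt'; apply: le_trans (inf_lb u' mt' amt'); rewrite infE.
apply: (@liminf_ge_le _ _ G GU (fun k => T (x k).1 (x k).2)); last first.
  move=> r; rewrite lte_fin -subr_gt0 => rm; apply: GN.
  have := @near_infty_natSinv_lt R (PosNum rm); apply: filterS => k /= km.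
  have [_ _ h] := xP k; rewrite (le_trans h)// lee_fin.
  by rewrite -lerBrDl ltW.
have pe_lim : liminf_ge G (fun k => pe (x k).2) (pe (mu, th)).
  rewrite /pe /prior_energy; apply: liminf_geD => //;
    try by [move=> k; rewrite lee_fin|rewrite lee_fin].
    have nE (m' : measures Omega Sigma net) : (measures_norm m')%:E =
        (\sum_(i < depth net) \sum_(n < width net i.+1) (dual_norm (m' i n))%:E)%E.
      by rewrite /measures_norm -sumEFin; apply: eq_bigr => i _; rewrite sumEFin.
    rewrite nE (_ : (fun i : nat => (measures_norm (x i).2.1)%:E) = (fun k =>
        \sum_(i < depth net) \sum_(n < width net i.+1) (dual_norm ((x k).2.1 i n))%:E)%E);
      last by apply/funext => k; rewrite nE.
    have dn0 V (m' : dual V) : (0 <= (dual_norm m')%:E :> \bar R)%E.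
      by rewrite lee_fin dual_norm_ge0.
    apply: liminf_ge_sum => [i k|i|i]; try by apply: sume_ge0 => n _; exact: dn0.
    apply: liminf_ge_sum => [n k|n|n]; try exact: dn0.
    by apply: liminf_ge_dual_norm => p; exact: mu_cvg.
  apply: liminf_ge_sum => [j k|j|j]; try exact: J_ge0.
  apply: (weakly_star_lsc_liminf (m := fun k n => (x k).2.1 (lower_index j) n -
    layer_conv (x k).2.1 (x k).2.2 n) (J_lsc j)) => n p.
  rewrite -[X in _ --> X]/(mu (lower_index j) n p - layer_conv mu th n p).
  apply: cvgB; first exact: mu_cvg.
  exact: (@layer_conv_cvg R d Omega Sigma net bO bS nat G GU
    (fun k => (x k).2.1) (fun k => (x k).2.2) _ nx thx mu th mu_cvg th1 th_cvg).
apply: liminf_geD => //.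
- by move=> k; rewrite adde_ge0.
- by rewrite adde_ge0.
- apply: liminf_geD => //.
    apply: liminf_geZ => //; exact: convex_lsc_liminf zP.
  apply: liminf_geZ => //; rewrite -vE.
  apply: (@weakly_lsc_liminf _ _ G _ _ _ (fun k => (x k).1 - fl (x k).2)) => // phi.
  rewrite dualB; under eq_fun do rewrite dualB.
  by apply: cvgB; [exact: zc|exact: vc].
- exact: liminf_geZ.
Qed.
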